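(* For $a\in\{0,1,2,3\}$ let $(\pi_{\omega_a},\mathcal H_{\omega_a},\Omega_{\omega_a})$ be the GNS triple of the state $\omega_a$ on $\mathfrak B_0$, where $$\omega_0,\qquad \omega_1=\omega_0\circ\beta^{*-1},\qquad \omega_2=\omega_0\circ\beta^{*-1}\circ\Delta,\qquad \omega_3=\omega_0\circ\Delta .$$ Then the transfer matrices $T_{\omega_0,\alpha_i^0}$, $T_{\omega_1,\alpha_i^1}$, $T_{\omega_2,\alpha_i^2}$, $T_{\omega_3,\alpha_i^3}$, acting on $\mathcal H_{\omega_0},\dots,\mathcal H_{\omega_3}$ respectively and defined by $$T_{\omega_a,\alpha_i^a}\,\pi_{\omega_a}(A)\Omega_{\omega_a}=\pi_{\omega_a}(\alpha_i^a(A))\Omega_{\omega_a},\qquad A\in\mathfrak B_0,$$ are unitarily equivalent.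
   Context: **Algebras.** Fix an integer $N\ge2$; indices in $\{0,\dots,N-1\}$ are read mod $N$. On $\mathbb Z^2$ consider sites $x$, oriented bonds $b$ ($-b$ is the reversed bond) and oriented plaquettes $p$ (positive = counterclockwise). Each site $x$ carries unitary matrices $Q_H(x),P_H(x)$ on a copy of $\mathbb C^N$, and each positively oriented bond $b$ carries $Q_G(b),P_G(b)$ on another copy, each pair having matrix elements $P_{a,c}=\delta_{a,c+1\bmod N}$, $Q_{a,c}=\delta_{a,c}e^{2\pi i a/N}$; operators on different copies commute; $Q_G(-b)=Q_G(b)^{-1}$, $P_G(-b)=P_G(b)^{-1}$. $\mathfrak F_0$ is the unital $*$-algebra they generate, $\mathfrak F$ its $C^*$-completion. Put $[\delta Q_H](b)=Q_H(y)Q_H(x)^*$ for $b$ from $x$ to $y$, $[\delta Q_G](p)=\prod_{b\in\partial p}Q_G(b)$, $[\delta^*P_G](x)=\prod_{b\text{ starting at }x}P_G(b)$, $\mathcal Q(x)=P_H(x)[\delta^*P_G](x)^*$. $\mathfrak A$ (resp. $\mathfrak A_0$) is the set of elements of $\mathfrak F$ (resp. $\mathfrak F_0$) commuting with all $\mathcal Q(x)$; $J$ is the closed two-sided ideal of $\mathfrak A$ generated by all $\mathcal Q(x)^k-1$; $\mathfrak B=\mathfrak A/J$, and $\mathfrak B_0$ is the image of $\mathfrak A_0$. $\mathfrak B_0$ is generated by $U_1(b)=P_G(b)+J$ and $U_3(b)=[\delta Q_H](b)Q_G(b)^*+J$. Maps and states compatible with $J$ are also regarded as maps and states on $\mathfrak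 B_0$. **Couplings.** $\mathcal F[\rho](m)=N^{-1/2}\sum_{v=0}^{N-1}\rho(v)e^{2\pi i mv/N}$. The couplings are given by functions $g,h:\{0,\dots,N-1\}\to(0,\infty)$ with $g(0)=h(0)=1$, $g(n)=g(N-n)$, $h(n)=h(N-n)$, $\mathcal F[g]>0$, $\mathcal F[h]>0$. Real functions $\beta_g,\beta_h,\gamma_g,\gamma_h$ are defined by $\mathcal F[\beta_g]=\ln g$, $\mathcal F[\beta_h]=\ln\mathcal F[h]$, $\mathcal F[\gamma_g]=\ln\mathcal F[g]$, $\mathcal F[\gamma_h]=\ln h$. The dual couplings are obtained by exchanging $g$ and $h$, i.e. $(\beta_g,\beta_h,\gamma_g,\gamma_h)\to(\gamma_h,\gamma_g,\beta_h,\beta_g)$; a prime on an automorphism or state means the same object built with the dual couplings. **Dynamics.** An automorphism is a linear multiplicative bijection, not necessarily $*$-preserving; $\gamma^*(A):=(\gamma(A^* ))^*$ and $\gamma^{*-1}:=(\gamma^* )^{-1}$. For a finite square $V\subset\mathbb Z^2$ centered at $0$ put (sums over positively oriented cells in $V$) $A_V=N^{-1/2}\sum_p\sum_n\beta_g(n)[\delta Q_G](p)^n+N^{-1/2}\sum_b\sum_n\beta_h(n)([\delta Q_H](b)Q_G(b)^* )^n$, $B_V=N^{-1/2}\sum_b\sum_n\gamma_g(n)P_G(b)^n+N^{-1/2}\sum_x\sum_n\gamma_h(n)P_H(x)^n$, $T_V=e^{A_V/2}e^{B_V}e^{A_V/2}$, $S_V=e^{B_V/2}e^{A_V/2}$.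 Then $\beta(A)=\lim_{V\uparrow\mathbb Z^2}S_VAS_V^{-1}$ ($A\in\mathfrak F_0$) defines an automorphism of $\mathfrak F_0$ and of $\mathfrak B_0$. Put $\alpha_i=\beta^{*-1}\circ\beta=\lim_V T_V\,\cdot\,T_V^{-1}$, and $\alpha_i^0=\alpha_i$, $\alpha_i^1=\beta\circ\beta^{*-1}$, $\alpha_i^2=\alpha_i'$, $\alpha_i^3=(\alpha_i^1)'$. **Vacuum.** A state $\omega$ on a unital $*$-algebra $\mathfrak C$ is a ground state with respect to an automorphism $\gamma$ if $0\le\omega(A^*\gamma(A))\le\omega(A^*A)$ for all $A\in\mathfrak C$. Let $\omega_V$ be the vector state of the (Perron–Frobenius, unique up to phase) eigenvector of $T_V$ for its largest eigenvalue on the tensor product of the copies of $\mathbb C^N$ in $V$, and $\omega_0=\lim_{V\uparrow\mathbb Z^2}\omega_V$ on $\mathfrak F_0$; the couplings are such that this limit exists. $\omega_0$ is translation invariant, vanishes on $J$, and is a ground state with respect to $\alpha_i$. **Duality.** $\Delta$ is the $*$-automorphism of $\mathfrak B_0$ with $\Delta(U_1(b))=U_3(-{*b})$, $\Delta(U_3(b))=U_1({*b})$, where $*b$ is obtained by rotating the oriented bond $b$ by $+90^\circ$ about its midpoint and then translating by $(1/2,1/2)$. *)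

(* Defs.v *)
From HB Require Import structures.
From mathcomp Require Import all_boot all_order all_algebra.
From mathcomp Require Import complex zify.
From mathcomp Require Import all_classical all_reals all_analysis.

Set Implicit Arguments.
Unset Strict Implicit.
Unset Printing Implicit Defensive.

Import Order.TTheory GRing.Theory Num.Theory.
Import numFieldNormedType.Exports.

Local Open Scope classical_set_scope.
Local Open Scope ring_scope.
Local Open Scope complex_scope.
Local Open Scope quotient_scope.

(* The hierarchies of mathcomp's algebras and of mathcomp-analysis' normed
   modules have no common join, so the C*-norm, convergence and the exponential
   are introduced here on top of [algType]. *)

Record cstarAlgebra (R : realType) := CStarAlgebra {
  cs_sort :> algType R[i];
  star : cs_sort -> cs_sort;
  cnorm : cs_sort -> R;
  starK : involutive star;
  star_lin : forall (k : R[i]) a b, star (k *: a + b) = k^*%R *: star a + star b;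
  starM : forall a b, star (a * b) = star b * star a;
  cnorm_eq0 : forall a, cnorm a = 0 -> a = 0;
  cnormD : forall a b, cnorm (a + b) <= cnorm a + cnorm b;
  cnormZ : forall (k : R[i]) a, (cnorm (k *: a))%:C = `|k| * (cnorm a)%:C;
  cnormM : forall a b, cnorm (a * b) <= cnorm a * cnorm b;
  cnorm_star : forall a, cnorm (star a * a) = cnorm a ^+ 2;
  cnorm_complete : forall u : nat -> cs_sort,
    (forall e : R, 0 < e -> exists n0 : nat, forall n m : nat,
       (n0 <= n)%N -> (n0 <= m)%N -> cnorm (u n - u m) < e) ->
    exists l, (fun n => cnorm (u n - l)) @ \oo --> (0 : R)
}.

Section CStar.
Variables (R : realType) (A : cstarAlgebra R).
Implicit Types (u : nat -> A) (l a : A) (S : set A).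

Definition cs_cvg u l := (fun n => cnorm (u n - l)) @ \oo --> (0 : R).

Definition cs_lim u : A := xget 0 [set l | cs_cvg u l].

Definition cs_closed S :=
  forall u l, (forall n, S (u n)) -> cs_cvg u l -> S l.

Definition cs_dense S :=
  forall a (e : R), 0 < e -> exists2 b, S b & cnorm (a - b) < e.

Definition cs_exp a : A :=
  cs_lim (fun n => \sum_(k < n) (k`!%:R)^-1 *: a ^+ k).

Inductive star_gen S : set A :=
| star_gen_in a : S a -> star_gen S a
| star_gen1 : star_gen S 1
| star_gen_lin (k : R[i]) a b :
    star_gen S a -> star_gen S b -> star_gen S (k *: a + b)
| star_genM a b : star_gen S a -> star_gen S b -> star_gen S (a * b)
| star_gen_star a : star_gen S a -> star_gen S (star a).

Definition unitary_elt a := star a * a = 1 /\ a * star a = 1.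

Lemma star1 : star (1 : A) = 1.
Proof. by rewrite -[LHS]mul1r -{1}(starK 1) -starM mul1r starK. Qed.

Lemma star0 : star (0 : A) = 0.
Proof.
have := star_lin (-1) (0 : A) 0.
by rewrite scaler0 add0r rmorphN1 scaleN1r addNr.
Qed.

Lemma starD a b : star (a + b) = star a + star b.
Proof. by rewrite -{1}[a]scale1r star_lin rmorph1 scale1r. Qed.

Lemma starZ (k : R[i]) a : star (k *: a) = k^*%R *: star a.
Proof. by rewrite -[k *: a]addr0 star_lin star0 addr0. Qed.

Lemma starN a : star (- a) = - star a.
Proof. by rewrite -scaleN1r starZ rmorphN1 scaleN1r. Qed.

Lemma starX a n : star (a ^+ n) = star a ^+ n.
Proof.
elim: n => [|n IH]; first by rewrite !expr0 star1.
by rewrite exprS starM IH exprSr.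
Qed.

Lemma cnorm_ge0 a : 0 <= cnorm a.
Proof.
have h k : cnorm (k *: a) = complex.Re `|k| * cnorm a.
  have /(congr1 (@complex.Re _)) /= := cnormZ k a.
  by move=> ->; case: `|k| => x y /=; rewrite mulr0 subr0.
have := cnormD a (-1 *: a).
rewrite scaleN1r subrr -scaleN1r h normrN1 /= mul1r.
have -> : cnorm (0 : A) = 0 by rewrite -(scale0r a) h normr0 /= mul0r.
by rewrite -mulr2n pmulrn_lge0.
Qed.

Lemma cnorm_starE a : cnorm (star a) = cnorm a.
Proof.
have le (b : A) : cnorm b <= cnorm (star b).
  have [b0|b0] := eqVneq (cnorm b) 0; first by rewrite b0 cnorm_ge0.
  rewrite -(@ler_pM2r _ (cnorm b)); last by rewrite lt_def b0 cnorm_ge0.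
  by rewrite -expr2 -cnorm_star cnormM.
by apply/eqP; rewrite eq_le le -{2}(starK a) le.
Qed.

Lemma unitary1 : unitary_elt 1.
Proof. by rewrite /unitary_elt star1 mul1r. Qed.

Lemma unitaryM a b : unitary_elt a -> unitary_elt b -> unitary_elt (a * b).
Proof.
move=> [a1 a2] [b1 b2]; split; rewrite starM.
  by rewrite mulrA -(mulrA (star b)) a1 mulr1.
by rewrite mulrA -(mulrA a) b2 mulr1.
Qed.

Lemma unitary_star a : unitary_elt a -> unitary_elt (star a).
Proof. by move=> [a1 a2]; split; rewrite starK. Qed.

Lemma comm_unitary_star a b :
  unitary_elt b -> GRing.comm a b -> GRing.comm a (star b).
Proof.
move=> [b1 b2] ab; rewrite /GRing.comm -[LHS]mul1r -b1 -[in RHS](mulr1 a) -b2.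
by rewrite -!mulrA (mulrA a b) ab !mulrA.
Qed.

End CStar.

Section Lattice.

Definition site := (int * int)%type.

Definition unit_vec (d : bool) : site := if d then (0, 1) else (1, 0).

(* (x, d) is the positively oriented bond from x to x + unit_vec d. *)
Definition pbond := (site * bool)%type.

(* (b, true) is b itself, (b, false) is -b. *)
Definition bond := (pbond * bool)%type.

(* Cells carrying a copy of C^N: sites and positively oriented bonds. *)
Definition cell := (site + pbond)%type.

Definition bond_opp (b : bond) : bond := (b.1, ~~ b.2).
Definition bond_src (b : bond) : site :=
  if b.2 then b.1.1 else b.1.1 + unit_vec b.1.2.
Definition bond_tgt (b : bond) : site :=
  if b.2 then b.1.1 + unit_vec b.1.2 else b.1.1.

(* A positive plaquette is given by its lower left corner. *)
Definition boundary (p : site) : seq bond :=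
  [:: (p, false, true); (p + unit_vec false, true, true);
      (p + unit_vec true, false, false); (p, true, false)].

Definition bonds_from (x : site) : seq bond :=
  [:: (x, false, true); (x, true, true);
      (x - unit_vec false, false, false); (x - unit_vec true, true, false)].

(* b |-> *b *)
Definition dual_bond (b : bond) : bond :=
  let: ((x, d), o) := b in
  if d then (x + unit_vec true, false, ~~ o) else (x + unit_vec false, true, o).

Definition rot90 (v : site) : site := (- v.2, v.1).

(* The end points of *b, in doubled coordinates: the midpoint of b is
   (src b + tgt b) / 2. *)
Lemma dual_bondP (b : bond) :
  bond_src (dual_bond b) *+ 2 =
    bond_src b + bond_tgt b + rot90 (bond_src b - bond_tgt b) + (1, 1) /\
  bond_tgt (dual_bond b) *+ 2 =
    bond_src b + bond_tgt b + rot90 (bond_tgt b - bond_src b) + (1, 1).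
Proof.
case: b => [[[x y] [|]] [|]];
  rewrite /bond_src /bond_tgt /dual_bond /rot90 /unit_vec /= !mulr2n.
all: split; congr pair => /=.
all: by rewrite -?[(_.1)]/_ /= ?addr0 ?oppr0; lia.
Qed.

(* The square V_L = [-L, L]^2. *)
Definition box_sites (L : nat) : seq site :=
  [seq (i%:Z - L%:Z, j%:Z - L%:Z) | i <- iota 0 (2 * L).+1, j <- iota 0 (2 * L).+1].

Definition box_bonds (L : nat) : seq pbond :=
  [seq b <- [seq (x, d) | x <- box_sites L, d <- [:: false; true]]
     | b.1 + unit_vec b.2 \in box_sites L].

Definition box_plaquettes (L : nat) : seq site :=
  [seq p <- box_sites L | p + unit_vec false + unit_vec true \in box_sites L].

Definition box_cells (L : nat) : seq cell :=
  [seq inl x | x <- box_sites L] ++ [seq inr b | b <- box_bonds L].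

Definition box_conf (N L : nat) := {ffun seq_sub (box_cells L) -> 'I_N}.

End Lattice.

Section Matrices.
Variables (R : realType) (N : nat).

(* exp (2 pi i k / N) *)
Definition root_unity (k : nat) : R[i] :=
  let t : R := 2 * pi * k%:R / N%:R in cos t +i* sin t.

Definition P_mx : 'M[R[i]]_N :=
  \matrix_(a < N, c < N) (a == c.+1 %% N :> nat)%N%:R.

Definition Q_mx : 'M[R[i]]_N :=
  \matrix_(a < N, c < N) ((a == c)%:R * root_unity a).

Definition adj_mx n (M : 'M[R[i]]_n) : 'M[R[i]]_n :=
  \matrix_(a, c) (M c a)^*%R.

Lemma P_mx_unitary : adj_mx P_mx *m P_mx = 1%:M.
Proof.
apply/matrixP => a c; rewrite !mxE.
have N0 : (0 < N)%N by apply: leq_ltn_trans (ltn_ord a).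
have inj (b d : 'I_N) : (b.+1 %% N == d.+1 %% N)%N = (b == d).
  rewrite -[b.+1]addn1 -[d.+1]addn1 eqn_modDr !modn_small //.
rewrite (bigD1 (Ordinal (ltn_pmod a.+1 N0))) //= !mxE /= eqxx rmorph1 mul1r.
rewrite inj big1 ?addr0 // => k /eqP ka; rewrite !mxE.
case: eqP => [e|_]; last by rewrite rmorph0 mul0r.
by case: ka; apply: val_inj.
Qed.

End Matrices.

(* Commuting copies of M_N(C), one for each cell, inside a C*-algebra which is
   the closure of the *-algebra generated by the matrices P and Q at all cells.
   A family of this kind is unique up to isomorphism: the *-algebra is the
   algebraic tensor product of the copies, and it has a unique C*-norm. *)

Definition PQ_gen (R : realType) (N : nat) (A : cstarAlgebra R)
    (cell_mx : cell -> 'M[R[i]]_N -> A) (V : set cell) : set A :=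
  star_gen [set a | exists2 c, V c & a = cell_mx c (P_mx R N) \/
                                     a = cell_mx c (Q_mx R N)].

Record fieldAlgebra (R : realType) (N : nat) := FieldAlgebra {
  fa_alg :> cstarAlgebra R;
  cell_mx : cell -> 'M[R[i]]_N -> fa_alg;
  cell_mx_lin : forall c (k : R[i]) M M',
    cell_mx c (k *: M + M') = k *: cell_mx c M + cell_mx c M';
  cell_mxM : forall c M M', cell_mx c (M *m M') = cell_mx c M * cell_mx c M';
  cell_mx1 : forall c, cell_mx c 1%:M = 1;
  cell_mx_star : forall c M, cell_mx c (adj_mx M) = star (cell_mx c M);
  cell_mx_comm : forall c c' M M',
    c != c' -> GRing.comm (cell_mx c M) (cell_mx c' M');
  cell_mx_dense : cs_dense (PQ_gen cell_mx setT)
}.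

Section Fields.
Variables (R : realType) (N : nat) (FA : fieldAlgebra R N).

Definition F0 : set FA := PQ_gen (@cell_mx R N FA) setT.

Definition P_H (x : site) : FA := cell_mx FA (inl x) (P_mx R N).
Definition Q_H (x : site) : FA := cell_mx FA (inl x) (Q_mx R N).

Definition P_G (b : bond) : FA :=
  let a := cell_mx FA (inr b.1) (P_mx R N) in if b.2 then a else star a.
Definition Q_G (b : bond) : FA :=
  let a := cell_mx FA (inr b.1) (Q_mx R N) in if b.2 then a else star a.

Definition dQ_H (b : bond) : FA := Q_H (bond_tgt b) * star (Q_H (bond_src b)).
Definition dQ_G (p : site) : FA := \prod_(b <- boundary p) Q_G b.
Definition dstar_P_G (x : site) : FA := \prod_(b <- bonds_from x) P_G b.

Definition gauss (x : site) : FA := P_H x * star (dstar_P_G x).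

Definition algA : set FA := [set a | forall x, GRing.comm a (gauss x)].
Definition algA0 : set FA := F0 `&` algA.

Definition closed_ideal (I : set FA) : Prop :=
  [/\ I `<=` algA, I 0, (forall a b, I a -> I b -> I (a + b)),
      (forall a b, algA a -> I b -> I (a * b) /\ I (b * a)) & cs_closed I].

Definition idealJ : set FA :=
  \bigcap_(I in [set I | closed_ideal I /\
                         forall x (k : nat), I (gauss x ^+ k - 1)]) I.

Lemma P_unitary c : unitary_elt (cell_mx FA c (P_mx R N)).
Proof.
split; rewrite -cell_mx_star -cell_mxM -(cell_mx1 FA c).
  by rewrite P_mx_unitary.
by rewrite (mulmx1C (P_mx_unitary R N)).
Qed.

Lemma P_G_unitary b : unitary_elt (P_G b).
Proof.
by rewrite /P_G; case: b.2; [|apply: unitary_star]; apply: P_unitary.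
Qed.

Lemma dstar_P_G_unitary x : unitary_elt (dstar_P_G x).
Proof.
rewrite /dstar_P_G; elim/big_ind: _ => //.
- exact: unitary1.
- exact: unitaryM.
by move=> b _; exact: P_G_unitary.
Qed.

Lemma gauss_unitary x : unitary_elt (gauss x).
Proof.
apply: unitaryM; first exact: P_unitary.
exact/unitary_star/dstar_P_G_unitary.
Qed.

Lemma P_comm c c' :
  GRing.comm (cell_mx FA c (P_mx R N)) (cell_mx FA c' (P_mx R N)).
Proof. by have [->|cc'] := eqVneq c c'; [|exact: cell_mx_comm]. Qed.

Lemma P_P_G_comm c b : GRing.comm (cell_mx FA c (P_mx R N)) (P_G b).
Proof.
rewrite /P_G; case: b.2; first exact: P_comm.
by apply: comm_unitary_star; [exact: P_unitary|exact: P_comm].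
Qed.

Lemma P_dstar_comm c x : GRing.comm (cell_mx FA c (P_mx R N)) (dstar_P_G x).
Proof. by apply: commr_prod => b _; apply: P_P_G_comm. Qed.

Lemma P_gauss_comm c x : GRing.comm (cell_mx FA c (P_mx R N)) (gauss x).
Proof.
apply: commrM; first exact: P_comm.
apply: comm_unitary_star; [exact: dstar_P_G_unitary|exact: P_dstar_comm].
Qed.

Lemma algA_lin k a b : algA a -> algA b -> algA (k *: a + b).
Proof.
move=> aA bA x; rewrite /GRing.comm mulrDl mulrDr -scalerAl -scalerAr.
by rewrite aA bA.
Qed.

Lemma algA1 : algA 1.
Proof. by move=> x; apply/commr_sym/commr1. Qed.

Lemma algA_const k : algA (k *: 1).
Proof. by move=> x; rewrite /GRing.comm -scalerAl -scalerAr mul1r mulr1. Qed.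

Lemma algAM a b : algA a -> algA b -> algA (a * b).
Proof. by move=> aA bA x; apply/commr_sym/commrM; apply/commr_sym. Qed.

Lemma algAX a n : algA a -> algA (a ^+ n).
Proof. by move=> aA x; apply/commr_sym/commrX/commr_sym. Qed.

Lemma algA_star a : algA a -> algA (star a).
Proof.
move=> aA x; have /(congr1 (@star _ _)) := comm_unitary_star (gauss_unitary x) (aA x).
by rewrite (starM a) (starM _ a) starK => h; rewrite /GRing.comm h.
Qed.

Lemma gauss_algA x : algA (gauss x).
Proof.
have PGA b : algA (P_G b).
  rewrite /P_G; case: b.2; last apply: algA_star; move=> y; exact: P_gauss_comm.
apply: algAM; first by move=> y; exact: P_gauss_comm.
apply: algA_star; rewrite /dstar_P_G; elim/big_ind: _ => //.
- exact: algA1.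
- exact: algAM.
Qed.

Lemma algA0_lin k a b : algA0 a -> algA0 b -> algA0 (k *: a + b).
Proof.
by move=> [? ?] [? ?]; split; [exact: star_gen_lin|exact: algA_lin].
Qed.

Lemma algA0_1 : algA0 1.
Proof. by split; [exact: star_gen1|exact: algA1]. Qed.

Lemma algA0_0 : algA0 0.
Proof. by rewrite -(addNr 1) -scaleN1r; apply: algA0_lin; exact: algA0_1. Qed.

Lemma algA0M a b : algA0 a -> algA0 b -> algA0 (a * b).
Proof. by move=> [? ?] [? ?]; split; [exact: star_genM|exact: algAM]. Qed.

Lemma algA0_star a : algA0 a -> algA0 (star a).
Proof. by move=> [? ?]; split; [exact: star_gen_star|exact: algA_star]. Qed.

Lemma idealJ0 : idealJ 0.
Proof. by move=> I [[]]. Qed.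

Lemma idealJD a b : idealJ a -> idealJ b -> idealJ (a + b).
Proof.
move=> aJ bJ I II; case: (II) => -[_ _ h _ _] _.
by apply: h; [exact: aJ|exact: bJ].
Qed.

Lemma idealJMl a b : algA a -> idealJ b -> idealJ (a * b).
Proof.
move=> aA bJ I II; case: (II) => -[_ _ _ h _] _.
by have [] := h a b aA (bJ _ II).
Qed.

Lemma idealJMr a b : algA a -> idealJ b -> idealJ (b * a).
Proof.
move=> aA bJ I II; case: (II) => -[_ _ _ h _] _.
by have [] := h a b aA (bJ _ II).
Qed.

Lemma idealJZ k a : idealJ a -> idealJ (k *: a).
Proof.
by move=> aJ; rewrite -[a]mul1r scalerAl; apply: idealJMl => //; exact: algA_const.
Qed.

Lemma idealJN a : idealJ a -> idealJ (- a).
Proof. by rewrite -scaleN1r; exact: idealJZ. Qed.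

Lemma idealJ_star a : idealJ a -> idealJ (star a).
Proof.
move=> aJ I [[IA I0 ID IM Icl] Ig].
suff : [set b | I (star b)] a by [].
apply: aJ; split => [|x k /=].
  split => /= [b Ib||b c Ib Ic|b c bA Ic|u l Iu ul].
  - by rewrite -(starK b); apply/algA_star/IA.
  - by rewrite star0.
  - by rewrite starD; apply: ID.
  - by rewrite !starM; have [] := IM (star b) (star c) (algA_star bA) Ic.
  - apply: (Icl (fun n => star (u n))) => //; rewrite /cs_cvg.
    under eq_fun => n do rewrite -starN -starD cnorm_starE.
    exact: ul.
have [g1 g2] := gauss_unitary x.
have gX n : star (gauss x) ^+ n * gauss x ^+ n = 1.
  rewrite -exprMn_comm; first by rewrite g1 expr1n.
  by rewrite /GRing.comm g1 g2.
rewrite starD starN star1 starX.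
have -> : star (gauss x) ^+ k - 1 =
          (- star (gauss x) ^+ k) * (gauss x ^+ k - 1).
  by rewrite mulrBr mulr1 mulNr gX opprK addrC.
have [] // := IM (- star (gauss x) ^+ k) _ _ (Ig x k).
rewrite -scaleN1r -[_ *: _]addr0; apply: algA_lin.
  exact/algAX/algA_star/gauss_algA.
by move=> y; apply/commr_sym/commr0.
Qed.

Definition A0_pred : {pred FA} := fun a => `[< algA0 a >].

Lemma A0_predP a : reflect (algA0 a) (a \in A0_pred).
Proof. exact: asboolP. Qed.

Lemma A0_pred_closed : GRing.subsemialg_closed A0_pred.
Proof.
split.
- exact/A0_predP/algA0_1.
- split=> [|a b /A0_predP aA /A0_predP bA]; apply/A0_predP; first exact: algA0_0.
  by rewrite -[a]scale1r; apply: algA0_lin.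
- move=> k a /A0_predP aA; apply/A0_predP.
  by rewrite -[k *: a]addr0; apply: algA0_lin => //; exact: algA0_0.
- by move=> a b /A0_predP aA /A0_predP bA; apply/A0_predP/algA0M.
Qed.

HB.instance Definition _ := GRing.isSubalgClosed.Build R[i] FA A0_pred A0_pred_closed.

Definition A0 : Type := {a : FA | a \in A0_pred}.
HB.instance Definition _ := [isSub of A0 for (@sval FA _)].
HB.instance Definition _ := [Choice of A0 by <:].
HB.instance Definition _ := [SubChoice_isSubAlgebra of A0 by <:].

End Fields.

(* B0 = A0 / (A0 `&` J), the image of A0 in A / J. *)
Section Quotient.
Variables (R : realType) (N : nat) (FA : fieldAlgebra R N).

Definition eqJ : rel (A0 FA) := fun a b => `[< idealJ (val a - val b) >].

Lemma eqJP a b : reflect (idealJ (val a - val b)) (eqJ a b).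
Proof. exact: asboolP. Qed.

Lemma eqJ_refl : reflexive eqJ.
Proof. by move=> a; apply/eqJP; rewrite subrr; exact: idealJ0. Qed.

Lemma eqJ_sym : symmetric eqJ.
Proof.
suff h a b : eqJ a b -> eqJ b a by move=> a b; apply/idP/idP; exact: h.
by move/eqJP/idealJN; rewrite opprB => ?; exact/eqJP.
Qed.

Lemma eqJ_trans : transitive eqJ.
Proof.
move=> b a c /eqJP ab /eqJP bc; apply/eqJP.
by rewrite -(subrK (val b) (val a)) -addrA; exact: idealJD.
Qed.

Canonical eqJ_equiv := EquivRel eqJ eqJ_refl eqJ_sym eqJ_trans.

Definition B0 : Type := {eq_quot eqJ_equiv}.
HB.instance Definition _ := Choice.on B0.
HB.instance Definition _ := EqQuotient.on B0.

Implicit Types (a b : A0 FA) (u v w : B0).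

Lemma val_algA a : algA (val a).
Proof. by have /A0_predP [] := valP a. Qed.

Fact A0_star_subproof a : star (val a) \in @A0_pred R N FA.
Proof. by apply/A0_predP/algA0_star/A0_predP; exact: valP. Qed.

Definition A0_star a : A0 FA := Sub (star (val a)) (A0_star_subproof a).

Lemma pi_eqP a b : \pi_B0 a = \pi_B0 b <-> idealJ (val a - val b).
Proof.
split=> [/eqquotP|h]; first by move/eqJP.
by apply/eqquotP/eqJP.
Qed.

Lemma repr_piP a : idealJ (val (repr (\pi_B0 a)) - val a).
Proof. by apply/pi_eqP; rewrite reprK. Qed.

Definition B0_add u v : B0 := \pi_B0 (repr u + repr v).
Definition B0_opp u : B0 := \pi_B0 (- repr u).
Definition B0_mul u v : B0 := \pi_B0 (repr u * repr v).
Definition B0_scale (k : R[i]) u : B0 := \pi_B0 (k *: repr u).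
Definition B0_star u : B0 := \pi_B0 (A0_star (repr u)).

Lemma B0_addE a b : B0_add (\pi_B0 a) (\pi_B0 b) = \pi_B0 (a + b).
Proof.
apply/pi_eqP; rewrite ![val (_ + _)]raddfD opprD addrACA.
by apply: idealJD; exact: repr_piP.
Qed.

Lemma B0_oppE a : B0_opp (\pi_B0 a) = \pi_B0 (- a).
Proof.
apply/pi_eqP; rewrite ![val (- _)]raddfN -opprD. exact: (idealJN (repr_piP a)).
Qed.

Lemma B0_mulE a b : B0_mul (\pi_B0 a) (\pi_B0 b) = \pi_B0 (a * b).
Proof.
apply/pi_eqP.
have vM (c d : A0 FA) : val (c * d) = val c * val d by exact: rmorphM.
rewrite !vM.
set a' := val (repr _); set b' := val (repr _).
have -> : a' * b' - val a * val b = (a' - val a) * b' + val a * (b' - val b).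
  by rewrite mulrBl mulrBr addrA subrK.
apply: idealJD; [apply: idealJMr|apply: idealJMl];
  by [exact: val_algA|exact: repr_piP].
Qed.

Lemma B0_scaleE k a : B0_scale k (\pi_B0 a) = \pi_B0 (k *: a).
Proof.
apply/pi_eqP.
have vZ (c : A0 FA) : val (k *: c) = k *: val c by exact: linearZ.
by rewrite !vZ -scalerBr; exact: (idealJZ k (repr_piP a)).
Qed.

Lemma B0_starE a : B0_star (\pi_B0 a) = \pi_B0 (A0_star a).
Proof.
by have := idealJ_star (repr_piP a); rewrite starD starN => h; apply/pi_eqP.
Qed.

Fact B0_addA : associative B0_add.
Proof.
elim/quotW=> a; elim/quotW=> b; elim/quotW=> c.
by rewrite (B0_addE b c) (B0_addE a b) !B0_addE addrA.
Qed.

Fact B0_addC : commutative B0_add.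
Proof.
elim/quotW=> a; elim/quotW=> b.
by rewrite (B0_addE a b) (B0_addE b a) addrC.
Qed.

Fact B0_add0 : left_id (\pi_B0 0) B0_add.
Proof. by elim/quotW=> a; rewrite (B0_addE 0 a) add0r. Qed.

Fact B0_addN : left_inverse (\pi_B0 0) B0_opp B0_add.
Proof. by elim/quotW=> a; rewrite (B0_oppE a) (B0_addE (- a) a) addNr. Qed.

HB.instance Definition _ :=
  GRing.isZmodule.Build B0 B0_addA B0_addC B0_add0 B0_addN.

Lemma pi_addE a b : \pi_B0 a + \pi_B0 b = \pi_B0 (a + b).
Proof. exact: B0_addE. Qed.

Fact B0_mulA : associative B0_mul.
Proof.
elim/quotW=> a; elim/quotW=> b; elim/quotW=> c.
by rewrite (B0_mulE b c) (B0_mulE a b) !B0_mulE mulrA.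
Qed.

Fact B0_mul1 : left_id (\pi_B0 1) B0_mul.
Proof. by elim/quotW=> a; rewrite (B0_mulE 1 a) mul1r. Qed.

Fact B0_mulr1 : right_id (\pi_B0 1) B0_mul.
Proof. by elim/quotW=> a; rewrite (B0_mulE a 1) mulr1. Qed.

Fact B0_mulDl : left_distributive B0_mul +%R.
Proof.
elim/quotW=> a; elim/quotW=> b; elim/quotW=> c.
by rewrite pi_addE (B0_mulE (a + b) c) (B0_mulE a c) (B0_mulE b c) pi_addE mulrDl.
Qed.

Fact B0_mulDr : right_distributive B0_mul +%R.
Proof.
elim/quotW=> a; elim/quotW=> b; elim/quotW=> c.
by rewrite pi_addE (B0_mulE a (b + c)) (B0_mulE a b) (B0_mulE a c) pi_addE mulrDr.
Qed.

HB.instance Definition _ := GRing.Zmodule_isPzRing.Build B0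
  B0_mulA B0_mul1 B0_mulr1 B0_mulDl B0_mulDr.

Fact B0_scaleA (k l : R[i]) u :
  B0_scale k (B0_scale l u) = B0_scale (k * l) u.
Proof. by elim/quotW: u => a; rewrite (B0_scaleE l a) !B0_scaleE scalerA. Qed.

Fact B0_scale1 : left_id 1 B0_scale.
Proof. by elim/quotW=> a; rewrite (B0_scaleE 1 a) scale1r. Qed.

Fact B0_scaleDr : right_distributive B0_scale +%R.
Proof.
move=> k; elim/quotW=> a; elim/quotW=> b.
by rewrite pi_addE (B0_scaleE k (a + b)) (B0_scaleE k a) (B0_scaleE k b) pi_addE scalerDr.
Qed.

Fact B0_scaleDl u : {morph B0_scale^~ u : k l / k + l}.
Proof.
elim/quotW: u => a k l.
by rewrite (B0_scaleE _ a) (B0_scaleE k a) (B0_scaleE l a) pi_addE scalerDl.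
Qed.

HB.instance Definition _ := GRing.Zmodule_isLmodule.Build R[i] B0
  B0_scaleA B0_scale1 B0_scaleDr B0_scaleDl.

(* The class a + J; meaningful for a in A0. *)
Definition cls (a : FA) : B0 := \pi_B0 (insubd (0 : A0 FA) a).

Definition U1 (b : bond) : B0 := cls (P_G FA b).
Definition U3 (b : bond) : B0 := cls (dQ_H FA b * star (Q_G FA b)).

End Quotient.

Section Couplings.
Variables (R : realType) (N : nat).

Definition fourier (rho : 'I_N -> R) (m : 'I_N) : R[i] :=
  ((Num.sqrt N%:R)^-1)%:C *
    \sum_(v < N) (rho v)%:C * root_unity R N (m * v).

Definition admissible (g : 'I_N -> R) : Prop :=
  [/\ (forall n, 0 < g n), (forall n : 'I_N, n = 0%N :> nat -> g n = 1),
      (forall n m : 'I_N, (n + m = N)%N -> g n = g m) &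
      (forall m, 0 < fourier g m)].

Record couplings := Couplings {
  beta_g : 'I_N -> R; beta_h : 'I_N -> R;
  gamma_g : 'I_N -> R; gamma_h : 'I_N -> R
}.

(* [fourier g] and [fourier h] take positive real values. *)
Definition couplings_of (g h : 'I_N -> R) (c : couplings) : Prop :=
  forall m : 'I_N,
  [/\ fourier (beta_g c) m = (ln (g m))%:C,
      fourier (beta_h c) m = (ln (complex.Re (fourier h m)))%:C,
      fourier (gamma_g c) m = (ln (complex.Re (fourier g m)))%:C &
      fourier (gamma_h c) m = (ln (h m))%:C].

Definition dual_couplings (c : couplings) : couplings :=
  Couplings (gamma_h c) (gamma_g c) (beta_h c) (beta_g c).

End Couplings.

Section Dynamics.
Variables (R : realType) (N : nat) (FA : fieldAlgebra R N).
Definition power_sum (f : 'I_N -> R) (a : FA) : FA :=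
  \sum_(n < N) (f n)%:C *: a ^+ n.

Definition sqrtN_inv : R[i] := ((Num.sqrt N%:R)^-1)%:C.

Variable c : couplings R N.


Definition A_V (L : nat) : FA :=
  sqrtN_inv *: (\sum_(p <- box_plaquettes L) power_sum (beta_g c) (dQ_G FA p)) +
  sqrtN_inv *: (\sum_(b <- box_bonds L)
    power_sum (beta_h c) (dQ_H FA (b, true) * star (Q_G FA (b, true)))).

Definition B_V (L : nat) : FA :=
  sqrtN_inv *: (\sum_(b <- box_bonds L) power_sum (gamma_g c) (P_G FA (b, true))) +
  sqrtN_inv *: (\sum_(x <- box_sites L) power_sum (gamma_h c) (P_H FA x)).

Definition T_V (L : nat) : FA :=
  cs_exp (2^-1 *: A_V L) * cs_exp (B_V L) * cs_exp (2^-1 *: A_V L).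

Definition S_V (L : nat) : FA :=
  cs_exp (2^-1 *: B_V L) * cs_exp (2^-1 *: A_V L).

(* S_V^-1 *)
Definition S_V_inv (L : nat) : FA :=
  cs_exp (- (2^-1 *: A_V L)) * cs_exp (- (2^-1 *: B_V L)).

Definition beta (a : FA) : FA := cs_lim (fun L => S_V L * a * S_V_inv L).

(* The Hilbert space of V_L, the tensor product of the copies of C^N at the
   cells of V_L, has the basis [box_conf N L]; its operators are matrices. *)
Definition box_dim (L : nat) : nat := #|{: box_conf N L}|.

Definition local_mx (L : nat) (s : seq_sub (box_cells L)) (M : 'M[R[i]]_N) :
    'M[R[i]]_(box_dim L) :=
  \matrix_(i, j)
    let: (sigma, tau) := (enum_val i : box_conf N L, enum_val j : box_conf N L) in
    [forall t, (t != s) ==> (sigma t == tau t)]%:R * M (sigma s) (tau s).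

Definition box_alg (L : nat) : set FA :=
  PQ_gen (@cell_mx R N FA) [set` box_cells L].

(* The action of the algebra of V_L on the Hilbert space of V_L. *)
Definition box_rep (L : nat) (rho : FA -> 'M[R[i]]_(box_dim L)) : Prop :=
  [/\ (forall (k : R[i]) a b, box_alg L a -> box_alg L b ->
         rho (k *: a + b) = k *: rho a + rho b),
      (forall a b, box_alg L a -> box_alg L b -> rho (a * b) = rho a *m rho b),
      (forall a, box_alg L a -> rho (star a) = adj_mx (rho a)),
      rho 1 = 1%:M &
      (forall s, rho (cell_mx FA (ssval s) (P_mx R N)) = local_mx s (P_mx R N) /\
                 rho (cell_mx FA (ssval s) (Q_mx R N)) = local_mx s (Q_mx R N))].

(* A unit eigenvector of T_V for its largest eigenvalue. *)
Definition top_eigenvector (L : nat) (rho : FA -> 'M[R[i]]_(box_dim L))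
    (Om : 'cV[R[i]]_(box_dim L)) : Prop :=
  \sum_i `|Om i ord0| ^+ 2 = 1 /\
  exists2 lambda : R[i], rho (T_V L) *m Om = lambda *: Om &
    forall (mu : R[i]) (v : 'cV[R[i]]_(box_dim L)),
      v != 0 -> rho (T_V L) *m v = mu *: v -> mu <= lambda.

Definition vector_state (L : nat) (rho : FA -> 'M[R[i]]_(box_dim L))
    (Om : 'cV[R[i]]_(box_dim L)) (a : FA) : R[i] :=
  \sum_i (Om i ord0)^*%R * (rho a *m Om) i ord0.

(* omega is the limit of the states omega_V on F0 (each element of F0 lies in
   [box_alg L] for all large L). *)
Definition infinite_volume_limit (omega : FA -> R[i]) : Prop :=
  exists (rho : forall L, FA -> 'M[R[i]]_(box_dim L))
         (Om : forall L, 'cV[R[i]]_(box_dim L)),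
    (forall L, box_rep (rho L) /\ top_eigenvector (rho L) (Om L)) /\
    (forall a, F0 a ->
       (fun L => vector_state (rho L) (Om L) a : R[i]^o) @ \oo -->
         (omega a : R[i]^o)).

End Dynamics.

Section MapsAndStates.
Variables (R : realType) (N : nat) (FA : fieldAlgebra R N).
Implicit Types (f : B0 FA -> B0 FA) (w : B0 FA -> R[i]).

Definition automorphism f : Prop :=
  [/\ linear f, (forall u v, f (u * v) = f u * f v) & bijective f].

Definition star_automorphism f : Prop :=
  automorphism f /\ forall u, f (B0_star u) = B0_star (f u).

(* f is the map on B0 defined by the map F on F0. *)
Definition induces_map (F : FA -> FA) f : Prop :=
  forall a, algA0 a -> algA0 (F a) /\ f (cls a) = cls (F a).

Definition induces_functional (omega : FA -> R[i]) w : Prop :=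
  forall a, algA0 a -> w (cls a) = omega a.

Definition map_inv f (u : B0 FA) : B0 FA := xget 0 [set v | f v = u].

Definition map_star f (u : B0 FA) : B0 FA := B0_star (f (B0_star u)).

Definition map_star_inv f : B0 FA -> B0 FA := map_inv (map_star f).

Definition is_state w : Prop :=
  [/\ (forall (k : R[i]) u v, w (k *: u + v) = k * w u + w v), w 1 = 1 &
      forall u, 0 <= w (B0_star u * u)].

Definition ground_state w f : Prop :=
  is_state w /\
  forall u, 0 <= w (B0_star u * f u) <= w (B0_star u * u).

Definition duality (Delta : B0 FA -> B0 FA) : Prop :=
  [/\ star_automorphism Delta,
      (forall b, Delta (U1 FA b) = U3 FA (bond_opp (dual_bond b))) &
      (forall b, Delta (U3 FA b) = U1 FA (dual_bond b))].

(* alpha_i^a, where b and b' are the automorphisms beta and beta' of B0. *)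
Definition alpha_i (b b' : B0 FA -> B0 FA) (a : 'I_4) : B0 FA -> B0 FA :=
  match a : nat with
  | 0 => map_star_inv b \o b
  | 1 => b \o map_star_inv b
  | 2 => map_star_inv b' \o b'
  | _ => b' \o map_star_inv b'
  end%N.

Definition vacuum_states (w0 : B0 FA -> R[i]) (b Delta : B0 FA -> B0 FA)
    (a : 'I_4) : B0 FA -> R[i] :=
  match a : nat with
  | 0 => w0
  | 1 => w0 \o map_star_inv b
  | 2 => w0 \o map_star_inv b \o Delta
  | _ => w0 \o Delta
  end%N.

End MapsAndStates.

(* The inner product is linear in its second argument. *)
HB.mixin Record isHilbert (R : realType) H of CompleteNormedModule R[i] H := {
  ip : H -> H -> R[i];
  ip_conj : forall x y : H, ip y x = (ip x y)^*%R;
  ip_lin : forall (k : R[i]) (x y z : H), ip x (k *: y + z) = k * ip x y + ip x z;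
  ip_norm : forall x : H, ip x x = `|x| ^+ 2
}.

#[short(type="hilbertType")]
HB.structure Definition Hilbert (R : realType) :=
  {H of CompleteNormedModule R[i] H & isHilbert R H}.

Definition bounded_operator (R : realType) (H : hilbertType R) (T : H -> H) : Prop :=
  linear T /\ continuous T.

Definition unitary_map (R : realType) (H K : hilbertType R) (U : H -> K) : Prop :=
  [/\ linear U, bijective U & forall x y, ip (U x) (U y) = ip x y].

Definition unitarily_equivalent (R : realType) (H K : hilbertType R)
    (T : H -> H) (S : K -> K) : Prop :=
  exists2 U : H -> K, unitary_map U & forall x, U (T x) = S (U x).

Section GNS.
Variables (R : realType) (N : nat) (FA : fieldAlgebra R N) (H : hilbertType R).

Definition gns_triple (w : B0 FA -> R[i]) (pi : B0 FA -> H -> H) (Om : H) : Prop :=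
  [/\ (forall u, bounded_operator (pi u)),
      ((forall (k : R[i]) u v x, pi (k *: u + v) x = k *: pi u x + pi v x) /\
       (forall u v x, pi (u * v) x = pi u (pi v x)) /\
       (forall x, pi 1 x = x) /\
       (forall u x y, ip x (pi (B0_star u) y) = ip (pi u x) y)),
      dense (range (fun u => pi u Om)) &
      (forall u, w u = ip Om (pi u Om))].

Definition transfer_matrix (pi : B0 FA -> H -> H) (Om : H)
    (alpha : B0 FA -> B0 FA) (T : H -> H) : Prop :=
  bounded_operator T /\ forall u, T (pi u Om) = pi (alpha u) Om.

End GNS.

(* Main.v *)
(* The vacuum satisfies 0 <= omega_0 (u^* alpha u) <= omega_0 (u^* u), so
   u |-> u - alpha u is a positive contraction on the GNS space of omega_0 and the
   transfer matrix T is 1 minus this contraction; let S be a square root of T.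
   Since alpha = beta^{*-1} beta, one has
   omega_1 ((beta u)^* beta v) = omega_0 (u^* alpha v) = <S u, S v>, and the map
   beta u |-> S u is a unitary intertwining the transfer matrices of omega_1 and
   omega_0; its range is dense because that of T is, alpha being surjective.

   The states omega_2 and omega_3 are reduced to omega_1 and omega_0 by
   Delta beta' = beta^{*-1} Delta.  For a local element, beta is conjugation by
   finite products exp (B/2) exp (A/2) of commuting local exponentials, and Delta
   exchanges the local terms of A' with those of B and the terms of B' with those
   of A, the term of P_H (x) being that of [delta^* P_G] (x) modulo J.  So
   Delta beta' Delta^-1 is locally conjugation by exp (A/2) exp (B/2), which is
   the inverse of beta^* as the local terms are self-adjoint. *)

Require Import Defs.
From mathcomp Require Import all_boot all_order all_algebra.
From mathcomp Require Import complex ring lra zify.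
From mathcomp Require Import all_classical all_reals all_analysis.

Set Implicit Arguments.
Unset Strict Implicit.
Unset Printing Implicit Defensive.

Import Order.TTheory GRing.Theory Num.Theory.
Import numFieldNormedType.Exports.

Local Open Scope classical_set_scope.
Local Open Scope ring_scope.
Local Open Scope complex_scope.

(** * Exponentials of unitaries of finite order *)

(** [Delta] and the induced maps live on [B0], so the exponentials, which are defined as limits in
    the completion, must first be recognised as elements of [algA0]. Each local term is a power sum
    of a unitary u with u^N = 1; by discrete Fourier inversion its exponential is a polynomial in u,
    and on local elements every limit over boxes becomes eventually constant. The coefficients of
    this polynomial are real and even in the exponent. Reality makes the exponentials self-adjoint;
    evenness makes them blind to u -> u^-1, which absorbs the bond orientations reversed by [Delta].
    The shift in [dual_bond] does not preserve boxes; so a conjugation is shown to depend only on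
    the terms that fail to commute with its argument, and any large enough finite set of terms may
    be used. In the Hilbert space part the ground state condition bounds a quadratic form only;
    Cauchy-Schwarz for that form turns it into the operator bound from which the contraction and its
    square root are built. *)

Section RootsOfUnity.
Variables (R : realType) (N : nat).
Hypothesis N_gt0 : (0 < N)%N.
Local Notation z := (root_unity R N).

Lemma root_unityD a b : z (a + b) = z a * z b.
Proof.
rewrite /root_unity natrD.
have -> : 2 * pi * (a%:R + b%:R) / N%:R =
          2 * pi * a%:R / N%:R + 2 * pi * b%:R / N%:R :> R by ring.
by rewrite cosD sinD; apply/eqP; rewrite eq_complex /= eqxx /= addrC mulrC.
Qed.

Lemma root_unity0 : z 0 = 1.
Proof. by rewrite /root_unity mulr0 mul0r cos0 sin0. Qed.

Lemma root_unityM a b : z (a * b) = z a ^+ b.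
Proof.
elim: b => [|b IH]; first by rewrite muln0 root_unity0.
by rewrite mulnS root_unityD IH exprS.
Qed.

Lemma root_unityN : z N = 1.
Proof.
rewrite /root_unity mulfK ?pnatr_eq0 -?lt0n // mulrC mulr_natr.
by rewrite cos2pi sin2pi.
Qed.

Lemma root_unityXN a : z a ^+ N = 1.
Proof. by rewrite -root_unityM mulnC root_unityM root_unityN expr1n. Qed.

Lemma root_unity_conjM a : (z a)^*%R * z a = 1.
Proof.
apply/eqP; rewrite eq_complex /=; apply/andP; split; apply/eqP; last by ring.
by rewrite -[RHS](cos2Dsin2 (2 * pi * a%:R / N%:R)); ring.
Qed.

(** Since cos t = 1 - 2 sin(t/2)^2 and here 0 < t/2 < pi, the cosine is not 1. *)
Lemma root_unity_neq1 a : (0 < a < N)%N -> z a != 1.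
Proof.
move=> /andP[a0 aN]; apply/eqP => /(congr1 (@complex.Re _)) /=.
set t := _ / _; have -> : t = (pi * a%:R / N%:R) *+ 2.
  by rewrite /t -mulr_natl; ring.
have : 0 < sin (pi * a%:R / N%:R : R).
  apply: sin_gt0_pi; rewrite divr_gt0 ?mulr_gt0 ?pi_gt0 ?ltr0n //=.
  by rewrite ltr_pdivrMr ?ltr0n // ltr_pM2l ?pi_gt0 // ltr_nat.
rewrite cos_mulr2n cos2sin2; set s := sin _ => s0 h.
have : 0 < s ^+ 2 by rewrite exprn_gt0.
by move: h; rewrite -mulr_natl; lra.
Qed.

Lemma sum_expr_unity_root (F : fieldType) (w : F) :
  w ^+ N = 1 -> w != 1 -> \sum_(n < N) w ^+ n = 0.
Proof.
move=> wN w1; apply: (mulfI (x := w - 1)); first by rewrite subr_eq0.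
by rewrite -subrX1 wN subrr mulr0.
Qed.

(** Orthogonality of the characters of Z/N: for distinct m and k the summand is a power of a
    nontrivial N-th root of unity, so the geometric sum vanishes. *)
Lemma sum_root_unity_conj (m k : 'I_N) :
  \sum_(n < N) ((z m)^*%R * z k) ^+ n = (m == k)%:R * N%:R.
Proof.
have [->|mk] := eqVneq m k.
  rewrite root_unity_conjM mul1r; under eq_bigr do rewrite expr1n.
  by rewrite sumr_const card_ord.
rewrite mul0r; apply: sum_expr_unity_root.
  by rewrite exprMn -rmorphXn /= !root_unityXN rmorph1 mulr1.
have key (a b : nat) : (a < b < N)%N -> z a != z b.
  move=> /andP[ab bN]; apply/eqP => e.
  have : z (b - a) != 1 by apply: root_unity_neq1; lia.
  move/eqP; apply; rewrite -[LHS]mul1r -(root_unity_conjM a) -mulrA.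
  by rewrite -root_unityD subnKC ?(ltnW ab) // -e.
have zmk : z m != z k.
  case: (ltngtP m k) => [lt|lt|/val_inj e]; last by rewrite e eqxx in mk.
    by apply: key; rewrite lt ltn_ord.
  by rewrite eq_sym; apply: key; rewrite lt ltn_ord.
apply: contra_neq zmk => e.
by rewrite -[LHS]mulr1 -e mulrCA mulrA root_unity_conjM mul1r.
Qed.

End RootsOfUnity.

Section SpectralProjections.
Variables (R : realType) (N : nat) (A : algType R[i]).
Hypothesis N_gt0 : (0 < N)%N.
Local Notation z := (root_unity R N).

(** The projection onto the eigenspace of u for the eigenvalue [z m], obtained by averaging over the
    cyclic group generated by u. *)
Definition spectral_proj (u : A) (m : nat) : A :=
  (N%:R)^-1 *: \sum_(n < N) ((z m)^*%R *: u) ^+ n.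

Variable u : A.
Hypothesis uN : u ^+ N = 1.

(** Multiplication by [(z m)^*%R *: u], whose N-th power is 1, only shifts the terms of the average
    cyclically. *)
Lemma spectral_projXl m n : u ^+ n * spectral_proj u m = z (m * n) *: spectral_proj u m.
Proof.
have E1 : u * spectral_proj u m = z m *: spectral_proj u m.
  rewrite /spectral_proj scalerA mulrC -scalerA -scalerAr; congr (_ *: _).
  set w := (z m)^*%R *: u.
  have -> : u = z m *: w.
    by rewrite /w scalerA mulrC root_unity_conjM scale1r.
  have wN : w ^+ N = 1.
    rewrite /w exprZn uN -rmorphXn /= root_unityXN //.
    by rewrite rmorph1 scale1r.
  rewrite -scalerAl; congr (_ *: _).
  case: N N_gt0 wN => // N' _ wN.
  rewrite big_distrr /= [LHS]big_ord_recr [RHS]big_ord_recl /= -exprS wN addrC.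
  by rewrite expr0; congr (_ + _); apply: eq_bigr => i _; rewrite -exprS.
elim: n => [|n IH]; first by rewrite muln0 root_unity0 mul1r scale1r.
by rewrite exprSr -mulrA E1 -scalerAr IH scalerA mulnS root_unityD.
Qed.

Lemma spectral_projM (m k : 'I_N) :
  spectral_proj u m * spectral_proj u k = (m == k)%:R *: spectral_proj u m.
Proof.
rewrite {1}/spectral_proj -scalerAl big_distrl /=.
under eq_bigr => n _ do rewrite exprZn -scalerAl spectral_projXl scalerA
   root_unityM -exprMn.
rewrite -scaler_suml sum_root_unity_conj // scalerA mulrCA mulVf ?mulr1.
  by have [->|] := eqVneq m k; rewrite ?scale0r.
by rewrite pnatr_eq0 -lt0n.
Qed.

Lemma spectral_proj_sum : \sum_(m < N) spectral_proj u m = 1.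
Proof.
rewrite -scaler_sumr exchange_big /=.
have H (n : 'I_N) : \sum_(m < N) ((z m)^*%R *: u) ^+ n =
    ((Ordinal N_gt0 == n)%:R * N%:R) *: u ^+ n.
  under eq_bigr do rewrite exprZn.
  rewrite -scaler_suml; congr (_ *: _).
  under eq_bigr do rewrite -rmorphXn /= -root_unityM mulnC root_unityM.
  rewrite -(rmorph_sum (@Num.conj R[i])) /=.
  (* [Ordinal N_gt0] is the index 0: orthogonality with the trivial character leaves only u ^+ 0. *)
  have -> : \sum_(m < N) z n ^+ m = (Ordinal N_gt0 == n)%:R * N%:R.
    rewrite -sum_root_unity_conj //; apply: eq_bigr => m _.
    by rewrite root_unity0 rmorph1 mul1r.
  by rewrite rmorphM /= !rmorph_nat.
under eq_bigr do rewrite H.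
rewrite (bigD1 (Ordinal N_gt0)) // eqxx mul1r expr0 /= big1 ?addr0.
  by rewrite scalerA mulVf ?scale1r // pnatr_eq0 -lt0n.
by move=> n /negPf n0; rewrite eq_sym n0 mul0r scale0r.
Qed.

Lemma power_sum_spectral (f : 'I_N -> R[i]) :
  \sum_(n < N) f n *: u ^+ n =
  \sum_(m < N) (\sum_(n < N) f n * z (m * n)) *: spectral_proj u m.
Proof.
rewrite -[LHS]mulr1 -spectral_proj_sum big_distrr /=; apply: eq_bigr => m _.
rewrite big_distrl scaler_suml /=; apply: eq_bigr => n _.
by rewrite -scalerAl spectral_projXl scalerA.
Qed.

Lemma comm_spectral_proj x m : GRing.comm x u -> GRing.comm x (spectral_proj u m).
Proof.
move=> xu; rewrite /GRing.comm /spectral_proj -scalerAl -scalerAr; congr (_ *: _).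
by apply: commr_sum => n _; apply/commrX; rewrite /GRing.comm -scalerAl -scalerAr xu.
Qed.

End SpectralProjections.

Lemma conj_realC (R : realType) (x : R) : (x%:C)^*%R = x%:C :> R[i].
Proof. by apply/eqP; rewrite eq_complex /= oppr0 !eqxx. Qed.

Lemma conj_realM (R : realType) (x : R) (y : R[i]) : (x%:C * y)^*%R = x%:C * y^*%R.
Proof. by rewrite rmorphM; congr (_ * _); exact: conj_realC. Qed.

Section ScalarExponential.
Variables (R : realType) (N : nat) (f : 'I_N -> R) (t : R).
Hypothesis N_gt0 : (0 < N)%N.
Local Notation z := (root_unity R N).

Definition fourier_re (m : 'I_N) : R := complex.Re (fourier f m).

(** The inverse discrete Fourier transform of m |-> exp (t * fourier_re m). *)
Definition exp_coef (n : nat) : R[i] :=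
  N%:R^-1 * \sum_(m < N) (expR (t * fourier_re m))%:C * (z m)^*%R ^+ n.

(** Negation in Z/N; the remainder is taken for the sake of m = 0, where N - m is N. *)
Definition ord_neg (m : 'I_N) : 'I_N := Ordinal (ltn_pmod (N - m) N_gt0).

Lemma ord_negK : involutive ord_neg.
Proof.
move=> [m mN]; apply: val_inj => /=.
have [->|m0] := posnP m; first by rewrite subn0 modnn subn0 modnn.
by rewrite (modn_small (m := N - m)) ?subKn ?modn_small // ?(ltnW mN) //; lia.
Qed.

Lemma root_unity_mod a : z (a %% N) = z a.
Proof.
rewrite [in RHS](divn_eq a N) root_unityD mulnC root_unityM root_unityN //.
by rewrite expr1n mul1r.
Qed.

Lemma root_unity_neg (m : 'I_N) : z (ord_neg m) = (z m)^*%R.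
Proof.
rewrite /= root_unity_mod -[LHS]mul1r -(root_unity_conjM R N m) -mulrA -root_unityD.
by rewrite subnKC ?root_unityN ?mulr1 // ltnW.
Qed.

Lemma fourier_re_neg m : fourier_re (ord_neg m) = fourier_re m.
Proof.
have -> : fourier_re (ord_neg m) = complex.Re (fourier f m)^*%R.
  rewrite /fourier_re /fourier; congr complex.Re.
  rewrite rmorphM rmorph_sum; congr (_ * _); first by apply/esym/conj_realC.
  apply: eq_bigr => v _; rewrite -[RHS]/(_^*%R) conj_realM; congr (_ * _).
  by rewrite [in LHS]root_unityM root_unity_neg -rmorphXn /= -root_unityM.
by rewrite /fourier_re; case: (fourier f m).
Qed.

(** As f is real, [fourier_re] is even, so reindexing by m -> -m undoes the conjugation. *)
Lemma exp_coef_conj n : (exp_coef n)^*%R = exp_coef n.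
Proof.
rewrite /exp_coef rmorphM rmorph_sum /= [in RHS](reindex_inj (inv_inj ord_negK)) /=.
congr (_ * _); first by rewrite fmorphV rmorph_nat.
apply: eq_bigr => m _; rewrite fourier_re_neg -[LHS]/(_^*%R) conj_realM; congr (_ * _).
by rewrite -/(ord_neg m) root_unity_neg rmorphXn.
Qed.

(** Changing the sign of n conjugates the characters, hence the coefficient, which is real. *)
Lemma exp_coef_neg n : exp_coef (ord_neg n) = exp_coef n.
Proof.
rewrite -[RHS]exp_coef_conj /exp_coef rmorphM rmorph_sum.
congr (_ * _); first by rewrite fmorphV rmorph_nat.
apply: eq_bigr => m _; rewrite -[RHS]/(_^*%R) conj_realM; congr (_ * _).
rewrite rmorphXn /= conjCK -rmorphXn /= -!root_unityM mulnC.
rewrite -/(nat_of_ord (ord_neg n)) root_unityM root_unity_neg -rmorphXn /= conjCK.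
by rewrite -root_unityM mulnC.
Qed.

End ScalarExponential.

Section BondExponential.
Variables (R : realType) (N : nat) (A : algType R[i]) (f : 'I_N -> R).
Hypothesis N_gt0 : (0 < N)%N.

(* exp (t N^(-1/2) sum_n f(n) u^n) when u ^+ N = 1, see cs_exp_power_sum. *)
Definition unit_exp (t : R) (u : A) : A := \sum_(n < N) exp_coef f t n *: u ^+ n.

Lemma unit_expE t u :
  unit_exp t u = \sum_(m < N) (expR (t * fourier_re f m))%:C *: spectral_proj N u m.
Proof.
rewrite /unit_exp.
under [RHS]eq_bigr do rewrite /spectral_proj scalerA mulrC -scalerA scaler_sumr.
rewrite -scaler_sumr exchange_big scaler_sumr /=; apply: eq_bigr => n _.
rewrite /exp_coef -scalerA scaler_suml; congr (_ *: _).
by apply: eq_bigr => m _; rewrite exprZn scalerA.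
Qed.

End BondExponential.

(** * Limits and the exponential in a C*-algebra *)

Section CStarLimits.
Variables (R : realType) (A : cstarAlgebra R).
Implicit Types (u v : nat -> A) (a l : A).

Lemma cnorm_realZ (x : R) a : cnorm (x%:C *: a) = `|x| * cnorm a.
Proof.
have /(congr1 (@complex.Re _)) /= := cnormZ x%:C a.
by rewrite mulr0 subr0 expr0n addr0 sqrtr_sqr.
Qed.

Lemma cnorm0 : cnorm (0 : A) = 0.
Proof. by rewrite -(scale0r (0 : A)) -[0 in LHS]/(0%:C) cnorm_realZ normr0 mul0r. Qed.

Lemma cnormN a : cnorm (- a) = cnorm a.
Proof.
have -> : - a = (-1)%:C *: a by rewrite rmorphN1 scaleN1r.
by rewrite cnorm_realZ normrN1 mul1r.
Qed.

Lemma cs_cvg_unique u l l' : cs_cvg u l -> cs_cvg u l' -> l = l'.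
Proof.
move=> ul ul'; apply/eqP; rewrite -subr_eq0; apply/eqP/cnorm_eq0.
have h : (fun n => cnorm (u n - l) + cnorm (u n - l')) @ \oo --> (0 : R).
  by rewrite -[0 in X in _ --> X]addr0; exact: cvgD ul ul'.
have c : (fun _ : nat => cnorm (l - l')) @ \oo --> (0 : R).
  apply: (squeeze_cvgr (f := fun=> 0) _ (cvg_cst 0) h); near=> n; rewrite cnorm_ge0 /=.
  rewrite -[l - l'](subrKA (u n)) addrC -[cnorm (u n - l)]cnormN opprB addrC.
  exact: cnormD.
exact: (cvg_unique _ (cvg_cst _) c).
Unshelve. all: by end_near.
Qed.

Lemma cs_limE u l : cs_cvg u l -> cs_lim u = l.
Proof. by move=> ul; apply: xget_unique => // l' /cs_cvg_unique; apply. Qed.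

Lemma cs_cvg_eventually u l n0 : (forall n, (n0 <= n)%N -> u n = l) -> cs_cvg u l.
Proof.
move=> ul; apply: cvg_near_cst; near=> n.
rewrite ul ?subrr ?cnorm0 //; near: n; exact: nbhs_infty_ge.
Unshelve. all: by end_near.
Qed.

Lemma cs_cvgD u v l l' :
  cs_cvg u l -> cs_cvg v l' -> cs_cvg (fun n => u n + v n) (l + l').
Proof.
move=> ul vl.
have h : (fun n => cnorm (u n - l) + cnorm (v n - l')) @ \oo --> (0 : R).
  by rewrite -[0 in X in _ --> X]addr0; exact: cvgD ul vl.
apply: (squeeze_cvgr _ (cvg_cst 0) h); near=> n.
by rewrite cnorm_ge0 opprD addrACA cnormD.
Unshelve. all: by end_near.
Qed.

Lemma cs_cvgZ (x : nat -> R) (y : R) a :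
  x @ \oo --> y -> cs_cvg (fun n => (x n)%:C *: a) (y%:C *: a).
Proof.
move=> xy; rewrite /cs_cvg.
under eq_fun do rewrite -scalerBl -rmorphB cnorm_realZ.
suff : (fun n => `|x n - y| * cnorm a) @ \oo --> `|y - y| * cnorm a.
  by rewrite subrr normr0 mul0r.
by apply: cvgM (cvg_cst _); apply: cvg_norm; apply: cvgB => //; exact: cvg_cst.
Qed.

Lemma cs_cvg_sum (K : Type) (s : seq K) (u : K -> nat -> A) (l : K -> A) :
  (forall k, cs_cvg (u k) (l k)) ->
  cs_cvg (fun n => \sum_(k <- s) u k n) (\sum_(k <- s) l k).
Proof.
move=> ul; elim: s => [|k s IH].
  by apply: (@cs_cvg_eventually _ _ 0) => n _; rewrite !big_nil.
by rewrite big_cons; under eq_fun do rewrite big_cons; exact: cs_cvgD.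
Qed.

(** Powers of the sum act on each idempotent by a scalar, so the partial sums converge as the real
    exponential series do. *)
Lemma cs_exp_spectral (K : finType) (lam : K -> R) (P : K -> A) :
  (forall k k', P k * P k' = (k == k')%:R *: P k) -> \sum_k P k = 1 ->
  cs_exp (\sum_k (lam k)%:C *: P k) = \sum_k (expR (lam k))%:C *: P k.
Proof.
move=> PP P1; apply: cs_limE.
have X j : (\sum_k (lam k)%:C *: P k) ^+ j = \sum_k (lam k ^+ j)%:C *: P k.
  elim: j => [|j IH].
    by rewrite expr0 -P1; apply: eq_bigr => k _; rewrite expr0 scale1r.
  rewrite exprS IH big_distrl; apply: eq_bigr => k _ /=.
  rewrite big_distrr (bigD1 k) //= big1 ?addr0 => [|k' lk].
    by rewrite -scalerAl -scalerAr PP eqxx scale1r scalerA exprS rmorphM.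
  by rewrite -scalerAl -scalerAr PP eq_sym (negPf lk) scale0r !scaler0.
have -> : (fun n => \sum_(j < n) (j`!%:R)^-1 *: (\sum_k (lam k)%:C *: P k) ^+ j) =
    (fun n => \sum_k (series (exp_coeff (lam k)) n)%:C *: P k).
  apply/funext => n; under eq_bigr do rewrite X scaler_sumr.
  rewrite exchange_big; apply: eq_bigr => k _ /=.
  rewrite seriesEnat /= big_mkord rmorph_sum scaler_suml; apply: eq_bigr => j _.
  by rewrite scalerA /exp_coeff /= rmorphM fmorphV rmorph_nat mulrC.
by apply: cs_cvg_sum => k; apply: cs_cvgZ; exact: is_cvg_series_exp_coeff.
Qed.

End CStarLimits.

(** * Products of exponentials of commuting unitaries *)

Section CommutingUnitaries.
Variables (R : realType) (N : nat) (A : cstarAlgebra R) (I : eqType).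
Variables (f : I -> 'I_N -> R) (u : I -> A).
Hypothesis N_gt0 : (0 < N)%N.
Hypothesis uN : forall i, u i ^+ N = 1.
Hypothesis u_comm : forall i j, GRing.comm (u i) (u j).
Hypothesis f_real : forall i m, fourier (f i) m = (fourier_re (f i) m)%:C.
Implicit Types (s : seq I) (t : R) (x : A).

Definition exp_prod t s : A := \prod_(i <- s) unit_exp (f i) t (u i).

Lemma comm_unit_exp i t x : GRing.comm x (u i) -> GRing.comm x (unit_exp (f i) t (u i)).
Proof.
move=> xu; rewrite unit_expE; apply: commr_sum => m _.
by rewrite /GRing.comm -scalerAl -scalerAr (comm_spectral_proj N m xu).
Qed.

Lemma comm_exp_prod t s x :
  (forall i, i \in s -> GRing.comm x (u i)) -> GRing.comm x (exp_prod t s).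
Proof.
move=> xu; rewrite /exp_prod big_seq; apply: commr_prod => i si.
by apply: comm_unit_exp; exact: xu.
Qed.

Lemma unit_exp_comm i j t t' :
  GRing.comm (unit_exp (f i) t (u i)) (unit_exp (f j) t' (u j)).
Proof. by apply/comm_unit_exp/commr_sym/comm_unit_exp. Qed.

Lemma unit_expN i t : unit_exp (f i) t (u i) * unit_exp (f i) (- t) (u i) = 1.
Proof.
rewrite !unit_expE big_distrl -(spectral_proj_sum N_gt0 (u i)).
apply: eq_bigr => m _ /=; rewrite big_distrr (bigD1 m) //= big1 ?addr0.
  rewrite -scalerAl -scalerAr spectral_projM // eqxx scale1r scalerA -rmorphM.
  by rewrite -expRD mulNr subrr expR0 scale1r.
move=> k km; rewrite -scalerAl -scalerAr spectral_projM // eq_sym (negPf km).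
by rewrite scale0r !scaler0.
Qed.

Lemma exp_prodN t s : exp_prod t s * exp_prod (- t) s = 1.
Proof.
elim: s => [|i s IH]; first by rewrite /exp_prod !big_nil mulr1.
rewrite /exp_prod !big_cons -/(exp_prod t s) -/(exp_prod (- t) s).
rewrite -mulrA (mulrA (exp_prod t s)).
have -> : exp_prod t s * unit_exp (f i) (- t) (u i) =
          unit_exp (f i) (- t) (u i) * exp_prod t s.
  by apply/commr_sym/commr_prod => j _; exact: unit_exp_comm.
by rewrite -mulrA IH mulr1 unit_expN.
Qed.

Lemma exp_prodNK t s : exp_prod (- t) s * exp_prod t s = 1.
Proof. by rewrite -{2}[t]opprK exp_prodN. Qed.

Lemma exp_prod_cat t s s' : exp_prod t (s ++ s') = exp_prod t s * exp_prod t s'.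
Proof. exact: big_cat. Qed.

Lemma exp_prod_comm t t' s s' : GRing.comm (exp_prod t s) (exp_prod t' s').
Proof.
apply: commr_prod => j _; apply/commr_sym/commr_prod => i _.
exact: unit_exp_comm.
Qed.

Lemma perm_exp_prod t s s' : perm_eq s s' -> exp_prod t s = exp_prod t s'.
Proof.
elim: s s' => [|i s IH] s'; first by rewrite perm_sym => /perm_nilP ->.
move=> ps; have := perm_mem ps i; rewrite mem_head => /esym si.
have := perm_trans ps (perm_to_rem si); rewrite perm_cons => /IH e.
rewrite /exp_prod big_cons -/(exp_prod t s) e.
(* It remains to move the factor of i from its place in s' to the front. *)
elim: s' si {ps IH e} => //= j s' IH'; rewrite inE; case: eqVneq => [-> _|ij /= si].
  by rewrite /exp_prod big_cons.
rewrite {1}/exp_prod !big_cons -/(exp_prod t _) -IH' //.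
by rewrite !mulrA unit_exp_comm.
Qed.

Definition exp_conj t s x : A := exp_prod t s * x * exp_prod (- t) s.

Lemma exp_conjK t s x : exp_conj (- t) s (exp_conj t s x) = x.
Proof.
by rewrite /exp_conj opprK !mulrA exp_prodNK mul1r -mulrA exp_prodNK mulr1.
Qed.

Lemma exp_conj_id t s x :
  (forall i, i \in s -> GRing.comm x (u i)) -> exp_conj t s x = x.
Proof.
by move=> xu; rewrite /exp_conj -(comm_exp_prod t xu) -mulrA exp_prodN mulr1.
Qed.

(** The factors outside s' commute with x and with the remaining factors, so they cancel against
    their inverses. This makes conjugations independent of the box once it is large. *)
Lemma exp_conj_sub t s s' x : uniq s -> uniq s' -> {subset s' <= s} ->
  (forall i, i \notin s' -> GRing.comm x (u i)) ->
  exp_conj t s x = exp_conj t s' x.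
Proof.
move=> us us' ss xu.
have ps : perm_eq s (s' ++ [seq i <- s | i \notin s']).
  rewrite -(perm_filterC (mem s') s) perm_cat2r.
  apply: uniq_perm; rewrite ?filter_uniq // => i.
  by rewrite mem_filter /=; case: (boolP (i \in s')) => // /ss ->.
rewrite /exp_conj !(perm_exp_prod _ ps) !exp_prod_cat.
(* Exchanging the two blocks of the inverse puts the factors outside s' next to x on both sides. *)
rewrite (exp_prod_comm (- t) (- t)) !mulrA; congr (_ * _).
rewrite -!mulrA; congr (_ * _); rewrite mulrA; apply: exp_conj_id => i.
by rewrite mem_filter => /andP[/xu].
Qed.

(* The products of spectral projections of the u i diagonalise all summands
   simultaneously. *)
Lemma cs_exp_power_sum t s :
  cs_exp (\sum_(i <- s) t%:C *: (sqrtN_inv R N *: \sum_(n < N) (f i n)%:C *: u i ^+ n)) =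
  exp_prod t s.
Proof.
(* The last clause strengthens the induction: it makes the P k commute with the projections of the
   next unitary, so that the products are again orthogonal idempotents. *)
have [K [lam [P [PP P1 -> -> _]]]] : exists (K : finType) (lam : K -> R) (P : K -> A),
    [/\ (forall k k', P k * P k' = (k == k')%:R *: P k), \sum_k P k = 1,
        \sum_(i <- s) t%:C *: (sqrtN_inv R N *: \sum_(n < N) (f i n)%:C *: u i ^+ n) =
          \sum_k (lam k)%:C *: P k,
        exp_prod t s = \sum_k (expR (lam k))%:C *: P k &
        forall x, (forall i, GRing.comm x (u i)) -> forall k, GRing.comm x (P k)];
  last exact: cs_exp_spectral.
elim: s => [|i s [K [lam [P [PP P1 sumE prodE Pc]]]]].
  exists unit, (fun=> 0), (fun=> 1); split=> [[] []||||x _ _].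
  - by rewrite eqxx scale1r mulr1.
  - by rewrite big_const card_unit /= addr0.
  - by rewrite big_nil big1 // => k _; rewrite scale0r.
  - by rewrite /exp_prod big_nil expR0 big_const card_unit /= addr0 scale1r.
  - exact: commr1.
pose E (m : 'I_N) := spectral_proj N (u i) m.
have EP m k : GRing.comm (E m) (P k).
  by apply: Pc => j; apply/commr_sym/comm_spectral_proj.
have sumEP (x : 'I_N -> R) (y : K -> R) :
    \sum_m (x m)%:C *: E m = \sum_p (x p.1)%:C *: (E p.1 * P p.2) :> A.
  rewrite -(pair_big predT predT (fun m k => (x m)%:C *: (E m * P k))) /=.
  by apply: eq_bigr => m _; rewrite -scaler_sumr -mulr_sumr P1 mulr1.
exists ('I_N * K)%type, (fun p => t * fourier_re (f i) p.1 + lam p.2),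
  (fun p => E p.1 * P p.2); split.
- move=> [m k] [m' k'] /=; rewrite xpair_eqE mulrA -(mulrA (E m)) -EP mulrA.
  rewrite spectral_projM // -mulrA PP -scalerAl -scalerAr scalerA -natrM.
  by rewrite mulnb.
- rewrite -(pair_big predT predT (fun m k => E m * P k)) /=.
  under eq_bigr do rewrite -mulr_sumr P1 mulr1.
  exact: spectral_proj_sum.
- rewrite big_cons sumE.
  have -> : t%:C *: (sqrtN_inv R N *: \sum_(n < N) (f i n)%:C *: u i ^+ n) =
            \sum_(m < N) (t * fourier_re (f i) m)%:C *: E m.
    rewrite power_sum_spectral // scalerA scaler_sumr.
    apply: eq_bigr => m _; rewrite scalerA [in RHS]rmorphM.
    by have := f_real i m; rewrite /= => <-; rewrite /fourier mulrA.
  rewrite (sumEP _ lam).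
  have -> : \sum_k (lam k)%:C *: P k =
            \sum_p (lam p.2)%:C *: (E p.1 * P p.2) :> A.
    rewrite -(pair_big predT predT (fun m k => (lam k)%:C *: (E m * P k))) /=.
    rewrite exchange_big; apply: eq_bigr => k _ /=.
    by rewrite -scaler_sumr -mulr_suml spectral_proj_sum // mul1r.
  by rewrite -big_split; apply: eq_bigr => p _; rewrite rmorphD scalerDl.
- rewrite /exp_prod big_cons -/(exp_prod t s) prodE unit_expE big_distrl /=.
  rewrite -(pair_big predT predT (fun m k => (expR (t * fourier_re (f i) m + lam k))%:C
    *: (E m * P k))) /=; apply: eq_bigr => m _.
  rewrite big_distrr; apply: eq_bigr => k _ /=.
  by rewrite -scalerAl -scalerAr scalerA expRD rmorphM.
- move=> x xu [m k] /=; apply: commrM; last exact: Pc.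
  exact: comm_spectral_proj.
Qed.

End CommutingUnitaries.

Section UnitaryExponentials.
Variables (R : realType) (N : nat) (A : cstarAlgebra R).
Hypothesis N_gt0 : (0 < N)%N.

Lemma unitary_root_starX (u : A) (n : 'I_N) :
  unitary_elt u -> u ^+ N = 1 -> star u ^+ n = u ^+ (ord_neg N_gt0 n).
Proof.
move=> [u1 u2] uN.
have umod a : u ^+ (a %% N) = u ^+ a.
  by rewrite [in RHS](divn_eq a N) exprD mulnC exprM uN expr1n mul1r.
rewrite /= umod -[RHS]mul1r.
have {1}<- : star u ^+ n * u ^+ n = 1.
  by rewrite -exprMn_comm ?u1 ?expr1n // /GRing.comm u1 u2.
by rewrite -mulrA -exprD subnKC ?uN ?mulr1 // ltnW.
Qed.

(** The adjoint of u is its inverse, which negates the exponents, and the coefficients are even. *)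
Lemma unit_exp_starr (f : 'I_N -> R) t (u : A) :
  unitary_elt u -> u ^+ N = 1 -> unit_exp f t (star u) = unit_exp f t u.
Proof.
move=> uU uN; rewrite /unit_exp [RHS](reindex_inj (inv_inj (ord_negK N_gt0))).
by apply: eq_bigr => n _; rewrite exp_coef_neg unitary_root_starX.
Qed.

Lemma star_unit_exp (f : 'I_N -> R) t (u : A) :
  unitary_elt u -> u ^+ N = 1 -> star (unit_exp f t u) = unit_exp f t u.
Proof.
move=> uU uN; rewrite -[RHS]unit_exp_starr // /unit_exp.
elim/big_rec2: _ => [|n x y _ <-]; first exact: star0.
by rewrite starD starZ (exp_coef_conj f t N_gt0) starX.
Qed.

Variables (I : eqType) (f : I -> 'I_N -> R) (u : I -> A).
Hypothesis uU : forall i, unitary_elt (u i).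
Hypothesis uN : forall i, u i ^+ N = 1.
Hypothesis u_comm : forall i j, GRing.comm (u i) (u j).

Lemma star_exp_prod t s : star (exp_prod f u t s) = exp_prod f u t s.
Proof.
elim: s => [|i s IH]; first by rewrite /exp_prod big_nil star1.
rewrite /exp_prod big_cons -/(exp_prod f u t s) starM IH star_unit_exp //.
by apply/commr_sym/commr_prod => j _; exact: unit_exp_comm.
Qed.

(** The exponentials are self-adjoint, not unitary, so [star] turns the conjugation into its
    inverse. Hence the inverse of beta^* is made of the same two conjugations as beta, in the
    opposite order. *)
Lemma star_exp_conj t s x :
  star (exp_conj f u t s x) = exp_conj f u (- t) s (star x).
Proof. by rewrite /exp_conj !starM !star_exp_prod opprK mulrA. Qed.

End UnitaryExponentials.

(** * Locality of the dynamics *)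

Section MatrixPowers.
Variables (R : realType) (N : nat).
Hypothesis N_gt0 : (0 < N)%N.

Lemma iter_P_mx k :
  iter k (mulmx (P_mx R N)) 1%:M =
  \matrix_(a < N, c < N) (a == (c + k) %% N :> nat)%N%:R.
Proof.
elim: k => [|k IH].
  by apply/matrixP => a c; rewrite !mxE addn0 modn_small.
apply/matrixP => a c; rewrite [LHS]/= IH !mxE.
rewrite (bigD1 (Ordinal (ltn_pmod (c + k) N_gt0))) //= !mxE /= eqxx mulr1.
rewrite big1 ?addr0 => [|j jc]; last first.
  by rewrite !mxE -(inj_eq val_inj) /= in jc *; rewrite (negPf jc) mulr0.
by rewrite -[(_ %% N).+1]addn1 modnDml addn1 addnS.
Qed.

Lemma iter_Q_mx k :
  iter k (mulmx (Q_mx R N)) 1%:M =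
  \matrix_(a < N, c < N) ((a == c)%:R * root_unity R N a ^+ k).
Proof.
elim: k => [|k IH].
  by apply/matrixP => a c; rewrite !mxE expr0 mulr1.
apply/matrixP => a c; rewrite [LHS]/= IH !mxE.
rewrite (bigD1 a) //= !mxE eqxx mul1r big1 ?addr0 => [|j ja]; last first.
  by rewrite !mxE eq_sym (negPf ja) !mul0r.
by rewrite mulrCA exprS.
Qed.

Lemma iter_P_mxN : iter N (mulmx (P_mx R N)) 1%:M = 1%:M.
Proof.
by rewrite iter_P_mx; apply/matrixP => a c; rewrite !mxE modnDr modn_small.
Qed.

Lemma iter_Q_mxN : iter N (mulmx (Q_mx R N)) 1%:M = 1%:M.
Proof.
by rewrite iter_Q_mx; apply/matrixP => a c; rewrite !mxE root_unityXN ?mulr1.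
Qed.

Lemma adj_mxK n : involutive (@adj_mx R n).
Proof. by move=> M; apply/matrixP => a c; rewrite !mxE conjCK. Qed.

Lemma Q_mx_unitary : adj_mx (Q_mx R N) *m Q_mx R N = 1%:M.
Proof.
apply/matrixP => a c; rewrite !mxE (bigD1 a) //= big1 ?addr0 => [|j ja].
  by rewrite !mxE eqxx mul1r mulrCA root_unity_conjM mulr1.
by rewrite !mxE (negPf ja) mul0r rmorph0 mul0r.
Qed.

End MatrixPowers.

Section Locality.
Variables (R : realType) (N : nat) (FA : fieldAlgebra R N).
Hypothesis N_gt0 : (0 < N)%N.
Local Notation Qc i := (cell_mx FA i (Q_mx R N)).
Local Notation Pc i := (cell_mx FA i (P_mx R N)).

Lemma cell_mx_iter i M k :
  cell_mx FA i (iter k (mulmx M) 1%:M) = cell_mx FA i M ^+ k.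
Proof.
elim: k => [|k IH]; first by rewrite cell_mx1.
by rewrite iterS cell_mxM IH exprS.
Qed.

Lemma cell_PN i : Pc i ^+ N = 1.
Proof. by rewrite -cell_mx_iter iter_P_mxN // cell_mx1. Qed.

Lemma cell_QN i : Qc i ^+ N = 1.
Proof. by rewrite -cell_mx_iter iter_Q_mxN // cell_mx1. Qed.

Lemma cell_Q_unitary i : unitary_elt (Qc i).
Proof.
split; rewrite -cell_mx_star -cell_mxM -(cell_mx1 FA i).
  by rewrite Q_mx_unitary.
by rewrite (mulmx1C (Q_mx_unitary R N)).
Qed.

Lemma cell_Q_comm i j : GRing.comm (Qc i) (Qc j).
Proof. by have [->|ij] := eqVneq i j; [|exact: cell_mx_comm]. Qed.

(** The terms of [A_V], indexed by [cell]: [inl p] stands here for the plaquette with lower left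
    corner p, not for a site. *)
Definition plaq_bond_op (i : cell) : FA :=
  match i with
  | inl p => dQ_G FA p
  | inr b => dQ_H FA (b, true) * star (Q_G FA (b, true))
  end.

Definition site_bond_op (i : cell) : FA := Pc i.

(** The cells whose Q enters the term; [inl] is a plaquette in the argument but a site in the
    result. *)
Definition plaq_bond_cells (i : cell) : seq cell :=
  match i with
  | inl p => [seq inr b.1 | b <- boundary p]
  | inr b => [:: inl (bond_src (b, true)); inl (bond_tgt (b, true)); inr b]
  end.

Lemma unitary_root_Q_G b : unitary_elt (Q_G FA b) /\ Q_G FA b ^+ N = 1.
Proof.
have u := cell_Q_unitary (inr b.1).
rewrite /Q_G; case: b.2; split; rewrite ?cell_QN //; first exact: unitary_star.
by rewrite -starX cell_QN star1.
Qed.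

Lemma comm_Q_G x b : GRing.comm x (Qc (inr b.1)) -> GRing.comm x (Q_G FA b).
Proof.
by rewrite /Q_G; case: b.2 => // xb; exact: comm_unitary_star (cell_Q_unitary _) _.
Qed.

Lemma comm_plaq_bond_op x i :
  (forall j, j \in plaq_bond_cells i -> GRing.comm x (Qc j)) ->
  GRing.comm x (plaq_bond_op i).
Proof.
case: i => [p|b] xu /=.
  rewrite /dQ_G big_seq; apply: commr_prod => b bp; apply/comm_Q_G/xu.
  exact: map_f.
apply: commrM; first apply: commrM.
- by apply: xu; rewrite !inE eqxx !orbT.
- apply: comm_unitary_star; first exact: cell_Q_unitary.
  by apply: xu; rewrite !inE eqxx.
- apply: comm_unitary_star; first exact: (unitary_root_Q_G _).1.
  by apply: comm_Q_G; apply: xu; rewrite !inE eqxx !orbT.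
Qed.

Lemma plaq_bond_op_comm i j : GRing.comm (plaq_bond_op i) (plaq_bond_op j).
Proof.
apply: comm_plaq_bond_op => k _; apply/commr_sym/comm_plaq_bond_op => l _.
exact: cell_Q_comm.
Qed.

Lemma unitary_root_mul (a b : FA) : GRing.comm a b ->
  unitary_elt a /\ a ^+ N = 1 -> unitary_elt b /\ b ^+ N = 1 ->
  unitary_elt (a * b) /\ (a * b) ^+ N = 1.
Proof.
move=> ab [ua aN] [ub bN]; split; first exact: unitaryM.
by rewrite exprMn_comm // aN bN mulr1.
Qed.

Lemma unitary_root_star (a : FA) :
  unitary_elt a /\ a ^+ N = 1 -> unitary_elt (star a) /\ star a ^+ N = 1.
Proof.
by move=> [ua aN]; split; [exact: unitary_star|rewrite -starX aN star1].
Qed.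

Lemma Q_G_comm b b' : GRing.comm (Q_G FA b) (Q_G FA b').
Proof. by apply/comm_Q_G/commr_sym/comm_Q_G/cell_Q_comm. Qed.

Lemma unitary_root_plaq_bond_op i :
  unitary_elt (plaq_bond_op i) /\ plaq_bond_op i ^+ N = 1.
Proof.
have Qr j : unitary_elt (Qc j) /\ Qc j ^+ N = 1.
  by split; [exact: cell_Q_unitary|exact: cell_QN].
case: i => [p|b] /=.
  rewrite /dQ_G; elim: (boundary p) => [|b s IH].
    by rewrite big_nil expr1n; split; first exact: unitary1.
  rewrite big_cons; apply: unitary_root_mul => //; last exact: unitary_root_Q_G.
  by apply: commr_prod => b' _; exact: Q_G_comm.
apply: unitary_root_mul; first apply: comm_unitary_star.
- exact: (unitary_root_Q_G _).1.
- apply: comm_Q_G; apply/commr_sym/commrM; first exact: cell_Q_comm.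
  by apply: comm_unitary_star; [exact: cell_Q_unitary|exact: cell_Q_comm].
- apply: unitary_root_mul; [|exact: Qr|exact/unitary_root_star/Qr].
  by apply: comm_unitary_star; [exact: cell_Q_unitary|exact: cell_Q_comm].
- exact/unitary_root_star/unitary_root_Q_G.
Qed.

Lemma plaq_bond_op_unitary i : unitary_elt (plaq_bond_op i).
Proof. exact: (unitary_root_plaq_bond_op i).1. Qed.

Lemma plaq_bond_opN i : plaq_bond_op i ^+ N = 1.
Proof. exact: (unitary_root_plaq_bond_op i).2. Qed.

Lemma site_bond_op_unitary i : unitary_elt (site_bond_op i).
Proof. exact: P_unitary. Qed.

Lemma site_bond_opN i : site_bond_op i ^+ N = 1.
Proof. exact: cell_PN. Qed.

Lemma site_bond_op_comm i j : GRing.comm (site_bond_op i) (site_bond_op j).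
Proof. exact: P_comm. Qed.

(** An element of the algebra generated by the P and Q involves finitely many cells, which C
    collects. Allowing every matrix M closes the case of [star], where M is replaced by its
    adjoint. *)
Lemma F0_local x : F0 x ->
  exists C : seq cell, forall i M, i \notin C -> GRing.comm x (cell_mx FA i M).
Proof.
elim=> {x} [x [j _ jx]||k x y _ [C xC] _ [D yD]|x y _ [C xC] _ [D yD]|x _ [C xC]].
- exists [:: j] => i M; rewrite inE => ij.
  by case: jx => ->; apply: cell_mx_comm; rewrite eq_sym.
- by exists [::] => i M _; apply/commr_sym/commr1.
- exists (C ++ D) => i M; rewrite mem_cat negb_or => /andP[/(xC i M) ? /(yD i M) ?].
  by apply/commr_sym/commrD; last exact/commr_sym; rewrite /GRing.comm
    -scalerAl -scalerAr; congr (_ *: _); apply/commr_sym.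
- exists (C ++ D) => i M; rewrite mem_cat negb_or => /andP[/(xC i M) ? /(yD i M) ?].
  by apply/commr_sym/commrM; apply/commr_sym.
- exists C => i M /(xC i (adj_mx M)) /(congr1 (@star R FA)).
  by rewrite !starM -cell_mx_star adj_mxK => /esym.
Qed.

(** The terms of [A_V] that may involve cell j: the four bonds at a site, or a bond and its two
    adjacent plaquettes. *)
Definition touching (j : cell) : seq cell :=
  match j with
  | inl x => [:: inr (x, false); inr (x, true);
                 inr (x - unit_vec false, false); inr (x - unit_vec true, true)]
  | inr b => [:: inr b; inl b.1; inl (b.1 - unit_vec (~~ b.2))]
  end.

Lemma touchingP i j : j \in plaq_bond_cells i -> i \in touching j.
Proof.
case: i => [p|[x d]] /=.
  by rewrite !inE => /or4P[] /eqP -> /=; rewrite !inE /= ?addrK ?eqxx ?orbT.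
rewrite !inE => /or3P[] /eqP -> /=; rewrite !inE /=.
- by rewrite /bond_src /=; case: d; rewrite eqxx ?orbT.
- by rewrite /bond_tgt /=; case: d; rewrite addrK eqxx ?orbT.
- by rewrite eqxx.
Qed.

Lemma F0_plaq_bond_local x : F0 x ->
  exists C : seq cell, forall i, i \notin C -> GRing.comm x (plaq_bond_op i).
Proof.
move=> /F0_local[C xC]; exists (flatten [seq touching j | j <- C]) => i iC.
apply: comm_plaq_bond_op => j /touchingP ij; apply: xC; apply: contra iC => jC.
by apply/flatten_mapP; exists j.
Qed.

End Locality.

(** * Exhaustion of the lattice by boxes *)

Section Boxes.

Lemma mem_box_sites L (x : site) :
  (x \in box_sites L) = ((- L%:Z <= x.1 <= L%:Z) && (- L%:Z <= x.2 <= L%:Z)).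
Proof.
case: x => x y /=; apply/allpairsP/idP => [[[i j] []]|].
  by rewrite !mem_iota /= => hi hj [-> ->]; lia.
move=> h; exists (absz (x + L%:Z), absz (y + L%:Z)); rewrite !mem_iota.
by split; rewrite /=; [lia|lia|congr pair; lia].
Qed.

Lemma box_sites_uniq L : uniq (box_sites L).
Proof.
by apply: allpairs_uniq => [||[i j] [k l] _ _ /= [? ?]]; rewrite ?iota_uniq //;
  congr pair; lia.
Qed.

Lemma box_bonds_uniq L : uniq (box_bonds L).
Proof.
apply/filter_uniq/allpairs_uniq => //; first exact: box_sites_uniq.
by move=> [x d] [y e].
Qed.

Definition box_plaq_bonds (L : nat) : seq cell :=
  [seq inl p | p <- box_plaquettes L] ++ [seq inr b | b <- box_bonds L].

Lemma uniq_sum_cat (S T : eqType) (s : seq S) (t : seq T) :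
  uniq s -> uniq t ->
  uniq ([seq inl x | x <- s] ++ [seq inr y | y <- t] : seq (S + T)).
Proof.
move=> us ut; rewrite cat_uniq !map_inj_uniq ?us ?ut //= ?andbT.
- by apply/hasPn => _ /mapP[y _ ->]; apply/mapP => -[].
- by move=> x y [].
- by move=> x y [].
Qed.

Lemma box_cells_uniq L : uniq (box_cells L).
Proof. by apply: uniq_sum_cat; [exact: box_sites_uniq|exact: box_bonds_uniq]. Qed.

Lemma box_plaq_bonds_uniq L : uniq (box_plaq_bonds L).
Proof.
by apply: uniq_sum_cat; [exact/filter_uniq/box_sites_uniq|exact: box_bonds_uniq].
Qed.

(** The added 1 leaves room for the far end of a bond, or the opposite corner of a plaquette, based
    at x. *)
Definition site_size (x : site) : nat := (`|x.1| + `|x.2| + 1)%N.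

Definition cell_size (i : cell) : nat :=
  match i with inl x => site_size x | inr b => site_size b.1 end.

Lemma mem_inl_cat (S T : eqType) (s : seq S) (t : seq T) x :
  (inl x \in ([seq inl x | x <- s] ++ [seq inr y | y <- t] : seq (S + T))) = (x \in s).
Proof.
rewrite mem_cat mem_map; last by move=> ? ? [].
by case: (x \in s) => //=; apply/mapP => -[].
Qed.

Lemma mem_inr_cat (S T : eqType) (s : seq S) (t : seq T) y :
  (inr y \in ([seq inl x | x <- s] ++ [seq inr y | y <- t] : seq (S + T))) = (y \in t).
Proof.
rewrite mem_cat orbC mem_map; last by move=> ? ? [].
by case: (y \in t) => //=; apply/mapP => -[].
Qed.

Lemma mem_box_bonds L (b : pbond) : (site_size b.1 <= L)%N -> b \in box_bonds L.
Proof.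
case: b => [[x y] d] h; have {}h : (absz x + absz y + 1 <= L)%N by [].
rewrite mem_filter mem_box_sites.
apply/andP; split.
  have {}h : [&& - L%:Z <= x, x + 1 <= L%:Z, - L%:Z <= y & y + 1 <= L%:Z] by lia.
  case: d h => /= h.
    rewrite -[X in X && _]/(- L%:Z <= x + 0 <= L%:Z).
    by rewrite -[X in _ && X]/(- L%:Z <= y + 1 <= L%:Z); lia.
  rewrite -[X in X && _]/(- L%:Z <= x + 1 <= L%:Z).
  by rewrite -[X in _ && X]/(- L%:Z <= y + 0 <= L%:Z); lia.
apply/allpairsP; exists ((x, y), d); rewrite mem_box_sites /=; split=> //; first lia.
by case: d; rewrite !inE.
Qed.

Lemma mem_box_cells L i : (cell_size i <= L)%N -> i \in box_cells L.
Proof.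
case: i => [[x y]|b] h; rewrite ?mem_inl_cat ?mem_inr_cat; last exact: mem_box_bonds.
by rewrite mem_box_sites; rewrite /= /site_size /= in h *; lia.
Qed.

Lemma mem_box_plaq_bonds L i : (cell_size i <= L)%N -> i \in box_plaq_bonds L.
Proof.
case: i => [[x y]|b] h; rewrite ?mem_inl_cat ?mem_inr_cat; last exact: mem_box_bonds.
by rewrite mem_filter !mem_box_sites; rewrite /= /site_size /= in h *; lia.
Qed.

Lemma sub_boxes (s : seq cell) : exists L0, forall L, (L0 <= L)%N ->
  {subset s <= box_cells L} /\ {subset s <= box_plaq_bonds L}.
Proof.
exists (\max_(i <- s) cell_size i) => L L0L.
by split=> i si; [apply: mem_box_cells|apply: mem_box_plaq_bonds];
  apply: leq_trans L0L; apply: leq_bigmax_seq.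
Qed.

End Boxes.

(** * The dynamics in a box as conjugations by local exponentials *)

Section LocalDynamics.
Variables (R : realType) (N : nat) (FA : fieldAlgebra R N) (c : couplings R N).
Hypothesis N_gt0 : (0 < N)%N.

(** Real Fourier transforms allow the spectral values to be exponentiated over the reals; the
    property is stable under passing to the dual couplings. *)
Definition real_couplings : Prop := forall f m,
  [\/ f = beta_g c, f = beta_h c, f = gamma_g c | f = gamma_h c] ->
  fourier f m = (fourier_re f m)%:C.
Hypothesis c_real : real_couplings.

Definition plaq_bond_coupling (i : cell) : 'I_N -> R :=
  match i with inl _ => beta_g c | inr _ => beta_h c end.

Definition site_bond_coupling (i : cell) : 'I_N -> R :=
  match i with inl _ => gamma_h c | inr _ => gamma_g c end.

Local Notation uA := (plaq_bond_op FA).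
Local Notation uB := (site_bond_op FA).
Local Notation fA := plaq_bond_coupling.
Local Notation fB := site_bond_coupling.

Definition expA := exp_prod fA uA.
Definition expB := exp_prod fB uB.
Definition conjA := exp_conj fA uA.
Definition conjB := exp_conj fB uB.

Let uAN i : uA i ^+ N = 1 := plaq_bond_opN FA N_gt0 i.
Let uBN i : uB i ^+ N = 1 := site_bond_opN FA N_gt0 i.
Let uAc i j : GRing.comm (uA i) (uA j) := plaq_bond_op_comm FA N_gt0 i j.
Let uBc i j : GRing.comm (uB i) (uB j) := site_bond_op_comm FA i j.

Lemma plaq_bond_coupling_real i m : fourier (fA i) m = (fourier_re (fA i) m)%:C.
Proof. by case: i => ? /=; apply: c_real; [constructor 1|constructor 2]. Qed.

Lemma site_bond_coupling_real i m : fourier (fB i) m = (fourier_re (fB i) m)%:C.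
Proof. by case: i => ? /=; apply: c_real; [constructor 4|constructor 3]. Qed.

Lemma cs_exp_A_V (t : R) L : cs_exp (t%:C *: A_V FA c L) = expA t (box_plaq_bonds L).
Proof.
rewrite /expA -(cs_exp_power_sum N_gt0 uAN uAc plaq_bond_coupling_real).
congr cs_exp; rewrite /A_V big_cat !big_map scalerDr !scaler_sumr.
by congr (_ + _).
Qed.

Lemma cs_exp_B_V (t : R) L : cs_exp (t%:C *: B_V FA c L) = expB t (box_cells L).
Proof.
rewrite /expB -(cs_exp_power_sum N_gt0 uBN uBc site_bond_coupling_real).
(* [B_V] lists the bonds before the sites, [box_cells] the sites before the bonds. *)
congr cs_exp; rewrite /B_V scalerDr [LHS]addrC !scaler_sumr.
by rewrite [RHS]big_cat -[RHS]/(_ + _); congr (_ + _); rewrite big_map.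
Qed.

Let half_C : 2^-1 = (2^-1)%:C :> R[i].
Proof. by rewrite fmorphV rmorph_nat. Qed.

Lemma S_VE L : S_V FA c L = expB 2^-1 (box_cells L) * expA 2^-1 (box_plaq_bonds L).
Proof. by rewrite /S_V half_C cs_exp_A_V cs_exp_B_V. Qed.

Lemma S_V_invE L :
  S_V_inv FA c L = expA (- 2^-1) (box_plaq_bonds L) * expB (- 2^-1) (box_cells L).
Proof.
rewrite /S_V_inv half_C -!scaleNr.
by rewrite -(rmorphN (real_complex R)) cs_exp_A_V cs_exp_B_V.
Qed.

Lemma S_V_conj L x : S_V FA c L * x * S_V_inv FA c L =
  conjB 2^-1 (box_cells L) (conjA 2^-1 (box_plaq_bonds L) x).
Proof. by rewrite S_VE S_V_invE /conjA /conjB /exp_conj !mulrA. Qed.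

Lemma algA0X (x : FA) n : algA0 x -> algA0 (x ^+ n).
Proof.
move=> xA; elim: n => [|n IH]; first exact: algA0_1.
by rewrite exprS; exact: algA0M.
Qed.

Lemma algA0D (x y : FA) : algA0 x -> algA0 y -> algA0 (x + y).
Proof. by move=> xA yA; rewrite -[x]scale1r; exact: algA0_lin. Qed.

Lemma algA0Z k (x : FA) : algA0 x -> algA0 (k *: x).
Proof. by move=> xA; rewrite -[_ *: x]addr0; apply: algA0_lin => //; exact: algA0_0. Qed.

Lemma algA0_sum (I : Type) (s : seq I) (F : I -> FA) :
  (forall i, algA0 (F i)) -> algA0 (\sum_(i <- s) F i).
Proof. by move=> h; elim/big_ind: _ => //; [exact: algA0_0|exact: algA0D]. Qed.

Lemma algA0_unit_exp (f : 'I_N -> R) t (u : FA) : algA0 u -> algA0 (unit_exp f t u).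
Proof. by move=> uA; apply: algA0_sum => n; apply/algA0Z/algA0X. Qed.

Lemma algA0_prod (I : Type) (s : seq I) (F : I -> FA) :
  (forall i, algA0 (F i)) -> algA0 (\prod_(i <- s) F i).
Proof. by move=> h; elim/big_ind: _ => //; [exact: algA0_1|exact: algA0M]. Qed.

Lemma F0_P_cell i : F0 (cell_mx FA i (P_mx R N)).
Proof. by apply: star_gen_in; exists i => //; left. Qed.

Lemma F0_Q_cell i : F0 (cell_mx FA i (Q_mx R N)).
Proof. by apply: star_gen_in; exists i => //; right. Qed.

Lemma algA0_P_G b : algA0 (P_G FA b).
Proof.
split=> [|x]; last first.
  rewrite /P_G; case: b.2; first exact: P_gauss_comm.
  by apply: algA_star => y; exact: P_gauss_comm.
by rewrite /P_G; case: b.2; [|apply: star_gen_star]; exact: F0_P_cell.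
Qed.

Lemma algA0_site_bond_op i : algA0 (uB i).
Proof. by split=> [|x]; [exact: F0_P_cell|exact: P_gauss_comm]. Qed.

End LocalDynamics.

(** * Gauge invariance and duality *)

Section GaugeInvariance.
Variables (R : realType) (N : nat) (FA : fieldAlgebra R N).
Hypothesis N_gt0 : (0 < N)%N.
Local Notation z := (root_unity R N).

(** A Weyl relation. That w has modulus 1 is included so that the relation passes to adjoints of
    unitaries, with the conjugate phase. *)
Definition phase_comm (w : R[i]) (a b : FA) : Prop :=
  w * w^*%R = 1 /\ a * b = w *: (b * a).

Lemma phase_comm1 a b : GRing.comm a b <-> phase_comm 1 a b.
Proof.
by rewrite /phase_comm rmorph1 mulr1 scale1r; split=> [|[]].
Qed.

Lemma phase_commMr w w' a b b' :
  phase_comm w a b -> phase_comm w' a b' -> phase_comm (w * w') a (b * b').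
Proof.
move=> [w1 e] [w1' e']; split; first by rewrite rmorphM mulrACA w1 w1' mulr1.
by rewrite mulrA e -scalerAl -(mulrA b a) e' -scalerAr scalerA mulrA.
Qed.

Lemma phase_commMl w w' a a' b :
  phase_comm w a b -> phase_comm w' a' b -> phase_comm (w * w') (a * a') b.
Proof.
move=> [w1 e] [w1' e']; split; first by rewrite rmorphM mulrACA w1 w1' mulr1.
by rewrite -mulrA e' -scalerAr (mulrA a) e -scalerAl scalerA mulrC (mulrA b).
Qed.

Lemma phase_comm_starl w a b :
  unitary_elt a -> phase_comm w a b -> phase_comm w^*%R (star a) b.
Proof.
move=> [a1 a2] [w1 e]; split; first by rewrite conjCK mulrC.
have : star a * (a * b) * star a = b * star a by rewrite mulrA a1 mul1r.
rewrite e -scalerAr -scalerAl -!mulrA a2 mulr1 => <-.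
by rewrite scalerA mulrC w1 scale1r.
Qed.

Lemma phase_comm_starr w a b :
  unitary_elt b -> phase_comm w a b -> phase_comm w^*%R a (star b).
Proof.
move=> [b1 b2] [w1 e]; split; first by rewrite conjCK mulrC.
have : star b * (a * b) * star b = star b * a by rewrite -!mulrA b2 mulr1.
rewrite e -scalerAr -scalerAl mulrA b1 mul1r => <-.
by rewrite scalerA mulrC w1 scale1r.
Qed.

Definition site_phase (x y : site) : R[i] := if x == y then (z 1)^*%R else 1.

(** In a common cell, the nonzero entries of P sit at a = c + 1, where [z a] is [z 1] times
    [z c]. *)
Lemma phase_P_Q i j : phase_comm (if i == j then (z 1)^*%R else 1)
  (cell_mx FA i (P_mx R N)) (cell_mx FA j (Q_mx R N)).
Proof.
have [<-|ij] := eqVneq i j; last exact/phase_comm1/cell_mx_comm.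
split; first by rewrite conjCK root_unity_conjM.
have mxE : P_mx R N *m Q_mx R N = (z 1)^*%R *: (Q_mx R N *m P_mx R N).
  apply/matrixP => a c; rewrite !mxE (bigD1 c) //= [in RHS](bigD1 a) //=.
  rewrite !mxE !eqxx !mul1r.
  rewrite !big1 ?addr0 => [|k ka|k kc]; last 2 first.
  - by rewrite !mxE eq_sym (negPf ka) !mul0r.
  - by rewrite !mxE (negPf kc) mul0r mulr0.
  case: eqP => [e|_]; last by rewrite mul0r !mulr0.
  rewrite mul1r mulr1 e root_unity_mod // -[c.+1]addn1 root_unityD mulrCA.
  by rewrite root_unity_conjM mulr1.
have cZ k M : cell_mx FA i (k *: M) = k *: cell_mx FA i M.
  have c0 : cell_mx FA i 0 = 0.
    have := cell_mx_lin FA i (-1) 0 0.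
    by rewrite scaler0 addr0 scaleN1r addNr.
  by have := cell_mx_lin FA i k M 0; rewrite c0 !addr0.
by rewrite -cell_mxM mxE cZ cell_mxM.
Qed.

Lemma phase_P_G_Q_G (b : bond) (e : pbond) :
  phase_comm (if b.1 == e then (if b.2 then (z 1)^*%R else z 1) else 1)
    (P_G FA b) (Q_G FA (e, true)).
Proof.
have := phase_P_Q (inr b.1) (inr e); rewrite (inj_eq (@inr_inj _ _)).
rewrite /P_G /Q_G /=; case: b.2 => // /(phase_comm_starl (P_unitary FA (inr b.1))).
by case: eqP => _; rewrite ?rmorph1 ?conjCK.
Qed.

(** The bond e starts at x, or -e does, exactly when x is an end point of e; in the second case P_G
    is inverted, which conjugates the phase. *)
Lemma phase_dstar_Q_G x (e : pbond) :
  phase_comm (site_phase x e.1 * (site_phase x (e.1 + unit_vec e.2))^*%R)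
    (dstar_P_G FA x) (Q_G FA (e, true)).
Proof.
have P1 := phase_P_G_Q_G (x, false, true) e.
have P2 := phase_P_G_Q_G (x, true, true) e.
have P3 := phase_P_G_Q_G (x - unit_vec false, false, false) e.
have P4 := phase_P_G_Q_G (x - unit_vec true, true, false) e.
have := phase_commMl P1 (phase_commMl P2 (phase_commMl P3 P4)).
rewrite /dstar_P_G !big_cons big_nil mulr1; congr phase_comm.
case: e {P1 P2 P3 P4} => y d /=; rewrite !xpair_eqE !subr_eq /site_phase.
case: d => /=; rewrite ?andbT ?andbF ?mulr1 ?mul1r; congr (_ * _);
  by case: eqP => _; rewrite ?rmorph1 ?conjCK.
Qed.

Lemma phase_gauss_Q_H x y : phase_comm (site_phase x y) (gauss FA x) (Q_H FA y).
Proof.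
rewrite -[site_phase x y]mulr1; apply: phase_commMl.
  by have := phase_P_Q (inl x) (inl y); rewrite (inj_eq (@inl_inj _ _)).
apply/phase_comm1/commr_sym/comm_unitary_star; first exact: dstar_P_G_unitary.
apply: commr_prod => b _; rewrite /P_G; case: b.2; last apply: comm_unitary_star.
- exact: cell_mx_comm.
- exact: P_unitary.
- exact: cell_mx_comm.
Qed.

Definition gauge_bond (b : bond) : FA := dQ_H FA b * star (Q_G FA b).

Lemma Q_H_G_comm x b : GRing.comm (Q_H FA x) (Q_G FA b).
Proof. by apply/comm_Q_G/cell_Q_comm. Qed.

Lemma unitary_Q_H x : unitary_elt (Q_H FA x).
Proof. exact: cell_Q_unitary. Qed.

Lemma unitary_Q_G b : unitary_elt (Q_G FA b).
Proof. exact: (unitary_root_Q_G FA N_gt0 b).1. Qed.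

Lemma star_Q_G b : star (Q_G FA b) = Q_G FA (bond_opp b).
Proof. by case: b => e [] //=; rewrite /Q_G /= starK. Qed.

Lemma gauge_bond_opp b :
  gauge_bond (bond_opp b) = Q_H FA (bond_src b) * Q_G FA b * star (Q_H FA (bond_tgt b)).
Proof.
rewrite /gauge_bond /dQ_H star_Q_G.
have -> : bond_opp (bond_opp b) = b by case: b => e [].
have -> : bond_tgt (bond_opp b) = bond_src b by case: b => e [].
have -> : bond_src (bond_opp b) = bond_tgt b by case: b => e [].
rewrite -!mulrA; congr (_ * _); apply/commr_sym/comm_unitary_star.
  exact: unitary_Q_H.
exact/commr_sym/Q_H_G_comm.
Qed.

Lemma star_gauge_bond b : star (gauge_bond b) = gauge_bond (bond_opp b).
Proof.
by rewrite gauge_bond_opp /gauge_bond /dQ_H !starM !starK Q_H_G_comm mulrA.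
Qed.

(** At each end point of e the phase of the Q_H factor cancels that of the Q_G factor. *)
Lemma algA_gauge_bond_pos e : algA (gauge_bond (e, true)).
Proof.
move=> x; apply/commr_sym/phase_comm1.
have Ht := phase_gauss_Q_H x (bond_tgt (e, true)).
have Hs := phase_comm_starr (unitary_Q_H _) (phase_gauss_Q_H x (bond_src (e, true))).
have G1 := phase_comm_starl (dstar_P_G_unitary FA x) (phase_dstar_Q_G x e).
have : phase_comm 1 (P_H FA x) (Q_G FA (e, true)) by apply/phase_comm1/cell_mx_comm.
move=> /phase_commMl/(_ G1)/(phase_comm_starr (unitary_Q_G _)) G2.
have := phase_commMr (phase_commMr Ht Hs) G2; congr phase_comm.
rewrite /bond_src /bond_tgt /= mul1r conjCK.
have p y : (site_phase x y)^*%R * site_phase x y = 1.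
  rewrite /site_phase; case: eqP => _; last by rewrite rmorph1 mulr1.
  by rewrite conjCK mulrC root_unity_conjM.
set t := site_phase x _; set s := site_phase x _.
have -> : t * s^*%R * (s * t^*%R) = (t^*%R * t) * (s^*%R * s) by ring.
by rewrite !p mulr1.
Qed.

Lemma algA0_gauge_bond b : algA0 (gauge_bond b).
Proof.
have pos e : algA0 (gauge_bond (e, true)).
  split; last exact: algA_gauge_bond_pos.
  apply: star_genM; first apply: star_genM.
  - exact: F0_Q_cell.
  - exact/star_gen_star/F0_Q_cell.
  - exact/star_gen_star/F0_Q_cell.
case: b => e [] //; rewrite -[(e, false)]/(bond_opp (e, true)) -star_gauge_bond.
exact: algA0_star.
Qed.

(* The factors Q_H telescope around the plaquette. *)
Lemma dQ_G_gauge_bond p :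
  dQ_G FA p = \prod_(b <- boundary p) gauge_bond (bond_opp b).
Proof.
rewrite /dQ_G !big_cons !big_nil !mulr1 !gauge_bond_opp /bond_src /bond_tgt /=.
have c x a : star (Q_H FA x) * (Q_H FA x * a) = a.
  by rewrite mulrA (unitary_Q_H x).1 mul1r.
rewrite (addrAC p (unit_vec true)) -!mulrA !c.
(* Telescoping leaves Q_H p and its adjoint at the two ends; moving the former across the four Q_G
   lets them cancel. *)
have QHc : GRing.comm (Q_H FA p) (Q_G FA (p, false, true) *
    (Q_G FA (p + unit_vec false, true, true) *
     (Q_G FA (p + unit_vec true, false, false) * Q_G FA (p, true, false)))).
  by do !apply: commrM; exact: Q_H_G_comm.
move: QHc; rewrite /GRing.comm !mulrA => ->.
by rewrite -!mulrA (unitary_Q_H p).2 mulr1.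
Qed.

End GaugeInvariance.

Section LocalAutomorphisms.
Variables (R : realType) (N : nat) (FA : fieldAlgebra R N) (c : couplings R N).
Hypothesis N_gt0 : (0 < N)%N.
Hypothesis c_real : real_couplings c.
Local Notation uA := (plaq_bond_op FA).
Local Notation uB := (site_bond_op FA).

Let uAN i : uA i ^+ N = 1 := plaq_bond_opN FA N_gt0 i.
Let uBN i : uB i ^+ N = 1 := site_bond_opN FA N_gt0 i.
Let uAc i j : GRing.comm (uA i) (uA j) := plaq_bond_op_comm FA N_gt0 i j.
Let uBc i j : GRing.comm (uB i) (uB j) := site_bond_op_comm FA i j.

Lemma algA0_plaq_bond_op i : algA0 (uA i).
Proof.
case: i => [p|b]; last exact: (algA0_gauge_bond FA N_gt0 (b, true)).
rewrite /= (dQ_G_gauge_bond FA); apply: algA0_prod => b.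
exact: algA0_gauge_bond.
Qed.

Lemma algA0_expA t s : algA0 (expA FA c t s).
Proof. by apply: algA0_prod => i; apply/algA0_unit_exp/algA0_plaq_bond_op. Qed.

Lemma algA0_expB t s : algA0 (expB FA c t s).
Proof. by apply: algA0_prod => i; apply/algA0_unit_exp/algA0_site_bond_op. Qed.

Lemma algA0_conjA t s (x : FA) : algA0 x -> algA0 (conjA c t s x).
Proof. by move=> xA; do !apply: algA0M => //; exact: algA0_expA. Qed.

Lemma algA0_conjB t s (x : FA) : algA0 x -> algA0 (conjB c t s x).
Proof. by move=> xA; do !apply: algA0M => //; exact: algA0_expB. Qed.

Lemma algA0_support (x : FA) : algA0 x -> exists C : seq cell,
  uniq C /\ forall i, i \notin C -> GRing.comm x (uA i) /\ GRing.comm x (uB i).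
Proof.
move=> [xF _]; have [C xC] := F0_local xF; have [D xD] := F0_plaq_bond_local N_gt0 xF.
exists (undup (C ++ D)); split=> [|i]; first exact: undup_uniq.
rewrite mem_undup mem_cat negb_or => /andP[iC iD].
by split; [exact: xD|exact: xC].
Qed.

(** The inner conjugation sees only a finite support C of x, the outer one only a finite support D
    of the result; beyond a box containing both, the sequence defining [beta] is constant. *)
Lemma beta_eventually (x : FA) : algA0 x -> exists L0, forall L, (L0 <= L)%N ->
  beta c x = conjB c 2^-1 (box_cells L) (conjA c 2^-1 (box_plaq_bonds L) x).
Proof.
move=> xA; have [C [uC xC]] := algA0_support xA.
pose y := conjA c 2^-1 C x.
have [D [uD yD]] := algA0_support (algA0_conjA 2^-1 C xA).
have [L1 h1] := sub_boxes C; have [L2 h2] := sub_boxes D.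
have E L : (maxn L1 L2 <= L)%N ->
    conjB c 2^-1 (box_cells L) (conjA c 2^-1 (box_plaq_bonds L) x) = conjB c 2^-1 D y.
  rewrite geq_max => /andP[/h1[_ CL] /h2[DL _]].
  have -> : conjA c 2^-1 (box_plaq_bonds L) x = y.
    apply: exp_conj_sub => //; first exact: box_plaq_bonds_uniq.
    by move=> i /xC[].
  apply: exp_conj_sub => //; first exact: box_cells_uniq.
  by move=> i /yD[].
exists (maxn L1 L2) => L LL; rewrite E // /beta; apply: cs_limE.
by apply: (@cs_cvg_eventually _ _ _ _ (maxn L1 L2)) => n nL; rewrite S_V_conj // E.
Qed.

End LocalAutomorphisms.

Local Open Scope quotient_scope.

(** * Classes modulo J and the Gauss law *)

Section Classes.
Variables (R : realType) (N : nat) (FA : fieldAlgebra R N).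
Implicit Types (x y : FA).

Lemma cls_val (a : A0 FA) : cls (val a) = \pi_(B0 FA) a.
Proof. by rewrite /cls /insubd valK. Qed.

Lemma cls_repr (v : B0 FA) : cls (val (repr v)) = v.
Proof. by rewrite cls_val reprK. Qed.

Lemma algA0_val (a : A0 FA) : algA0 (val a).
Proof. exact/A0_predP/valP. Qed.

Lemma algA0_lift x : algA0 x -> exists a : A0 FA, val a = x.
Proof. by move=> /A0_predP xA; exists (Sub x xA); exact: SubK. Qed.

Lemma clsM x y : algA0 x -> algA0 y -> cls (x * y) = cls x * cls y.
Proof.
move=> /algA0_lift[a <-] /algA0_lift[b <-].
have -> : val a * val b = val (a * b) by [].
by rewrite !cls_val; exact/esym/B0_mulE.
Qed.

Lemma clsD x y : algA0 x -> algA0 y -> cls (x + y) = cls x + cls y.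
Proof.
move=> /algA0_lift[a <-] /algA0_lift[b <-].
have -> : val a + val b = val (a + b) by [].
by rewrite !cls_val; exact/esym/B0_addE.
Qed.

Lemma clsZ k x : algA0 x -> cls (k *: x) = k *: cls x.
Proof.
move=> /algA0_lift[a <-].
have -> : k *: val a = val (k *: a) by [].
by rewrite !cls_val; exact/esym/B0_scaleE.
Qed.

Lemma cls1 : cls (1 : FA) = 1.
Proof. exact: (cls_val 1). Qed.

Lemma cls0 : cls (0 : FA) = 0.
Proof. exact: (cls_val 0). Qed.

Lemma cls_star x : algA0 x -> cls (star x) = B0_star (cls x).
Proof.
move=> /algA0_lift[a <-].
have -> : star (val a) = val (A0_star a) by [].
by rewrite !cls_val; exact/esym/B0_starE.
Qed.

Lemma clsX x n : algA0 x -> cls (x ^+ n) = cls x ^+ n.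
Proof.
move=> xA; elim: n => [|n IH]; first exact: cls1.
by rewrite !exprS clsM ?IH //; exact: algA0X.
Qed.

Lemma cls_sum (I : Type) (s : seq I) (F : I -> FA) :
  (forall i, algA0 (F i)) -> cls (\sum_(i <- s) F i) = \sum_(i <- s) cls (F i).
Proof.
move=> FA0; elim: s => [|i s IH]; first by rewrite !big_nil cls0.
by rewrite !big_cons clsD ?IH //; exact: algA0_sum.
Qed.

Lemma cls_prod (I : Type) (s : seq I) (F : I -> FA) :
  (forall i, algA0 (F i)) -> cls (\prod_(i <- s) F i) = \prod_(i <- s) cls (F i).
Proof.
move=> FA0; elim: s => [|i s IH]; first by rewrite !big_nil cls1.
by rewrite !big_cons clsM ?IH //; exact: algA0_prod.
Qed.

Lemma cls_eqJ x y : algA0 x -> algA0 y -> idealJ (x - y) -> cls x = cls y.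
Proof.
by move=> /algA0_lift[a <-] /algA0_lift[b <-] h; rewrite !cls_val; exact/pi_eqP.
Qed.

(** The difference is gauss x - 1 times a gauge invariant unitary, hence in J. It expresses the site
    terms through the generators on which [Delta] is given. *)
Lemma cls_gauss_law (x : site) : cls (P_H FA x) = \prod_(b <- bonds_from x) U1 FA b.
Proof.
rewrite /U1 -cls_prod; last exact: algA0_P_G.
apply: cls_eqJ; first exact: (algA0_site_bond_op FA (inl x)).
  by apply: algA0_prod => b; exact: algA0_P_G.
rewrite -/(dstar_P_G FA x).
have -> : P_H FA x - dstar_P_G FA x = (gauss FA x ^+ 1 - 1) * dstar_P_G FA x.
  by rewrite expr1 mulrBl mul1r /gauss -mulrA (dstar_P_G_unitary FA x).1 mulr1.
apply: idealJMr; last by move=> I [_ Ig]; exact: Ig.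
have [] : algA0 (dstar_P_G FA x) by apply: algA0_prod => b; exact: algA0_P_G.
by [].
Qed.

End Classes.

(** * Duality intertwines the dual dynamics with the star-inverse of beta *)

Section Duality.
Variables (R : realType) (N : nat) (FA : fieldAlgebra R N) (c : couplings R N).
Hypothesis N_gt0 : (0 < N)%N.
Hypothesis c_real : real_couplings c.
Variables (b b' Delta : B0 FA -> B0 FA).
Hypothesis b_def : induces_map (beta c) b.
Hypothesis b'_def : induces_map (beta (dual_couplings c)) b'.
Hypothesis DeltaP : duality Delta.
Local Notation uA := (plaq_bond_op FA).
Local Notation uB := (site_bond_op FA).
Local Notation c' := (dual_couplings c).

Lemma dual_couplings_real : real_couplings c'.
Proof.
by move=> f m f_c; apply: c_real; case: f_c => ->;
  [constructor 4|constructor 3|constructor 2|constructor 1].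
Qed.

Let DeltaM u v : Delta (u * v) = Delta u * Delta v.
Proof. by case: DeltaP => [[[_ + _] _] _ _]; apply. Qed.

Let Delta_lin k u v : Delta (k *: u + v) = k *: Delta u + Delta v.
Proof. by case: DeltaP => [[[+ _ _] _] _ _]; apply. Qed.

Let Delta0 : Delta 0 = 0.
Proof. by have := Delta_lin (-1) 0 0; rewrite scaler0 addr0 scaleN1r addNr. Qed.

Let Delta1 : Delta 1 = 1.
Proof.
case: DeltaP => [[[_ M [D' _ DK]] _] _ _].
by rewrite -[LHS]mulr1 -{2}(DK 1) -M mul1r DK.
Qed.

Let DeltaX u n : Delta (u ^+ n) = Delta u ^+ n.
Proof. by elim: n => [|n IH]; rewrite ?expr0 ?Delta1 // !exprS DeltaM IH. Qed.

Let Delta_sum (I : Type) (s : seq I) (F : I -> B0 FA) :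
  Delta (\sum_(i <- s) F i) = \sum_(i <- s) Delta (F i).
Proof.
elim: s => [|i s IH]; first by rewrite !big_nil Delta0.
by rewrite !big_cons -[F i]scale1r Delta_lin IH !scale1r.
Qed.

Let Delta_prod (I : Type) (s : seq I) (F : I -> B0 FA) :
  Delta (\prod_(i <- s) F i) = \prod_(i <- s) Delta (F i).
Proof.
elim: s => [|i s IH]; first by rewrite !big_nil Delta1.
by rewrite !big_cons DeltaM IH.
Qed.

Lemma Delta_unit_exp (f : 'I_N -> R) t (x y : FA) : algA0 x -> algA0 y ->
  Delta (cls x) = cls y -> Delta (cls (unit_exp f t x)) = cls (unit_exp f t y).
Proof.
move=> xA yA xy; rewrite /unit_exp !cls_sum;
  try by move=> n; apply/algA0Z/algA0X.
rewrite Delta_sum; apply: eq_bigr => n _; rewrite !clsZ; try exact: algA0X.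
by rewrite -[_ *: _]addr0 Delta_lin Delta0 addr0 !clsX // DeltaX xy.
Qed.

(** From terms of A to terms of B. The shift by (1/2, 1/2) moves the centre of a plaquette to its
    upper right corner. *)
Definition dual_plaq_bond (i : cell) : cell :=
  match i with
  | inl p => inl (p + unit_vec false + unit_vec true)
  | inr e => inr (dual_bond (e, true)).1
  end.

(** From terms of B to terms of A. The shift moves the site x to the centre of the plaquette with
    lower left corner x, hence the same index. *)
Definition dual_site_bond (i : cell) : cell :=
  match i with
  | inl x => inl x
  | inr e => inr (dual_bond (e, true)).1
  end.

Lemma dual_bond_inj : injective (fun e => (dual_bond (e, true)).1).
Proof.
by move=> [x [|]] [y [|]] // /[dup] /(congr1 fst) /addIr -> /(congr1 snd).
Qed.

Lemma dual_plaq_bond_inj : injective dual_plaq_bond.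
Proof.
move=> [p|e] [p'|e'] //; first by move=> e; rewrite (addIr _ (addIr _ (inl_inj e))).
by move=> e2; rewrite (dual_bond_inj (inr_inj e2)).
Qed.

Lemma dual_site_bond_inj : injective dual_site_bond.
Proof. by move=> [x|e] [x'|e'] // h; rewrite (dual_bond_inj (inr_inj h)). Qed.

Lemma dual_bond_surj e : exists e', (dual_bond (e', true)).1 = e.
Proof.
case: e => x [|]; first by exists (x - unit_vec false, false); rewrite /= subrK.
by exists (x - unit_vec true, true); rewrite /= subrK.
Qed.

Lemma dual_plaq_bond_surj j : exists i, dual_plaq_bond i = j.
Proof.
case: j => [x|e]; last by have [e' <-] := dual_bond_surj e; exists (inr e').
by exists (inl (x - unit_vec true - unit_vec false)); rewrite /= !subrK.
Qed.

Lemma dual_site_bond_surj j : exists i, dual_site_bond i = j.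
Proof.
case: j => [x|e]; first by exists (inl x).
by have [e' <-] := dual_bond_surj e; exists (inr e').
Qed.

Lemma cls_gauge_bond e : cls (gauge_bond FA e) = U3 FA e.
Proof. by []. Qed.

(** Duality matches the lists [boundary] and [bonds_from] only up to a cyclic shift by one. *)
Lemma comm_rotate (S : pzRingType) (x1 x2 x3 x4 : S) :
  GRing.comm x1 x2 -> GRing.comm x1 x3 -> GRing.comm x1 x4 ->
  x1 * (x2 * (x3 * x4)) = x2 * (x3 * (x4 * x1)).
Proof. by move=> c2 c3 c4; rewrite mulrA c2 -mulrA (mulrA x1) c3 -mulrA c4. Qed.

Lemma U1_comm e e' : GRing.comm (U1 FA e) (U1 FA e').
Proof.
rewrite /GRing.comm /U1 -(clsM (algA0_P_G FA e) (algA0_P_G FA e')).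
rewrite -(clsM (algA0_P_G FA e') (algA0_P_G FA e)); congr cls.
rewrite -/(GRing.comm _ _) {1}/P_G; apply/commr_sym.
case: e.2; last apply: comm_unitary_star; first 1 last.
- exact: P_unitary.
- exact/commr_sym/P_P_G_comm.
- exact/commr_sym/P_P_G_comm.
Qed.

Lemma U3_comm e e' : GRing.comm (U3 FA e) (U3 FA e').
Proof.
rewrite /GRing.comm -!cls_gauge_bond.
rewrite -(clsM (algA0_gauge_bond FA N_gt0 e) (algA0_gauge_bond FA N_gt0 e')).
rewrite -(clsM (algA0_gauge_bond FA N_gt0 e') (algA0_gauge_bond FA N_gt0 e)).
congr cls; rewrite -/(GRing.comm _ _).
have Qc x i : (forall j, GRing.comm x (cell_mx FA j (Q_mx R N))) ->
    GRing.comm x (gauge_bond FA i).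
  move=> xQ; apply: commrM; first apply: commrM; first exact: xQ.
    by apply: comm_unitary_star; [exact: cell_Q_unitary|exact: xQ].
  apply: comm_unitary_star; last exact/comm_Q_G/xQ.
  exact: unitary_Q_G.
by apply: (Qc) => j; apply/commr_sym/(Qc) => k; exact: cell_Q_comm.
Qed.

(** The second case occurs for the bonds that [dual_bond] sends to negatively oriented ones;
    [unit_exp_starr] makes it harmless. *)
Lemma Delta_plaq_bond_op i :
  Delta (cls (uA i)) = cls (uB (dual_plaq_bond i)) \/
  Delta (cls (uA i)) = cls (star (uB (dual_plaq_bond i))).
Proof.
case: DeltaP => _ D1 D3; case: i => [p|e].
  left; rewrite -[uB _]/(P_H FA _) cls_gauss_law /= (dQ_G_gauge_bond FA).
  rewrite cls_prod; last by move=> ?; exact: algA0_gauge_bond.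
  rewrite Delta_prod /boundary /bonds_from !big_cons !big_nil !mulr1.
  rewrite !cls_gauge_bond !D3 /= addrK (addrAC p (unit_vec false)) addrK.
  by apply: comm_rotate; exact: U1_comm.
rewrite -[uA _]/(gauge_bond FA (e, true)) cls_gauge_bond D3 /U1 /P_G.
by case: (dual_bond (e, true)).2; [left|right].
Qed.

Lemma Delta_site_bond_op i :
  Delta (cls (uB i)) = cls (uA (dual_site_bond i)) \/
  Delta (cls (uB i)) = cls (star (uA (dual_site_bond i))).
Proof.
case: DeltaP => _ D1 D3; case: i => [p|e].
  left; rewrite -[uB _]/(P_H FA _) cls_gauss_law /= (dQ_G_gauge_bond FA).
  rewrite cls_prod; last by move=> ?; exact: algA0_gauge_bond.
  rewrite Delta_prod /boundary /bonds_from !big_cons !big_nil !mulr1.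
  rewrite !cls_gauge_bond !D1 /= !subrK.
  by apply/esym/comm_rotate; exact: U3_comm.
rewrite -[uB _]/(P_G FA (e, true)) -/(U1 FA (e, true)) D1 -cls_gauge_bond.
have [e' [sg eE]] : exists e' sg, dual_bond (e, true) = (e', sg).
  by case: (dual_bond _) => e' sg; exists e', sg.
rewrite /dual_site_bond eE; case: sg {eE}; last by left.
by right; rewrite -[X in star X]/(gauge_bond FA (e', true)) star_gauge_bond.
Qed.

Lemma Delta_expA t s :
  Delta (cls (expA FA c' t s)) = cls (expB FA c t (map dual_plaq_bond s)).
Proof.
rewrite /expA /expB /exp_prod !cls_prod ?big_map; first last.
- by move=> i; apply/algA0_unit_exp/algA0_plaq_bond_op.
- by move=> i; apply/algA0_unit_exp/algA0_site_bond_op.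
rewrite Delta_prod; apply: eq_bigr => i _.
have -> : site_bond_coupling c (dual_plaq_bond i) = plaq_bond_coupling c' i by case: i.
have uB0 j : algA0 (uB j) by exact: algA0_site_bond_op.
have uA0 j : algA0 (uA j) by exact: algA0_plaq_bond_op.
have [] := Delta_plaq_bond_op i; first exact: Delta_unit_exp.
move/(Delta_unit_exp (plaq_bond_coupling c' i) t (uA0 i) (algA0_star (uB0 _))) => ->.
by rewrite (unit_exp_starr N_gt0) //; [exact: P_unitary|exact: cell_PN].
Qed.

Lemma Delta_expB t s :
  Delta (cls (expB FA c' t s)) = cls (expA FA c t (map dual_site_bond s)).
Proof.
rewrite /expA /expB /exp_prod !cls_prod ?big_map; first last.
- by move=> i; apply/algA0_unit_exp/algA0_site_bond_op.
- by move=> i; apply/algA0_unit_exp/algA0_plaq_bond_op.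
rewrite Delta_prod; apply: eq_bigr => i _.
have -> : plaq_bond_coupling c (dual_site_bond i) = site_bond_coupling c' i by case: i.
have uB0 j : algA0 (uB j) by exact: algA0_site_bond_op.
have uA0 j : algA0 (uA j) by exact: algA0_plaq_bond_op.
have [] := Delta_site_bond_op i; first exact: Delta_unit_exp.
move/(Delta_unit_exp (site_bond_coupling c' i) t (uB0 i) (algA0_star (uA0 _))) => ->.
by rewrite (unit_exp_starr N_gt0) //; [exact: plaq_bond_op_unitary|exact: plaq_bond_opN].
Qed.

Lemma cls_conjA k t s (x : FA) : algA0 x ->
  cls (conjA k t s x) = cls (expA FA k t s) * cls x * cls (expA FA k (- t) s).
Proof.
move=> xA; have eA t' := algA0_expA FA k N_gt0 t' s.
by rewrite -(clsM (eA _) xA) -(clsM (algA0M (eA _) xA) (eA _)).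
Qed.

Lemma cls_conjB k t s (x : FA) : algA0 x ->
  cls (conjB k t s x) = cls (expB FA k t s) * cls x * cls (expB FA k (- t) s).
Proof.
move=> xA; have eB t' := algA0_expB FA k t' s.
by rewrite -(clsM (eB _) xA) -(clsM (algA0M (eB _) xA) (eB _)).
Qed.

Lemma Delta_conj t s s' (x y : FA) : algA0 x -> algA0 y -> Delta (cls x) = cls y ->
  Delta (cls (conjB c' t s (conjA c' t s' x))) =
  cls (conjA c t (map dual_site_bond s) (conjB c t (map dual_plaq_bond s') y)).
Proof.
move=> xA yA xy.
have mul5 (e1 e2 e3 e4 u f1 f2 f3 f4 v : B0 FA) :
    Delta e1 = f1 -> Delta e2 = f2 -> Delta u = v -> Delta e3 = f3 -> Delta e4 = f4 ->
    Delta (e1 * (e2 * u * e3) * e4) = f1 * (f2 * v * f3) * f4.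
  by move=> <- <- <- <- <-; rewrite !DeltaM.
rewrite (cls_conjB _ _ _ (algA0_conjA c' N_gt0 t s' xA)) (cls_conjA _ _ _ xA).
rewrite (cls_conjA _ _ _ (algA0_conjB c t _ yA)) (cls_conjB _ _ _ yA).
exact: mul5 (Delta_expB t s) (Delta_expA t s') xy (Delta_expA _ s') (Delta_expB _ s).
Qed.

(** Applying beta^* on the left avoids evaluating an inverse: [b] and [b'] are explicit conjugations
    on local elements. *)
Lemma Delta_beta v : map_star b (Delta (b' v)) = Delta v.
Proof.
set x := val (repr v); set y := val (repr (Delta v)).
have xA : algA0 x by exact: algA0_val.
have yA : algA0 y by exact: algA0_val.
have xy : Delta (cls x) = cls y by rewrite !cls_repr.
have [C [uC yC]] := algA0_support N_gt0 yA.
pose w := conjB c 2^-1 C y.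
have wA : algA0 w by exact: algA0_conjB.
have [D [uD wD]] := algA0_support N_gt0 wA.
have [L1 h1] := beta_eventually N_gt0 dual_couplings_real xA.
have sub (tau : cell -> cell) (s : seq cell) : (forall j, exists i, tau i = j) ->
    exists r, {subset s <= map tau r}.
  (* The default [inl 0] is never returned, as tau is surjective. *)
  move=> surj; exists [seq xget (inl 0) [set i | tau i = j] | j <- s] => j js.
  rewrite -map_comp; apply/mapP; exists j => //=.
  by case: xgetP => [i _ //|]; have [i ij] := surj j => /(_ i).
have [rC hC] := sub _ C dual_plaq_bond_surj; have [rD hD] := sub _ D dual_site_bond_surj.
have [L2 h2] := sub_boxes rC; have [L3 h3] := sub_boxes rD.
(* Large enough for beta' to be stationary at x and for the dual images of the box to cover the
   supports C and D. *)
pose L := maxn L1 (maxn L2 L3).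
have L2L : (L2 <= L)%N by rewrite !leq_max leqnn orbT.
have L3L : (L3 <= L)%N by rewrite !leq_max leqnn !orbT.
have [_ CL] := h2 L L2L; have [DL _] := h3 L L3L.
pose t := map dual_plaq_bond (box_plaq_bonds L).
pose s := map dual_site_bond (box_cells L).
have ut : uniq t.
  by rewrite map_inj_uniq ?box_plaq_bonds_uniq //; exact: dual_plaq_bond_inj.
have us : uniq s.
  by rewrite map_inj_uniq ?box_cells_uniq //; exact: dual_site_bond_inj.
have Ct : {subset C <= t}.
  by move=> j /hC /mapP[i /CL iL ->]; exact: map_f.
have Ds : {subset D <= s}.
  by move=> j /hD /mapP[i /DL iL ->]; exact: map_f.
have uAN := plaq_bond_opN FA N_gt0; have uBN := site_bond_opN FA N_gt0.
have uAU := plaq_bond_op_unitary FA N_gt0; have uBU := site_bond_op_unitary FA.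
have uAc := plaq_bond_op_comm FA N_gt0; have uBc := site_bond_op_comm FA.
pose x' := conjA c 2^-1 s w.
have x'A : algA0 x' by exact: algA0_conjA.
have -> : Delta (b' v) = cls x'.
  rewrite -{1}[v]cls_repr -/x; have [_ ->] := b'_def xA.
  rewrite (h1 L) ?leq_maxl // (Delta_conj _ _ _ xA yA xy); congr (cls (conjA _ _ _ _)).
  by apply: exp_conj_sub => // i /yC[].
rewrite /map_star -cls_star //.
have [bA ->] := b_def (algA0_star x'A); rewrite -cls_star //.
(* A second box, for beta itself, has to contain the dual image s of the first one as well as C. *)
have [M1 k1] := beta_eventually N_gt0 c_real (algA0_star x'A).
have [M2 k2] := sub_boxes s; have [M3 k3] := sub_boxes C.
pose M := maxn M1 (maxn M2 M3).
have M2M : (M2 <= M)%N by rewrite !leq_max leqnn orbT.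
have M3M : (M3 <= M)%N by rewrite !leq_max leqnn !orbT.
have [_ sM] := k2 M M2M; have [CM _] := k3 M M3M.
rewrite (k1 M) ?leq_maxl // /conjB /conjA (star_exp_conj N_gt0 _ uBU uBN uBc).
rewrite (star_exp_conj N_gt0 _ uAU uAN uAc) starK.
(* Enlarging s to the box M does not change x', and then the two conjugations are inverse to each
   other. *)
have -> : exp_conj (plaq_bond_coupling c) uA (- 2^-1) (box_plaq_bonds M) x' = w.
  rewrite /x' /conjA.
  rewrite -(@exp_conj_sub _ _ _ _ _ _ N_gt0 uAN uAc _ (box_plaq_bonds M) s) //.
  - exact: exp_conjK.
  - exact: box_plaq_bonds_uniq.
  - by move=> i si; apply: (wD _ _).1; apply: contra si; exact: Ds.
rewrite /w /conjB -(@exp_conj_sub _ _ _ _ _ _ N_gt0 uBN uBc 2^-1 (box_cells M) C) //.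
- by rewrite exp_conjK // cls_repr.
- exact: box_cells_uniq.
- by move=> i /yC[].
Qed.

End Duality.

(** * Extension of densely defined contractions *)

Lemma linear_funB (K : pzRingType) (V W : lmodType K) (f : V -> W) :
  linear f -> forall x y, f (x - y) = f x - f y.
Proof. by move=> fl x y; rewrite addrC -scaleN1r fl scaleN1r addrC. Qed.

Lemma linear_fun0 (K : pzRingType) (V W : lmodType K) (f : V -> W) :
  linear f -> f 0 = 0.
Proof. by move=> fl; have := linear_funB fl 0 0; rewrite !subrr. Qed.

Section RealNorm.
Variables (R : realType) (H : normedModType R[i]).
Implicit Types (x y : H).

(** Norms over R[i] are complex numbers; real parts bring them into real arithmetic. *)
Definition modulus (k : R[i]) : R := complex.Re `|k|.
Definition rnorm x : R := complex.Re `|x|.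

Lemma ge0_complexP (k : R[i]) : 0 <= k <-> k = (complex.Re k)%:C /\ 0 <= complex.Re k.
Proof.
case: k => a b; rewrite lecE /=; split=> [/andP[/eqP -> ->] //|].
by move=> [[<-] ->]; rewrite eqxx.
Qed.

Lemma modulusE k : `|k| = (modulus k)%:C.
Proof. by have /ge0_complexP[] := normr_ge0 k. Qed.

Lemma modulus_ge0 k : 0 <= modulus k.
Proof. by have /ge0_complexP[] := normr_ge0 k. Qed.

Lemma modulus_sqr k : k * k^*%R = ((modulus k) ^+ 2)%:C.
Proof. by rewrite -normCK modulusE rmorphXn. Qed.

Lemma modulus_eq0 k : modulus k = 0 -> k = 0.
Proof. by move=> k0; apply/eqP; rewrite -normr_eq0 modulusE k0. Qed.

Lemma rnormE x : `|x| = (rnorm x)%:C.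
Proof. by have /ge0_complexP[] := normr_ge0 x. Qed.

Lemma rnorm_ge0 x : 0 <= rnorm x.
Proof. by have /ge0_complexP[] := normr_ge0 x. Qed.

Lemma rnormD x y : rnorm (x + y) <= rnorm x + rnorm y.
Proof. by have := ler_normD x y; rewrite !rnormE -rmorphD lecR. Qed.

Lemma rnormZ k x : rnorm (k *: x) = modulus k * rnorm x.
Proof.
by have := normrZ k x; rewrite !rnormE modulusE -rmorphM => /(congr1 (@complex.Re R)).
Qed.

Lemma rnorm0 : rnorm (0 : H) = 0.
Proof. by rewrite /rnorm normr0. Qed.

Lemma rnormN x : rnorm (- x) = rnorm x.
Proof. by rewrite /rnorm normrN. Qed.

Lemma rnormB x y : rnorm (x - y) = rnorm (y - x).
Proof. by rewrite -rnormN opprB. Qed.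

Lemma rnorm_eq0 x : rnorm x = 0 -> x = 0.
Proof. by move=> x0; apply/eqP; rewrite -normr_eq0 rnormE x0. Qed.

Lemma rnorm_tri y x z : rnorm (x - z) <= rnorm (x - y) + rnorm (y - z).
Proof. by rewrite -[x - z](subrKA y); exact: rnormD. Qed.

Lemma rnorm_small x : (forall e : R, 0 < e -> rnorm x <= e) -> x = 0.
Proof.
move=> h; apply: rnorm_eq0; apply/eqP; rewrite eq_le rnorm_ge0 andbT.
apply/ler_addgt0Pr => e e0; rewrite add0r; exact: h.
Qed.

Lemma norm_lt_rnorm x (e : R) : (`|x| < e%:C) = (rnorm x < e).
Proof. by rewrite rnormE ltcR. Qed.

Definition rcvg (u : nat -> H) l := forall e : R, 0 < e ->
  exists n0, forall n, (n0 <= n)%N -> rnorm (u n - l) < e.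

Lemma gt0_complexP (e : R[i]) : 0 < e -> e = (complex.Re e)%:C /\ 0 < complex.Re e.
Proof.
move=> e0; have /ge0_complexP[e1 e2] := ltW e0; split=> //.
by move: e0; rewrite e1 -[0]/(0%:C) ltcR.
Qed.

Lemma dense_rnorm (V : Type) (i : V -> H) : dense (range i) ->
  forall x (e : R), 0 < e -> exists v, rnorm (x - i v) < e.
Proof.
move=> d x e e0; have e0' : 0 < e%:C by rewrite -[0]/(0%:C) ltcR.
have [] := d (ball x e%:C) _ (ball_open _ _).
  by exists x; exact: ballxx.
by move=> y [+ [v _ iv]]; rewrite -ball_normE -iv /= norm_lt_rnorm; exists v.
Qed.

Lemma dense_rnormP (V : Type) (i : V -> H) :
  (forall x (e : R), 0 < e -> exists v, rnorm (x - i v) < e) -> dense (range i).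
Proof.
move=> h O [x Ox] Oo; have := open_nbhs_nbhs (conj Oo Ox).
move=> /nbhs_ballP[d /gt0_complexP[dE d0] hd].
have [v hv] := h x _ d0; exists (i v); split; last by exists v.
by apply: hd; rewrite -ball_normE /= dE norm_lt_rnorm.
Qed.

End RealNorm.

Section Bounded.
Variables (R : realType) (H K : normedModType R[i]).

Lemma contraction_continuous (T : H -> K) : linear T ->
  (forall x, rnorm (T x) <= rnorm x) -> continuous T.
Proof.
move=> Tl Tc x; apply/cvgrPdist_lt => e e0.
near=> y; rewrite -(linear_funB Tl).
apply: (@le_lt_trans _ _ `|x - y|); first by rewrite !rnormE lecR.
near: y; exact: cvgr_dist_lt.
Unshelve. all: by end_near.
Qed.

Lemma continuous_linear_bounded (T : H -> K) : linear T -> continuous T ->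
  exists C : R, forall x, rnorm (T x) <= C * rnorm x.
Proof.
move=> Tl Tc.
have T0 := linear_fun0 Tl.
have TZ k x : T (k *: x) = k *: T x by rewrite -[k *: x]addr0 Tl T0 addr0.
have := Tc 0; rewrite /continuous_at T0 => /cvgr0_norm_lt/(_ 1 ltr01).
move=> /nbhs_ballP[d /gt0_complexP[dE d0] hd].
set D := complex.Re d in dE d0.
(* Rescaling x to norm D / 2 puts it in the ball on which T is bounded by 1. *)
exists (2 / D) => x; have [/rnorm_eq0 ->|x0] := eqVneq (rnorm x) 0.
  by rewrite T0 !rnorm0 mulr0.
have xp : 0 < rnorm x by rewrite lt_def x0 rnorm_ge0.
have m (r : R) : 0 <= r -> modulus r%:C = r.
  by move=> r0; rewrite /modulus ger0_norm // -[0]/(0%:C) lecR.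
have := hd ((D / 2 / rnorm x)%:C *: x).
have r0 : 0 <= D / 2 / rnorm x by rewrite !divr_ge0 // ltW.
rewrite -ball_normE /= sub0r normrN dE norm_lt_rnorm rnormZ m // mulfVK //.
have -> : D / 2 < D by lra.
move/(_ isT); rewrite TZ (_ : 1 = 1%:C :> R[i]) // norm_lt_rnorm rnormZ m // => h.
have := ltW h; rewrite -(@ler_pM2l _ (2 / D * rnorm x)); last first.
  by rewrite mulr_gt0 ?divr_gt0.
rewrite mulr1 mulrA; congr (_ <= _); rewrite -[RHS]mul1r; congr (_ * _).
by field; rewrite x0 gt_eqF.
Qed.

End Bounded.

Section DenseExtension.
Variables (R : realType) (V : lmodType R[i]).

Lemma dense_additive0 (H K : normedModType R[i]) (i : V -> H) (f : H -> K) (C : R) :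
  dense (range i) -> (forall x y, f (x - y) = f x - f y) ->
  (forall x, rnorm (f x) <= C * rnorm x) -> (forall v, f (i v) = 0) ->
  forall x, f x = 0.
Proof.
move=> d fB fC f0 x; apply: rnorm_small => e e0.
have C1 : 0 < `|C| + 1 by rewrite ltr_wpDl.
have [v hv] := dense_rnorm d x (divr_gt0 e0 C1).
rewrite -[f x]subr0 -(f0 v) -fB; apply: le_trans (fC _) _.
apply: (@le_trans _ _ ((`|C| + 1) * rnorm (x - i v))).
  by rewrite ler_wpM2r ?rnorm_ge0 // (le_trans (ler_norm C)) // lerDl.
by rewrite mulrC -ler_pdivlMr // ltW.
Qed.

Lemma dense_eq_bounded (H K : normedModType R[i]) (i : V -> H) (T S : H -> K) :
  dense (range i) -> linear T -> continuous T -> linear S -> continuous S ->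
  (forall v, T (i v) = S (i v)) -> T = S.
Proof.
move=> d Tl Tc Sl Sc TS; apply/funext => x; apply/eqP; rewrite -subr_eq0; apply/eqP.
have [C hC] := continuous_linear_bounded Tl Tc.
have [D hD] := continuous_linear_bounded Sl Sc.
apply: (@dense_additive0 H K i (fun x => T x - S x) (C + D)) => //.
- by move=> a b; rewrite (linear_funB Tl) (linear_funB Sl) !opprD !opprK addrACA.
- move=> a; apply: le_trans (rnormD _ _) _; rewrite rnormN mulrDl.
  exact: lerD.
- by move=> v; rewrite TS subrr.
Qed.

Lemma complete_rcvg (K : completeNormedModType R[i]) (u : nat -> K) :
  (forall e : R, 0 < e -> exists n0, forall n m, (n0 <= n)%N -> (n0 <= m)%N ->
     rnorm (u n - u m) < e) -> exists l, rcvg u l.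
Proof.
move=> uc; have : cvg (u @ \oo).
  apply: cauchy_cvg; apply: cauchy_exP => e /gt0_complexP[eE e0].
  have [n0 h0] := uc _ e0; exists (u n0); exists n0 => // n /= hn.
  by rewrite -ball_normE /= eE norm_lt_rnorm; exact: h0.
move=> /cvgrPdist_lt ul; exists (lim (u @ \oo)) => e e0.
have e0' : 0 < e%:C by rewrite -[0]/(0%:C) ltcR.
have [n0 _ hn] := ul _ e0'; exists n0 => n /hn /=.
by rewrite norm_lt_rnorm rnormB.
Qed.

Variables (H : normedModType R[i]) (K : completeNormedModType R[i]).
Variables (i : V -> H) (j : V -> K).
Hypotheses (i_lin : linear i) (j_lin : linear j).
Hypothesis i_dense : dense (range i).
Hypothesis ij : forall v, rnorm (j v) <= rnorm (i v).

(** Describes the value l of the extension at x without limits, so that existence, uniqueness and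
    linearity can be treated separately. *)
Let is_ext x (l : K) := forall v, rnorm (l - j v) <= rnorm (x - i v).

Let is_ext_approx x l :
  (forall e : R, 0 < e -> exists w, rnorm (x - i w) <= e /\ rnorm (l - j w) <= e) ->
  is_ext x l.
Proof.
move=> h v; apply/ler_addgt0Pr => e e0.
have e2 : 0 < e / 2 by rewrite divr_gt0.
have [w [w1 w2]] := h _ e2.
apply: le_trans (rnorm_tri (j w) _ _) _; rewrite -(linear_funB j_lin).
have := ij (w - v); rewrite (linear_funB i_lin) => ijwv.
have := rnorm_tri x (i w) (i v); rewrite (rnormB (i w) x); move: ijwv w1 w2; lra.
Qed.

Let is_ext_unique x l l' : is_ext x l -> is_ext x l' -> l = l'.
Proof.
move=> h h'; apply/eqP; rewrite -subr_eq0; apply/eqP/rnorm_small => e e0.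
have e2 : 0 < e / 2 by rewrite divr_gt0.
have [w hw] := dense_rnorm i_dense x e2.
have := rnorm_tri (j w) l l'; rewrite (rnormB (j w)).
by have := h w; have := h' w; move: hw; lra.
Qed.

Let is_ext_exists x : exists l, is_ext x l.
Proof.
have /choice[w hw] : forall n : nat, exists v, rnorm (x - i v) < n.+1%:R^-1.
  by move=> n; apply: dense_rnorm.
have small (e : R) : 0 < e -> exists n0, forall n, (n0 <= n)%N -> rnorm (x - i (w n)) < e.
  move=> e0; exists (Num.truncn e^-1) => n hn; apply: lt_trans (hw n) _.
  rewrite invf_plt ?posrE //; apply: lt_le_trans (truncnS_gt _) _.
  by rewrite ler_nat.
have [|l hl] := @complete_rcvg K (j \o w).
  move=> e e0; have e2 : 0 < e / 2 by rewrite divr_gt0.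
  have [n0 h0] := small _ e2; exists n0 => n m /h0 hn /h0 hm.
  rewrite /= -(linear_funB j_lin); apply: le_lt_trans (ij _) _.
  rewrite (linear_funB i_lin).
  have := rnorm_tri x (i (w n)) (i (w m)); rewrite (rnormB (i (w n)) x).
  by move: hn hm; lra.
exists l; apply: is_ext_approx => e e0.
have [n0 h0] := small _ e0; have [n1 h1] := hl _ e0.
exists (w (maxn n0 n1)); split; first by rewrite ltW // h0 // leq_maxl.
by rewrite rnormB ltW // h1 // leq_maxr.
Qed.

Lemma dense_extension : exists F : H -> K,
  [/\ linear F, continuous F, forall x, rnorm (F x) <= rnorm x &
      forall v, F (i v) = j v].
Proof.
have [F hF] := choice is_ext_exists; exists F.
have Fl : linear F.
  move=> k x y; apply: (@is_ext_unique (k *: x + y)) => //.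
  apply: is_ext_approx => e e0.
  have k0 := modulus_ge0 k.
  (* This d satisfies |k| d + d = e, the error of a combination k *: a + b. *)
  have d0 : 0 < e / (modulus k + 1) by rewrite divr_gt0 // ltr_wpDl.
  have [v hv] := dense_rnorm i_dense x d0; have [w hw] := dense_rnorm i_dense y d0.
  have E : modulus k * (e / (modulus k + 1)) + e / (modulus k + 1) = e.
    by field; rewrite gt_eqF // ltr_wpDl.
  have linBD (W : normedModType R[i]) (a b a' b' : W) :
      k *: a + b - (k *: a' + b') = k *: (a - a') + (b - b').
    by rewrite scalerBr opprD addrACA.
  have bound (W : normedModType R[i]) (a b : W) :
      rnorm a <= e / (modulus k + 1) -> rnorm b <= e / (modulus k + 1) ->
      rnorm (k *: a + b) <= e.
    move=> ha hb; apply: le_trans (rnormD _ _) _; rewrite rnormZ -[leRHS]E.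
    by apply: lerD hb; rewrite ler_wpM2l.
  exists (k *: v + w); split.
    by rewrite i_lin linBD; apply: bound; exact: ltW.
  rewrite j_lin linBD; apply: bound; apply: le_trans (ltW _);
    [exact: hF|exact: hv|exact: hF|exact: hw].
have F1 x : rnorm (F x) <= rnorm x.
  have j0 : j 0 = 0 by rewrite -(subrr 0) (linear_funB j_lin) subrr.
  have i0 : i 0 = 0 by rewrite -(subrr 0) (linear_funB i_lin) subrr.
  by have := hF x 0; rewrite j0 i0 !subr0.
split=> //; first exact: contraction_continuous.
move=> v; apply: (@is_ext_unique (i v)) => //.
by move=> w; rewrite -(linear_funB j_lin) -(linear_funB i_lin).
Qed.

End DenseExtension.

(** * Square roots of positive contractions *)

Section CauchySchwarz.
Variables (R : realType) (V : lmodType R[i]) (B : V -> V -> R[i]).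
Hypothesis Bl : forall k x y z, B (k *: x + y) z = k^*%R * B x z + B y z.
Hypothesis Br : forall k x y z, B x (k *: y + z) = k * B x y + B x z.
Hypothesis B_ge0 : forall x, 0 <= B x x.

Let B_real x : complex.Im (B x x) = 0.
Proof. by have /ge0_complexP[-> _] := B_ge0 x. Qed.

(* Polarisation: B (x + y) (x + y) and B ('i x + y) ('i x + y) are real. *)
Lemma psd_hermitian x y : B y x = (B x y)^*%R.
Proof.
have := B_real (1 *: x + y); have := B_real ('i *: x + y).
have := B_real x; have := B_real y.
rewrite !Bl !Br rmorph1.
case: (B x x) => a1 a2; case: (B y y) => b1 b2; case: (B x y) => c1 c2.
case: (B y x) => d1 d2 /= -> -> h1 h2.
apply/eqP; rewrite eq_complex /=; apply/andP; split; apply/eqP; move: h1 h2; lra.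
Qed.

Lemma psd_CauchySchwarz x y :
  (modulus (B x y)) ^+ 2 <= complex.Re (B x x) * complex.Re (B y y).
Proof.
set b := modulus _ ^+ 2; set a := complex.Re _; set c := complex.Re _.
have bE : B x y * (B x y)^*%R = b%:C by exact: modulus_sqr.
have [aE a0] : B x x = a%:C /\ 0 <= a by apply/ge0_complexP.
have [cE c0] : B y y = c%:C /\ 0 <= c by apply/ge0_complexP.
have b0 : 0 <= b by exact: sqr_ge0.
(* The value of the form at x minus s times the conjugate of B x y times y, for real s. *)
have q (s : R) : 0 <= s ^+ 2 * b * c - 2 * s * b + a.
  have kc : (- (s%:C * (B x y)^*%R))^*%R = - (s%:C * B x y).
    by rewrite -!mulNr -rmorphN conj_realM conjCK.
  have := B_ge0 ((- (s%:C * (B x y)^*%R)) *: y + x).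
  rewrite Bl !Br (psd_hermitian x y) kc aE cE.
  set z := B x y in bE *; set z' := z^*%R in bE *.
  have -> : - (s%:C * z) * (- (s%:C * z') * c%:C + z') + (- (s%:C * z') * z + a%:C) =
            (s ^+ 2 * b * c - 2 * s * b + a)%:C.
    move: bE; rewrite {}/z' {}/z; case: (B x y) => z1 z2 /(congr1 (@complex.Re R)) /= <-.
    by apply/eqP; rewrite eq_complex /=; apply/andP; split; apply/eqP; ring.
  by rewrite -[0]/(0%:C) lecR.
have [c1|c1] := eqVneq c 0.
  have [b1|b1] := eqVneq b 0; first by rewrite b1 mulr_ge0.
  (* The form may be degenerate: with c = 0 the polynomial is affine in s and would take the value
     -1 here. *)
  have := q ((a + 1) / b / 2); rewrite c1 mulr0 add0r.
  have -> : 2 * ((a + 1) / b / 2) * b = a + 1 by field.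
  by lra.
have cp : 0 < c by rewrite lt_def c1.
(* The minimum of the parabola when b is positive. *)
have := q c^-1; have -> : c^-1 ^+ 2 * b * c - 2 * c^-1 * b + a = (a * c - b) / c by field.
by rewrite pmulr_lge0 ?invr_gt0 // subr_ge0.
Qed.

End CauchySchwarz.

Section HilbertSpace.
Variables (R : realType) (H : hilbertType R).
Implicit Types (x y : H).

Lemma ip_linl (k : R[i]) x y z : ip (k *: x + y) z = k^*%R * ip x z + ip y z.
Proof. by rewrite ip_conj ip_lin [ip x z]ip_conj [ip y z]ip_conj rmorphD rmorphM. Qed.

Lemma ipE x : ip x x = (rnorm x ^+ 2)%:C.
Proof. by rewrite ip_norm rnormE rmorphXn. Qed.

Lemma ip_CauchySchwarz x y : modulus (ip x y) <= rnorm x * rnorm y.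
Proof.
have pos (z : H) : 0 <= ip z z.
  by rewrite ipE -[0]/(0%:C) lecR sqr_ge0.
rewrite -(@ler_pXn2r _ 2) ?nnegrE ?modulus_ge0 ?mulr_ge0 ?rnorm_ge0 //.
have : modulus (ip x y) ^+ 2 <= complex.Re (ip x x) * complex.Re (ip y y).
  by apply: psd_CauchySchwarz => // k u v w; [exact: ip_linl|exact: ip_lin].
by rewrite !ipE /= exprMn.
Qed.

Lemma ipDr x y z : ip x (y + z) = ip x y + ip x z.
Proof. by rewrite -[y]scale1r ip_lin mul1r scale1r. Qed.

Lemma ip0r x : ip x 0 = 0.
Proof. by apply: (addIr (ip x 0)); rewrite -ipDr !add0r. Qed.

Lemma ipZr (k : R[i]) x y : ip x (k *: y) = k * ip x y.
Proof. by rewrite -[k *: y]addr0 ip_lin ip0r addr0. Qed.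

Lemma ipBr x y z : ip x (y - z) = ip x y - ip x z.
Proof. by rewrite ipDr -scaleN1r ipZr mulN1r. Qed.

Lemma ipDl x y z : ip (x + y) z = ip x z + ip y z.
Proof. by rewrite ip_conj ipDr [ip x z]ip_conj [ip y z]ip_conj rmorphD. Qed.

Lemma ipBl x y z : ip (x - y) z = ip x z - ip y z.
Proof. by rewrite ip_conj ipBr [ip x z]ip_conj [ip y z]ip_conj rmorphB. Qed.

Lemma ipZl (k : R[i]) x y : ip (k *: x) y = k^*%R * ip x y.
Proof. by rewrite ip_conj ipZr [ip x y]ip_conj rmorphM. Qed.

End HilbertSpace.

Section SquareRoot.
Variables (R : realType) (H : hilbertType R) (X : H -> H).
Hypothesis X_lin : linear X.
Hypothesis X_sym : forall x y, ip x (X y) = ip (X x) y.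
Hypothesis X_contr : forall x, rnorm (X x) <= rnorm x.

(* Y = (X + Y^2) / 2 is solved by iteration from 0; then 1 - Y is a square root
   of 1 - X.  The iterates are polynomials in X with nonnegative coefficients, so
   the scalar iteration with X = 1 dominates all differences. *)
Fixpoint sqrt_iter (n : nat) (x : H) : H :=
  if n is n'.+1 then 2^-1 *: (X x + sqrt_iter n' (sqrt_iter n' x)) else 0.

Fixpoint sqrt_bound (n : nat) : R :=
  if n is n'.+1 then 2^-1 * (1 + sqrt_bound n' ^+ 2) else 0.

Local Notation Y := sqrt_iter.
Local Notation y := sqrt_bound.

Let linD (T : H -> H) : linear T -> forall a b, T (a + b) = T a + T b.
Proof. by move=> Tl a b; rewrite -[a]scale1r Tl !scale1r. Qed.

Let linZ (T : H -> H) : linear T -> forall k a, T (k *: a) = k *: T a.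
Proof. by move=> Tl k a; rewrite -[k *: a]addr0 Tl (linear_fun0 Tl) addr0. Qed.

Lemma sqrt_iter_lin n : linear (Y n).
Proof.
elim: n => [|n IH] k a b /=; first by rewrite scaler0 addr0.
rewrite X_lin !IH scalerDr scalerDr [k *: (2^-1 *: _)]scalerA [k * _]mulrC -scalerA.
by rewrite -!scalerDr; congr (_ *: _); rewrite scalerDr addrACA.
Qed.

Lemma sqrt_iter_sym n a b : ip a (Y n b) = ip (Y n a) b.
Proof.
elim: n a b => [|n IH] a b /=; first by rewrite ip0r ip_conj ip0r rmorph0.
by rewrite ipZr ipDr X_sym !IH -ipDl ipZl fmorphV rmorph_nat.
Qed.

Lemma sqrt_iter_commX n a : X (Y n a) = Y n (X a).
Proof.
elim: n a => [|n IH] a /=; first exact: linear_fun0.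
by rewrite (linZ X_lin) (linD X_lin) !IH.
Qed.

Lemma sqrt_iter_comm n m a : Y n (Y m a) = Y m (Y n a).
Proof.
elim: n a => [|n IH] a /=; first by rewrite (linear_fun0 (sqrt_iter_lin m)).
rewrite (linZ (sqrt_iter_lin m)) (linD (sqrt_iter_lin m)) sqrt_iter_commX.
by rewrite !IH.
Qed.

Lemma sqrt_bound_ge0 n : 0 <= y n.
Proof. by case: n => //= n; rewrite mulr_ge0 ?addr_ge0 ?sqr_ge0. Qed.

Lemma sqrt_bound_le1 n : y n <= 1.
Proof.
elim: n => //= n IH; have := sqrt_bound_ge0 n; nra.
Qed.

Let modulus_half : modulus (2^-1 : R[i]) = 2^-1 :> R.
Proof.
rewrite /modulus ger0_norm ?invr_ge0 ?ler0n //.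
have -> : 2^-1 = (2^-1)%:C :> R[i] by rewrite fmorphV rmorph_nat.
by [].
Qed.

Lemma sqrt_iter_bound n a : rnorm (Y n a) <= y n * rnorm a.
Proof.
elim: n a => [|n IH] a /=; first by rewrite rnorm0 mul0r.
rewrite rnormZ modulus_half -mulrA ler_pM2l ?invr_gt0 // mulrDl mul1r.
apply: le_trans (rnormD _ _) _; apply: lerD; first exact: X_contr.
apply: le_trans (IH _) _; rewrite expr2 -mulrA ler_wpM2l ?IH //.
exact: sqrt_bound_ge0.
Qed.

(** The iterates commute, so the difference of their squares factors exactly as for the scalar
    sequence. *)
Lemma sqrt_iter_step n a : rnorm (Y n.+1 a - Y n a) <= (y n.+1 - y n) * rnorm a.
Proof.
elim: n a => [|n IH] a.
  rewrite subr0 subr0; exact: (sqrt_iter_bound 1).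
have -> : Y n.+2 a - Y n.+1 a =
    2^-1 *: (Y n.+1 (Y n.+1 a - Y n a) + Y n (Y n.+1 a - Y n a)).
  rewrite (linear_funB (sqrt_iter_lin n.+1)) (linear_funB (sqrt_iter_lin n)).
  rewrite [Y n.+1 (Y n a)]sqrt_iter_comm addrA subrK.
  transitivity (2^-1 *: (X a + Y n.+1 (Y n.+1 a)) - 2^-1 *: (X a + Y n (Y n a))) => //.
  by rewrite -scalerBr opprD addrACA subrr add0r.
rewrite rnormZ modulus_half.
have -> : y n.+2 - y n.+1 = 2^-1 * ((y n.+1 + y n) * (y n.+1 - y n)).
  transitivity (2^-1 * (1 + y n.+1 ^+ 2) - 2^-1 * (1 + y n ^+ 2)) => //.
  ring.
rewrite -mulrA ler_pM2l ?invr_gt0 // -mulrA mulrDl.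
apply: le_trans (rnormD _ _) _; apply: lerD;
  apply: le_trans (sqrt_iter_bound _ _) _; apply: ler_wpM2l => //;
  exact: sqrt_bound_ge0.
Qed.

Lemma sqrt_bound_step n : y n <= y n.+1.
Proof. by have := sqrt_bound_le1 n; have := sqrt_bound_ge0 n; rewrite /=; nra. Qed.

Lemma sqrt_bound_mono n m : (n <= m)%N -> y n <= y m.
Proof.
by move=> /subnK <-; elim: (m - n)%N => // k IH; apply: le_trans IH (sqrt_bound_step _).
Qed.

Lemma sqrt_iter_diff n m a : (n <= m)%N ->
  rnorm (Y m a - Y n a) <= (y m - y n) * rnorm a.
Proof.
move=> /subnK <-; elim: (m - n)%N => [|k IH].
  by rewrite add0n !subrr rnorm0 mul0r.
apply: le_trans (rnorm_tri (Y (k + n) a) _ _) _.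
rewrite -[y (k.+1 + n)%N](subrK (y (k + n)%N)) -addrA mulrDl.
by apply: lerD => //; exact: sqrt_iter_step.
Qed.

Lemma sqrt_bound_lim : exists L : R, (forall n, y n <= L) /\
  forall e : R, 0 < e -> exists n, L - y n < e.
Proof.
have yub : has_ubound (range y) by exists 1 => _ [n _ <-]; exact: sqrt_bound_le1.
have ysup : has_sup (range y) by split=> //; exists (y 0%N), 0%N.
exists (sup (range y)); split=> [n|e e0].
  by apply: ub_le_sup => //; exists n.
have [_ [n _ <-] h] := sup_adherent e0 ysup.
by exists n; move: h; lra.
Qed.

Lemma operator_sqrt : exists S : H -> H, [/\ linear S,
  (exists C : R, forall x, rnorm (S x) <= C * rnorm x),
  (forall a b, ip a (S b) = ip (S a) b),
  (forall a, S (S a) = a - X a) & (forall a, S (X a) = X (S a))].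
Proof.
have [L [yL Llim]] := sqrt_bound_lim.
have /choice[Z hZ] : forall a, exists l, forall n,
    rnorm (l - Y n a) <= (L - y n) * rnorm a.
  move=> a; have a1 : 0 < rnorm a + 1 by rewrite ltr_wpDl ?rnorm_ge0.
  have [e e0|l hl] := @complete_rcvg R H (Y ^~ a).
    have [n0 hn0] := Llim _ (divr_gt0 e0 a1).
    suff h n m : (n0 <= n)%N -> (n <= m)%N -> rnorm (Y n a - Y m a) < e.
      exists n0 => n m hn hm; have [nm|/ltnW mn] := leqP n m; first exact: h.
      by rewrite rnormB; exact: h.
    move=> hn nm; rewrite rnormB; apply: le_lt_trans (sqrt_iter_diff _ nm) _.
    have : y m - y n < e / (rnorm a + 1).
      by have := yL m; have := sqrt_bound_mono hn; move: hn0; lra.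
    rewrite ltr_pdivlMr // => /le_lt_trans; apply.
    by rewrite ler_wpM2l ?subr_ge0 ?sqrt_bound_mono // lerDl.
  exists l => n; apply/ler_addgt0Pr => e e0; have [n1 h1] := hl _ e0.
  pose m := maxn n n1; apply: le_trans (rnorm_tri (Y m a) _ _) _.
  rewrite addrC lerD //; last by rewrite rnormB ltW // h1 // leq_maxr.
  apply: le_trans (sqrt_iter_diff _ (leq_maxl n n1)) _.
  by rewrite ler_wpM2r ?rnorm_ge0 // lerB.
(* The vector identities for the limit Z are proved this way: the difference of the two sides is
   bounded by a multiple of L - y n for every n. *)
have small (v : H) C : 0 <= C -> (forall n, rnorm v <= (L - y n) * C) -> v = 0.
  move=> C0 h; apply: rnorm_small => e e0.
  have C1 : 0 < C + 1 by rewrite ltr_wpDl.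
  have [n hn] := Llim _ (divr_gt0 e0 C1).
  apply: le_trans (h n) _; move: hn; rewrite ltr_pdivlMr // => /ltW; apply: le_trans.
  by rewrite ler_wpM2l ?subr_ge0 // lerDl.
have d0 n : 0 <= L - y n by rewrite subr_ge0.
have Zl : linear Z.
  move=> k a b; apply/eqP; rewrite -subr_eq0; apply/eqP.
  have C0 : 0 <= rnorm (k *: a + b) + (modulus k * rnorm a + rnorm b).
    by rewrite !addr_ge0 ?mulr_ge0 ?rnorm_ge0 ?modulus_ge0.
  apply: (small _ _ C0) => n.
  apply: le_trans (rnorm_tri (Y n (k *: a + b)) _ _) _.
  rewrite mulrDr; apply: lerD; first exact: hZ.
  rewrite sqrt_iter_lin rnormB.
  have -> : k *: Z a + Z b - (k *: Y n a + Y n b) = k *: (Z a - Y n a) + (Z b - Y n b).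
    by rewrite scalerBr opprD addrACA.
  apply: le_trans (rnormD _ _) _; rewrite mulrDr; apply: lerD; last exact: hZ.
  by rewrite rnormZ mulrCA ler_wpM2l ?modulus_ge0.
have ZX a : Z (X a) = X (Z a).
  apply/eqP; rewrite -subr_eq0; apply/eqP.
  have C0 : 0 <= rnorm (X a) + rnorm a by rewrite addr_ge0 ?rnorm_ge0.
  apply: (small _ _ C0) => n.
  apply: le_trans (rnorm_tri (Y n (X a)) _ _) _; rewrite mulrDr; apply: lerD.
    exact: hZ.
  rewrite -sqrt_iter_commX rnormB -(linear_funB X_lin); apply: le_trans (X_contr _) _.
  exact: hZ.
have ZZ a : Z a = 2^-1 *: (X a + Z (Z a)).
  apply/eqP; rewrite -subr_eq0; apply/eqP.
  have C0 : 0 <= rnorm a + (rnorm (Z a) + rnorm a) by rewrite !addr_ge0 ?rnorm_ge0.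
  apply: (small _ _ C0) => n.
  apply: le_trans (rnorm_tri (Y n.+1 a) _ _) _; rewrite mulrDr; apply: lerD.
    apply: le_trans (hZ _ _) _; rewrite ler_wpM2r ?rnorm_ge0 // lerB //.
    exact: sqrt_bound_step.
  rewrite [Y n.+1 a]/= -scalerBr opprD addrACA subrr add0r rnormZ modulus_half rnormB.
  apply: (@le_trans _ _ (rnorm (Z (Z a) - Y n (Y n a)))).
    by rewrite ler_piMl ?rnorm_ge0 // invf_le1 // ler1n.
  apply: le_trans (rnorm_tri (Y n (Z a)) _ _) _; rewrite mulrDr; apply: lerD.
    exact: hZ.
  rewrite -(linear_funB (sqrt_iter_lin n)); apply: le_trans (sqrt_iter_bound _ _) _.
  apply: (@le_trans _ _ (rnorm (Z a - Y n a))); last exact: hZ.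
  by rewrite ler_piMl ?rnorm_ge0 // sqrt_bound_le1.
have Zs a b : ip a (Z b) = ip (Z a) b.
  apply/eqP; rewrite -subr_eq0; apply/eqP/modulus_eq0/eqP.
  rewrite eq_le modulus_ge0 andbT; apply/ler_addgt0Pr => e e0; rewrite add0r.
  have C1 : 0 < 2 * (rnorm a * rnorm b) + 1.
    by rewrite ltr_wpDl // !mulr_ge0 ?rnorm_ge0.
  have [n hn] := Llim _ (divr_gt0 e0 C1).
  have -> : ip a (Z b) - ip (Z a) b = ip a (Z b - Y n b) - ip (Z a - Y n a) b.
    by rewrite ipBr ipBl sqrt_iter_sym; ring.
  have : modulus (ip a (Z b - Y n b) - ip (Z a - Y n a) b) <=
         modulus (ip a (Z b - Y n b)) + modulus (ip (Z a - Y n a) b).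
    by have := ler_normB (ip a (Z b - Y n b)) (ip (Z a - Y n a) b);
      rewrite !modulusE -rmorphD lecR.
  move/le_trans; apply.
  apply: (@le_trans _ _ ((L - y n) * (2 * (rnorm a * rnorm b)))); last first.
    move: hn; rewrite ltr_pdivlMr // => /ltW; apply: le_trans.
    by rewrite ler_wpM2l // lerDl.
  have -> : (L - y n) * (2 * (rnorm a * rnorm b)) =
     rnorm a * ((L - y n) * rnorm b) + (L - y n) * rnorm a * rnorm b by ring.
  apply: lerD; apply: le_trans (ip_CauchySchwarz _ _) _.
    by rewrite ler_wpM2l ?rnorm_ge0.
  by rewrite ler_wpM2r ?rnorm_ge0.
exists (fun a => a - Z a); split.
- by move=> k a b; rewrite Zl scalerBr opprD addrACA.
- exists (1 + L) => a; apply: le_trans (rnormD _ _) _.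
  rewrite rnormN mulrDl mul1r lerD2l.
  by have := hZ a 0%N; rewrite /= !subr0.
- by move=> a b; rewrite ipBr ipBl Zs.
- move=> a; rewrite (linear_funB Zl).
  (* The fixed point equation 2 Z = X + Z^2, solved for X, so that (1 - Z)^2 = 1 - X. *)
  have -> : X a = Z a + Z a - Z (Z a).
    apply/eqP; rewrite eq_sym subr_eq; apply/eqP.
    by rewrite -mulr2n -scaler_nat {1}[Z a]ZZ scalerA mulfV ?scale1r // pnatr_eq0.
  by rewrite !opprD !opprK !addrA.
- by move=> a; rewrite (linear_funB X_lin) ZX.
Qed.

End SquareRoot.

(** * Transfer matrices *)

Section Transfer.
Variables (R : realType) (V : lmodType R[i]).

(** The defect is additive and bounded in each variable; density is used in one variable at a
    time. *)
Lemma dense_symmetric (H : hilbertType R) (i : V -> H) (X : H -> H) :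
  dense (range i) -> linear X -> (forall x, rnorm (X x) <= rnorm x) ->
  (forall u v, ip (i u) (X (i v)) = ip (X (i u)) (i v)) ->
  forall x y, ip x (X y) = ip (X x) y.
Proof.
move=> d Xl X1 e x y.
have XB := linear_funB Xl.
have step (f : H -> R[i]) (E : R) : (forall a b, f (a - b) = f a - f b) ->
    (forall a, modulus (f a) <= E * rnorm a) -> (forall v, f (i v) = 0) ->
    forall a, f a = 0.
  exact: (@dense_additive0 R V H R[i]^o i).
have bound (a b c d' : H) : modulus (ip a b - ip c d') <=
    rnorm a * rnorm b + rnorm c * rnorm d'.
  have := ler_normB (ip a b) (ip c d'); rewrite !modulusE -rmorphD lecR.
  by move/le_trans; apply; apply: lerD; exact: ip_CauchySchwarz.
have b2 a b : modulus (ip a (X b) - ip (X a) b) <= (rnorm a * rnorm b) *+ 2.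
  apply: le_trans (bound _ _ _ _) _; rewrite mulr2n.
  by apply: lerD; [rewrite ler_wpM2l ?rnorm_ge0|rewrite ler_wpM2r ?rnorm_ge0].
apply/eqP; rewrite -subr_eq0; apply/eqP.
apply: (step (fun a => ip a (X y) - ip (X a) y) (rnorm y *+ 2)) => [a b|a|u].
- by rewrite XB !ipBl !opprD !opprK addrACA.
- by rewrite mulrnAl mulrC; exact: b2.
apply: (step (fun b => ip (i u) (X b) - ip (X (i u)) b) (rnorm (i u) *+ 2)) => [a b|a|v].
- by rewrite XB !ipBr !opprD !opprK addrACA.
- by rewrite mulrnAl; exact: b2.
by rewrite e subrr.
Qed.

Lemma isometry_unitary (H K : hilbertType R) (i : V -> H) (j : V -> K) :
  linear i -> linear j -> dense (range i) -> dense (range j) ->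
  (forall u v, ip (i u) (i v) = ip (j u) (j v)) ->
  exists F : H -> K, exists G : K -> H,
    [/\ linear F /\ continuous F, linear G /\ continuous G,
        cancel F G /\ cancel G F, (forall x y, ip (F x) (F y) = ip x y) &
        (forall v, F (i v) = j v) /\ (forall v, G (j v) = i v)].
Proof.
move=> il jl i_dense j_dense e.
have ij v : rnorm (i v) = rnorm (j v).
  have := e v v; rewrite !ipE => /(congr1 (@complex.Re R)) /= /eqP.
  by rewrite eqrXn2 ?rnorm_ge0 // => /eqP.
have [F [Fl Fc F1 Fi]] : exists F : H -> K,
  [/\ linear F, continuous F, forall x, rnorm (F x) <= rnorm x & forall v, F (i v) = j v].
  by apply: dense_extension => // v; rewrite ij.
have [G [Gl Gc G1 Gj]] : exists G : K -> H,
  [/\ linear G, continuous G, forall x, rnorm (G x) <= rnorm x & forall v, G (j v) = i v].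
  by apply: dense_extension => // v; rewrite ij.
have compl (A B C : hilbertType R) (S : A -> B) (T : B -> C) :
    linear S -> linear T -> linear (T \o S).
  by move=> Sl Tl k a b /=; rewrite Sl Tl.
have GF z : G (F z) = z.
  have : G \o F = id.
    apply: (dense_eq_bounded i_dense) => //; first exact: compl.
    - by move=> a; apply: continuous_comp; [exact: Fc|exact: Gc].
    - by move=> a; exact: cvg_id.
    - by move=> v /=; rewrite Fi Gj.
  by move/(congr1 (fun f => f z)).
have FG z : F (G z) = z.
  have : F \o G = id.
    apply: (dense_eq_bounded j_dense) => //; first exact: compl.
    - by move=> a; apply: continuous_comp; [exact: Gc|exact: Fc].
    - by move=> a; exact: cvg_id.
    - by move=> v /=; rewrite Gj Fi.
  by move/(congr1 (fun f => f z)).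
exists F, G; split=> // x y.
have FN z : rnorm (F z) = rnorm z.
  by apply/eqP; rewrite eq_le F1 -{1}[z]GF G1.
(* The defect of F from being isometric is a form vanishing on the diagonal. *)
have : modulus (ip (F x) (F y) - ip x y) ^+ 2 <=
    complex.Re (ip (F x) (F x) - ip x x) * complex.Re (ip (F y) (F y) - ip y y).
  apply: (@psd_CauchySchwarz R H (fun a b => ip (F a) (F b) - ip a b)).
  - by move=> k a b c; rewrite Fl !ip_linl; ring.
  - by move=> k a b c; rewrite Fl !ip_lin; ring.
  - by move=> a; rewrite !ipE FN subrr.
rewrite !ipE !FN !subrr mulr0 => h; apply/eqP; rewrite -subr_eq0.
apply/eqP/modulus_eq0/eqP; rewrite -sqrf_eq0 eq_le h.
exact: sqr_ge0.
Qed.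

(** Existence comes with the equivalence: the operator on H is S pulled back along the unitary
    extending i v |-> j v. *)
Lemma transfer_unitary (H K : hilbertType R) (i : V -> H) (j : V -> K)
    (alpha : V -> V) (S : K -> K) :
  linear i -> linear j -> dense (range i) -> dense (range j) ->
  (forall u v, ip (i u) (i v) = ip (j u) (j v)) ->
  bounded_operator S -> (forall v, S (j v) = j (alpha v)) ->
  (exists T, bounded_operator T /\ forall v, T (i v) = i (alpha v)) /\
  forall T, bounded_operator T -> (forall v, T (i v) = i (alpha v)) ->
    unitarily_equivalent T S.
Proof.
move=> il jl i_dense j_dense e [Sl Sc] Sj.
have [F [G [[Fl Fc] [Gl Gc] [GF FG] Fip [Fi Gj]]]] :=
  isometry_unitary il jl i_dense j_dense e.
split.
  exists (G \o S \o F); split; last by move=> v /=; rewrite Fi Sj Gj.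
  split; first by move=> k a b /=; rewrite Fl Sl Gl.
  move=> a; apply: continuous_comp; first exact: Fc.
  by apply: continuous_comp; [exact: Sc|exact: Gc].
move=> T [Tl Tc] Ti; exists F.
  by split=> //; exists G.
have compl (A B C : hilbertType R) (f : A -> B) (g : B -> C) :
    linear f -> linear g -> linear (g \o f).
  by move=> fl gl k a b /=; rewrite fl gl.
have : F \o T = S \o F.
  apply: (dense_eq_bounded i_dense); [exact: compl| |exact: compl| |].
  - by move=> a; apply: continuous_comp; [exact: Tc|exact: Fc].
  - by move=> a; apply: continuous_comp; [exact: Fc|exact: Sc].
  - by move=> v /=; rewrite Ti !Fi Sj.
by move=> h x; move/(congr1 (fun f => f x)): h.
Qed.

Lemma unitarily_equivalent_sym (H K : hilbertType R) (T : H -> H) (S : K -> K) :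
  unitarily_equivalent T S -> unitarily_equivalent S T.
Proof.
move=> [U [Ul [W UW WU] Uip] UT]; exists W.
  split; last by move=> x y; rewrite -Uip !WU.
    by move=> k a b; rewrite -{1}[a]WU -{1}[b]WU -Ul UW.
  by exists U.
by move=> x; rewrite -{1}[x]WU -UT UW.
Qed.

Lemma unitarily_equivalent_trans (H K L : hilbertType R) (T : H -> H) (S : K -> K)
    (Q : L -> L) :
  unitarily_equivalent T S -> unitarily_equivalent S Q -> unitarily_equivalent T Q.
Proof.
move=> [U [Ul Ub Uip] UT] [W [Wl Wb Wip] WS]; exists (W \o U).
  split; last by move=> x y; rewrite /= Wip Uip.
    by move=> k a b /=; rewrite Ul Wl.
  exact: bij_comp.
by move=> x /=; rewrite UT WS.
Qed.

End Transfer.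

Section StarB0.
Variables (R : realType) (N : nat) (FA : fieldAlgebra R N).
Implicit Types (u v : B0 FA) (f : B0 FA -> B0 FA).
Let vA (u : B0 FA) : algA0 (val (repr u)) := algA0_val (repr u).

Lemma B0_starK : involutive (@B0_star R N FA).
Proof.
move=> u; rewrite -[u]cls_repr -!cls_star ?starK //; exact: algA0_star.
Qed.

Lemma B0_star_lin (k : R[i]) u v :
  B0_star (k *: u + v) = k^*%R *: B0_star u + B0_star v.
Proof.
rewrite -[u]cls_repr -[v]cls_repr -(clsZ k (vA u)) -(clsD (algA0Z k (vA u)) (vA v)).
rewrite -!cls_star //; last by apply: algA0D => //; exact: algA0Z.
rewrite star_lin clsD ?clsZ //; try exact: algA0_star.
by apply: algA0Z; exact: algA0_star.
Qed.

Lemma B0_starM u v : B0_star (u * v) = B0_star v * B0_star u.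
Proof.
rewrite -[u]cls_repr -[v]cls_repr -(clsM (vA u) (vA v)) -!cls_star //; last exact: algA0M.
by rewrite starM clsM //; exact: algA0_star.
Qed.

Lemma map_star_automorphism f : automorphism f -> automorphism (map_star f).
Proof.
move=> [fl fM fb]; split.
- by move=> k u v; rewrite /map_star B0_star_lin fl B0_star_lin conjCK.
- by move=> u v; rewrite /map_star B0_starM fM B0_starM.
- apply: bij_comp; last exact: bij_comp (inv_bij B0_starK).
  exact: (inv_bij B0_starK).
Qed.

Lemma map_invK f : bijective f -> cancel (map_inv f) f.
Proof.
move=> [g fK gK] u; rewrite /map_inv; case: xgetP => [v _ //|].
by move/(_ (g u)); rewrite /= gK.
Qed.

Lemma map_Kinv f : bijective f -> cancel f (map_inv f).
Proof. by move=> fb u; apply: (bij_inj fb); rewrite map_invK. Qed.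

Lemma map_inv_automorphism f : automorphism f -> automorphism (map_inv f).
Proof.
move=> [fl fM fb]; have fi := bij_inj fb; have K := map_invK fb; split.
- by move=> k u v; apply: fi; rewrite K fl !K.
- by move=> u v; apply: fi; rewrite K fM !K.
- by exists f; [exact: map_invK|exact: map_Kinv].
Qed.

Lemma automorphism1 f : automorphism f -> f 1 = 1.
Proof.
by move=> [_ fM [g _ gK]]; rewrite -[LHS]mulr1 -{2}(gK 1) -fM mul1r gK.
Qed.

End StarB0.

Section GNSSpace.
Variables (R : realType) (N : nat) (FA : fieldAlgebra R N) (H : hilbertType R).
Variables (w : B0 FA -> R[i]) (pi : B0 FA -> H -> H) (Om : H).
Hypothesis gns : gns_triple w pi Om.

Lemma gns_ip u v : ip (pi u Om) (pi v Om) = w (B0_star u * v).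
Proof.
case: gns => _ [_ [piM [_ pis]]] _ wE.
by rewrite wE piM pis.
Qed.

Lemma gns_linear : linear (fun u => pi u Om).
Proof. by case: gns => _ [pil _] _ _ k u v; rewrite pil. Qed.

Lemma gns_dense (phi psi : B0 FA -> B0 FA) : cancel psi phi ->
  dense (range (fun u => pi (phi u) Om)).
Proof.
case: gns => _ _ + _ K; congr dense.
apply/seteqP; split=> x [u _ <-]; last by exists (phi u).
by exists (psi u); rewrite ?K.
Qed.

End GNSSpace.

(** * The transfer matrix of a ground state and its square root *)

Section Vacuum.
Variables (R : realType) (N : nat) (FA : fieldAlgebra R N) (H : hilbertType R).
Variables (w : B0 FA -> R[i]) (pi : B0 FA -> H -> H) (Om : H).
Hypothesis gns : gns_triple w pi Om.
Variable alpha : B0 FA -> B0 FA.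
Hypothesis alpha_aut : automorphism alpha.
Hypothesis ground : ground_state w alpha.
Local Notation i := (fun u => pi u Om).

Lemma vacuum_transfer_sqrt : exists T S : H -> H,
  [/\ bounded_operator T /\ (forall u, T (i u) = i (alpha u)),
      linear S, (exists C : R, forall x, rnorm (S x) <= C * rnorm x),
      (forall u v, ip (S (i u)) (S (i v)) = w (B0_star u * alpha v)) &
      (forall u, T (S (i u)) = S (i (alpha u))) /\ forall x, S (S x) = T x].
Proof.
have il : linear i := gns_linear gns.
have i_dense : dense (range i) := gns_dense gns (phi := id) (psi := id) (fun _ => erefl).
have [al _ _] := alpha_aut.
have iB u v : i (u - v) = i u - i v by exact: (linear_funB il).
pose B u v := ip (i u) (i v - i (alpha v)).
have Bl k x y z : B (k *: x + y) z = k^*%R * B x z + B y z.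
  by rewrite /B (il k x y) ip_linl.
have Br k x y z : B x (k *: y + z) = k * B x y + B x z.
  rewrite /B al (il k y z) (il k (alpha y) (alpha z)) -ip_lin; congr (ip _ _).
  by rewrite scalerBr opprD addrACA.
have BE u : B u u = w (B0_star u * u) - w (B0_star u * alpha u).
  by rewrite /B ipBr !(gns_ip gns).
have B_ge0 u : 0 <= B u u.
  by rewrite BE subr_ge0; case: ground => _ /(_ u)/andP[].
have B_le u : complex.Re (B u u) <= rnorm (i u) ^+ 2.
  have : B u u <= ip (i u) (i u).
    by rewrite BE (gns_ip gns) gerBl; case: ground => _ /(_ u)/andP[].
  by rewrite ipE; have /ge0_complexP[-> _] := B_ge0 u; rewrite lecR.
(* With n the left-hand side, B (u - alpha u) u = n^2, so Cauchy-Schwarz for B and the bound of B by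
   the norm give n^4 <= n^2 rnorm (i u)^2. *)
have contr u : rnorm (i u - i (alpha u)) <= rnorm (i u).
  set n := rnorm (i u - i (alpha u)).
  have n0 : 0 <= n by exact: rnorm_ge0.
  have := psd_CauchySchwarz Bl Br B_ge0 (u - alpha u) u.
  have -> : B (u - alpha u) u = (n ^+ 2)%:C by rewrite /B iB ipE.
  have -> : modulus (n ^+ 2)%:C = n ^+ 2.
    by rewrite /modulus ger0_norm // -[0]/(0%:C) lecR sqr_ge0.
  have h1 := B_le (u - alpha u); rewrite iB -/n in h1.
  have h2 := B_le u; have /ge0_complexP[_ p1] := B_ge0 (u - alpha u).
  have /ge0_complexP[_ p2] := B_ge0 u.
  move/le_trans => /(_ _ (ler_pM p1 p2 h1 h2)).
  have [->|nn] := eqVneq n 0; first by rewrite rnorm_ge0.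
  have np : 0 < n by rewrite lt_def nn.
  rewrite [(n ^+ 2) ^+ 2]expr2 ler_pM2l ?exprn_gt0 //.
  by rewrite ler_pXn2r ?nnegrE // rnorm_ge0.
have jl : linear (fun u => i u - i (alpha u)).
  move=> k u v; rewrite al (il k u v) (il k (alpha u) (alpha v)).
  by rewrite scalerBr opprD addrACA.
have [X [Xl Xc X1 Xi]] := dense_extension il jl i_dense contr.
have Xsym := dense_symmetric i_dense Xl X1.
have {}Xsym : forall x y, ip x (X y) = ip (X x) y.
  apply: Xsym => u v; rewrite !Xi -[LHS]/(B u v) (psd_hermitian Bl Br B_ge0 v u).
  by rewrite [RHS]ip_conj.
have [S [Sl SC Ssym SS SX]] := operator_sqrt Xl Xsym X1.
exists (fun x => x - X x), S; split=> //.
- split; last by move=> u; rewrite Xi opprB addrC subrK.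
  split; first by move=> k a c; rewrite Xl scalerBr opprD addrACA.
  by move=> a; apply: cvgB; [exact: cvg_id|exact: Xc].
- move=> u v; rewrite -Ssym SS Xi opprB addrC subrK; exact: gns_ip.
- split=> // u; rewrite -SX.
  by rewrite -(linear_funB Sl) Xi opprB addrC subrK.
Qed.

(* The vectors S (pi u Om) realise the form w (u^* alpha u), so that they carry
   the GNS representation of states conjugate to it. *)
Lemma vacuum_transfer_equivalence : exists T : H -> H,
  forall (K : hilbertType R) (w' : B0 FA -> R[i]) (pi' : B0 FA -> K -> K) (Om' : K)
    (phi alpha' : B0 FA -> B0 FA),
  gns_triple w' pi' Om' -> linear phi -> bijective phi ->
  (forall u, alpha' (phi u) = phi (alpha u)) ->
  ((forall u v, w' (B0_star (phi u) * phi v) = w (B0_star u * v)) \/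
   (forall u v, w' (B0_star (phi u) * phi v) = w (B0_star u * alpha v))) ->
  (exists T', transfer_matrix pi' Om' alpha' T') /\
  forall T', transfer_matrix pi' Om' alpha' T' -> unitarily_equivalent T' T.
Proof.
have [T [S [[Tb Ti] Sl [C SC] Sw [TS SS]]]] := vacuum_transfer_sqrt.
(* T is fixed before the second representation, so that one operator serves all four states. *)
exists T => K w' pi' Om' phi alpha' gns' phil [psi phiK psiK] phi_alpha ww.
have [al _ [beta alK betaK]] := alpha_aut.
have i_dense : dense (range i) := gns_dense gns (phi := id) (psi := id) (fun _ => erefl).
have k_dense : dense (range (fun u => pi' (phi u) Om')) := gns_dense gns' psiK.
have kl : linear (fun u => pi' (phi u) Om').
  by move=> k u v; rewrite phil (gns_linear gns').
have Si_dense : dense (range (fun u => S (i u))).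
  apply: dense_rnormP => x e e0; have e2 : 0 < e / 2 by rewrite divr_gt0.
  have C1 : 0 < `|C| + 1 by rewrite ltr_wpDl.
  (* Approximate x by i (alpha v) = S (S (i v)), then the inner S (i v) by some i u; S is bounded by
     C. *)
  have [v hv] := dense_rnorm (gns_dense gns betaK) x e2.
  have [u hu] := dense_rnorm i_dense (S (i v)) (divr_gt0 e2 C1).
  exists u; apply: le_lt_trans (rnorm_tri (i (alpha v)) _ _) _.
  have : rnorm (S (S (i v) - i u)) <= e / 2.
    apply: le_trans (SC _) _; apply: (@le_trans _ _ ((`|C| + 1) * rnorm (S (i v) - i u))).
      by rewrite ler_wpM2r ?rnorm_ge0 // (le_trans (ler_norm C)) // lerDl.
    by rewrite mulrC -ler_pdivlMr // ltW.
  by rewrite (linear_funB Sl) SS Ti; move: hv; lra.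
have transferP T' : transfer_matrix pi' Om' alpha' T' <->
    bounded_operator T' /\ forall u, T' (pi' (phi u) Om') = pi' (phi (alpha u)) Om'.
  split=> -[T'b T'E]; split=> // u; first by rewrite T'E phi_alpha.
  by rewrite -[u]psiK T'E phi_alpha.
have [j [jl jd jip jT]] : exists j : B0 FA -> H, [/\ linear j, dense (range j),
    (forall u v, ip (pi' (phi u) Om') (pi' (phi v) Om') = ip (j u) (j v)) &
    forall u, T (j u) = j (alpha u)].
  case: ww => ww; [exists i|exists (fun u => S (i u))]; split=> //.
  - exact: gns_linear gns.
  - by move=> u v; rewrite (gns_ip gns') ww (gns_ip gns).
  - by move=> k u v; rewrite (gns_linear gns k u v) Sl.
  - by move=> u v; rewrite (gns_ip gns') ww Sw.
have [[T' T'P] eqv] := transfer_unitary kl jl k_dense jd jip Tb jT.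
split; first by exists T'; apply/transferP.
by move=> T'' /transferP[T''b T''E]; exact: eqv.
Qed.

End Vacuum.

Lemma real_couplings_of (R : realType) (N : nat) (g h : 'I_N -> R) (c : couplings R N) :
  couplings_of g h c -> real_couplings c.
Proof.
move=> c_def f m [] ->; rewrite /fourier_re; have [h1 h2 h3 h4] := c_def m.
- by rewrite h1.
- by rewrite h2.
- by rewrite h3.
- by rewrite h4.
Qed.

Local Close Scope classical_set_scope.

Theorem corollary5p2
  (R : realType) (N : nat) (N_ge2 : (2 <= N)%N) (FA : fieldAlgebra R N)
  (g h : 'I_N -> R) (g_adm : admissible g) (h_adm : admissible h)
  (c : couplings R N) (c_def : couplings_of g h c)
  (* beta and beta' as automorphisms of B0 *)
  (b b' : B0 FA -> B0 FA)
  (b_aut : automorphism b) (b_def : induces_map (beta c) b)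
  (b'_aut : automorphism b') (b'_def : induces_map (beta (dual_couplings c)) b')
  (* the vacuum, on F0 and on B0 *)
  (omega0 : FA -> complex R) (omega0_lim : infinite_volume_limit c omega0)
  (w0 : B0 FA -> complex R) (w0_def : induces_functional omega0 w0)
  (w0_ground : ground_state w0 (map_star_inv b \o b))
  (* the duality *)
  (Delta : B0 FA -> B0 FA) (Delta_def : duality Delta)
  (* GNS triples of omega_0, ..., omega_3 *)
  (H : 'I_4 -> hilbertType R)
  (pi : forall a, B0 FA -> H a -> H a) (Om : forall a, H a)
  (gns : forall a, gns_triple (vacuum_states w0 b Delta a) (pi a) (Om a)) :
  (forall a, is_state (vacuum_states w0 b Delta a)) /\
  (forall a, exists! T, transfer_matrix (pi a) (Om a) (alpha_i b b' a) T) /\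
  (forall T : forall a, H a -> H a,
    (forall a, transfer_matrix (pi a) (Om a) (alpha_i b b' a) (T a)) ->
    forall a a', unitarily_equivalent (T a) (T a')).
Proof.
have N_gt0 : (0 < N)%N by apply: leq_trans N_ge2.
have dual := Delta_beta N_gt0 (real_couplings_of c_def) b_def b'_def Delta_def.
have [[D_aut D_star] _ _] := Delta_def.
have [Dl DM Db] := D_aut; have [bl bM bb] := b_aut.
pose bi := map_star_inv b; pose bi' := map_star_inv b'.
have bi_aut : automorphism bi by apply/map_inv_automorphism/map_star_automorphism.
have [bil biM bib] := bi_aut.
have biK : cancel (map_star b) bi.
  by apply: map_Kinv; have [] := map_star_automorphism b_aut.
have Kbi' : cancel bi' (map_star b').
  by apply: map_invK; have [] := map_star_automorphism b'_aut.
have alpha_aut : automorphism (bi \o b).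
  split; last exact: bij_comp.
    by move=> k u v /=; rewrite bl bil.
  by move=> u v /=; rewrite bM biM.
have Dbeta u : Delta (b' u) = bi (Delta u) by rewrite -(dual u) biK.
(* This is [dual] at the adjoint of [bi' u], with [star] taken on both sides. *)
have Dbi' u : Delta (bi' u) = b (Delta u).
  rewrite -[u in RHS]Kbi'; set v := bi' u.
  have := dual (B0_star v); rewrite /map_star -!D_star -/(map_star b' v).
  move=> /(congr1 (@B0_star R N FA)).
  by rewrite !B0_starK !D_star !B0_starK.
(* omega_1 (b u)^* (b v) = omega_0 (u^* alpha v) *)
have bi_star u v : bi (B0_star (b u) * b v) = B0_star u * bi (b v).
  rewrite biM; congr (_ * _); rewrite -[RHS]biK /map_star B0_starK.
  by [].
have [w0_state w0_pos] := w0_ground.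
have [T0 HT0] := vacuum_transfer_equivalence (gns ord0) alpha_aut w0_ground.
pose Di := map_inv Delta.
have DiK : cancel Di Delta by exact: map_invK.
have KDi : cancel Delta Di by exact: map_Kinv.
have [Dil Dib] : linear Di /\ bijective Di by have [] := map_inv_automorphism D_aut.
have Di_star u v : Delta (B0_star (Di u) * Di v) = B0_star u * v.
  by rewrite DM D_star !DiK.
have [binv bK Kb] := bb.
(* [bi] need not preserve adjoints; positivity at b u is the lower ground state bound for w0 at
   u. *)
have state1 : is_state (w0 \o bi).
  have [wl w1 wp] := w0_state; split.
  - by move=> k u v /=; rewrite bil wl.
  - by rewrite /= (automorphism1 bi_aut).
  - by move=> u; rewrite /= -[u]Kb bi_star; have /andP[] := w0_pos (binv u).
have state_Delta w : is_state w -> is_state (w \o Delta).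
  move=> [wl w1 wp]; split.
  - by move=> k u v /=; rewrite Dl wl.
  - by rewrite /= (automorphism1 D_aut).
  - by move=> u; rewrite /= DM D_star.
have states a : is_state (vacuum_states w0 b Delta a).
  case: a => [[|[|[|[|]]]]] // a4; first exact: (state_Delta (w0 \o bi)).
  exact: (state_Delta w0).
(* For a = 0, 1, 2, 3 the map phi is the identity, b, Delta^-1 b and Delta^-1. *)
have param a : exists phi : B0 FA -> B0 FA,
    [/\ linear phi, bijective phi,
        forall u, alpha_i b b' a (phi u) = phi ((bi \o b) u) &
        (forall u v, vacuum_states w0 b Delta a (B0_star (phi u) * phi v) =
                     w0 (B0_star u * v)) \/
        (forall u v, vacuum_states w0 b Delta a (B0_star (phi u) * phi v) =
                     w0 (B0_star u * (bi \o b) v))].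
  case: a => [[|[|[|[|]]]]] // a4.
  - by exists id; split=> //; [exists id|left].
  - by exists b; split=> //; right=> u v; exact: (congr1 w0 (bi_star u v)).
  - exists (Di \o b); split=> [k u v||u|] /=.
    + by rewrite bl Dil.
    + exact: bij_comp.
    + by rewrite -/bi' -[LHS]KDi Dbi' Dbeta DiK.
    + right=> u v; apply: etrans (congr1 w0 (bi_star u v)).
      exact: (congr1 (w0 \o bi) (Di_star (b u) (b v))).
  - exists Di; split=> //; first by move=> u /=; rewrite -/bi' -[LHS]KDi Dbeta Dbi' DiK.
    by left=> u v; exact: (congr1 w0 (Di_star u v)).
have transfer a : (exists T', transfer_matrix (pi a) (Om a) (alpha_i b b' a) T') /\
    forall T', transfer_matrix (pi a) (Om a) (alpha_i b b' a) T' ->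
      unitarily_equivalent T' T0.
  have [phi [phil phib phi_alpha ww]] := param a.
  exact: HT0 (gns a) phil phib phi_alpha ww.
split=> //; split=> [a|T HT a a'].
  have [[T HT] _] := transfer a; exists T; split=> // S [[Sl Sc] SE].
  case: HT => -[Tl Tc] TE.
  have d := gns_dense (gns a) (phi := id) (psi := id) (fun _ => erefl).
  apply: (dense_eq_bounded d) => // u.
  by rewrite TE SE.
have [_ /(_ _ (HT a)) e] := transfer a; have [_ /(_ _ (HT a')) e'] := transfer a'.
exact: unitarily_equivalent_trans e (unitarily_equivalent_sym e').
Qed.
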